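(* Let $(Y,\lambda)$ be a closed contact three-manifold and let $L>0$. Then $$\mathrm{Box}^L(Y,\lambda)\le\mathrm{Close}^L(Y,\lambda).$$
   Context: A closed contact three-manifold $(Y,\lambda)$ is a closed oriented $3$-manifold $Y$ with a contact form $\lambda$, i.e. a $1$-form with $\lambda\wedge d\lambda>0$ everywhere. The Reeb vector field $R$ is characterized by $d\lambda(R,\cdot)=0$, $\lambda(R)=1$. A Reeb orbit is a periodic orbit $\gamma:\mathbb{R}/T\mathbb{Z}\to Y$, $T>0$, with $\gamma'(t)=R(\gamma(t))$, modulo translations of the domain; its action is $T$. The contact volume is $\mathrm{vol}(Y,\lambda)=\int_Y\lambda\wedge d\lambda$. Thickened Reeb trajectory: given $A,L>0$, a thickened Reeb trajectory in $(Y,\lambda)$ of area $A$ and length $L$ is a smooth embedding $\varphi:[0,L]\times D\to Y$, where $D$ is a closed disk (centered at the origin of the plane) of area $A$, such that $\varphi^*\lambda=dt+\frac12r^2\,d\theta$, where $t$ is the $[0,L]$ coordinate and $(r,\theta)$ are polar coordinates on $D$. $\mathrm{Box}^L(Y,\lambda)\in\{-\infty\}\cup(0,\mathrm{vol}(Y,\lambda)/L]$ is the supremum (with $\sup\emptyset=-\infty$) of $A>0$ such that there exists a thickened Reeb trajectory in $(Y,\lambda)$ of area $A$ and length $L$. Positive deformation: let $\mathcal{U}\subset Y$ be a nonempty open set. A positive deformation of $\lambda$ supported in $\mathcal{U}$ is a smooth one-parameter family of contact forms $\{\lambda_\tau=e^{f_\tau}\lambda\}_{\tau\in[0,1]}$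 such that $f_0\equiv 0$; $f_\tau(y)=0$ for all $\tau\in[0,1]$ and $y\in Y\setminus\mathcal{U}$; and $f_1\ge 0$ with $f_1$ not identically zero. Gromov width: for a symplectic $4$-manifold $(X,\omega)$, $c_{\mathrm{Gr}}(X,\omega)\in(0,\infty]$ is the supremum of $a>0$ such that there is a symplectic embedding $B^4(a)\to(X,\omega)$, where $B^4(a)=\{z\in\mathbb{C}^2\mid \pi|z|^2\le a\}$ with the restriction of the standard symplectic form $\sum_{i=1}^2dx_i\,dy_i$. Width: for a positive deformation $\{\lambda_\tau=e^{f_\tau}\lambda\}_{\tau\in[0,1]}$ of $\lambda$ supported in a nonempty open set $\mathcal{U}\subset Y$, let $M_{\lambda_1}=\{(s,y)\in\mathbb{R}\times Y\mid 0<s<f_1(y)\}$ with the symplectic form $d(e^s\lambda)$; then $\mathrm{width}(\{\lambda_\tau\})=c_{\mathrm{Gr}}(M_{\lambda_1})$. $\mathrm{Close}^L(Y,\lambda)\in[0,\infty]$ is the infimum (with $\inf\emptyset=+\infty$) of $\delta>0$ with the following property: for every nonempty open set $\mathcal{U}\subset Y$ and every positive deformation $\{\lambda_\tau\}_{\tau\in[0,1]}$ of $\lambda$ supported in $\mathcal{U}$ with $\mathrm{width}(\{\lambda_\tau\})\ge\delta$, there is some $\tau\in[0,1]$ such that the contact form $\lambda_\tau$ has a Reeb orbit intersecting $\mathcal{U}$ with action at most $L$. *)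

(* Defs.v *)
From HB Require Import structures.
From mathcomp Require Import all_boot all_order all_algebra.
From mathcomp Require Import all_classical all_reals all_analysis.

Set Implicit Arguments.
Unset Strict Implicit.
Unset Printing Implicit Defensive.

Import Order.TTheory GRing.Theory Num.Theory.
Import numFieldNormedType.Exports.

Local Open Scope classical_set_scope.
Local Open Scope ring_scope.

(* A smooth manifold is given by an explicit atlas, and tangent vectors and
   forms by their components in its charts, related by the differentials of the
   transition maps.  The model spaces are the finite-dimensional spaces
   'rV[R]_n and R^o * 'rV[R]_n. *)

Section Smoothness.
Context {R : realType}.

(* For finite-dimensional V: f is C^k on the open set U.  The clause 0 is
   continuity at the points of U; in the clause k.+1 it is enough that every
   directional derivative be C^k. *)
Fixpoint Ck (V W : normedModType R) (k : nat) (U : set V) (f : V -> W) : Prop :=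
  match k with
  | 0 => forall x, U x -> {for x, continuous f}
  | k'.+1 => (forall x, U x -> differentiable f x) /\
             (forall v, Ck k' U (fun x => 'D_v f x))
  end.

Definition smooth_open (V W : normedModType R) (U : set V) (f : V -> W) : Prop :=
  open U /\ forall k, Ck k U f.

(* Smoothness on an arbitrary subset: local smooth extendability. *)
Definition smooth_on (V W : normedModType R) (K : set V) (f : V -> W) : Prop :=
  forall p, K p -> exists (N : set V) (g : V -> W),
    [/\ N p, smooth_open N g & forall q, N q -> K q -> f q = g q].

End Smoothness.

Section Manifolds.
Context {R : realType}.

(* A family of charts chart_coord i : chart_dom i -> V, with inverses chart_par i.
   The maps are total functions, meaningless outside chart_dom i (resp. outside
   the image of chart_dom i). *)
Record charted (V : normedModType R) (T : topologicalType) := Charted {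
  chart_idx : Type;
  chart_dom : chart_idx -> set T;
  chart_coord : chart_idx -> T -> V;
  chart_par : chart_idx -> V -> T }.

Definition chart_im (V : normedModType R) (T : topologicalType)
    (S : charted V T) (i : chart_idx S) : set V :=
  chart_coord i @` chart_dom i.

Definition transition (V : normedModType R) (T : topologicalType)
    (S : charted V T) (i j : chart_idx S) : V -> V :=
  chart_coord j \o chart_par i.

Definition smooth_atlas (V : normedModType R) (T : topologicalType)
    (S : charted V T) : Prop :=
  [/\ forall y, exists i : chart_idx S, chart_dom i y,
      forall i : chart_idx S, open (chart_dom i) /\ open (chart_im i),
      forall (i : chart_idx S) y, chart_dom i y ->
        chart_par i (chart_coord i y) = y /\ {for y, continuous (chart_coord i)},
      forall (i : chart_idx S) x, chart_im i x ->
        {for x, continuous (chart_par i)} &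
      forall i j : chart_idx S,
        smooth_open (chart_coord i @` (chart_dom i `&` chart_dom j))
                    (transition i j)].

Definition oriented_atlas (n : nat) (T : topologicalType)
    (S : charted 'rV[R]_n T) : Prop :=
  forall (i j : chart_idx S) y, chart_dom i y -> chart_dom j y ->
    0 < \det ('J (transition i j) (chart_coord i y)).

Definition closed_oriented_manifold (n : nat) (T : topologicalType)
    (S : charted 'rV[R]_n T) : Prop :=
  [/\ compact [set: T], hausdorff_space T, smooth_atlas S & oriented_atlas S].

(* The product manifold R * T, with the products of the charts of T with the
   identity of R. *)
Definition line_prod (V : normedModType R) (T : topologicalType)
    (S : charted V T) : charted (R^o * V)%type (R^o * T)%type :=
  @Charted (R^o * V)%type (R^o * T)%type (chart_idx S)
    (fun i p => chart_dom i p.2)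
    (fun i p => (p.1, chart_coord i p.2))
    (fun i x => (x.1, chart_par i x.2)).

(* al i y v is the value of the form at y, for y in chart_dom i, on the tangent
   vector at y whose components in the chart i are v. *)
Definition form1 (V : normedModType R) (T : topologicalType) (S : charted V T) :=
  chart_idx S -> T -> V -> R.
Definition form2 (V : normedModType R) (T : topologicalType) (S : charted V T) :=
  chart_idx S -> T -> V -> V -> R.

Definition smooth_form1 (V : normedModType R) (T : topologicalType)
    (S : charted V T) (al : form1 S) : Prop :=
  [/\ forall i y, chart_dom i y -> forall a u v,
        al i y (a *: u + v) = a * al i y u + al i y v,
      forall i j y, chart_dom i y -> chart_dom j y -> forall v,
        al i y v = al j y ('d (transition i j) (chart_coord i y) v) &
      forall i v, smooth_open (chart_im i)
                    (fun x => al i (chart_par i x) v : R^o)].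

(* d al (u, v) = u (al v) - v (al u) for constant fields u, v in the chart i. *)
Definition ext_d (V : normedModType R) (T : topologicalType)
    (S : charted V T) (al : form1 S) : form2 S :=
  fun i y u v =>
    'D_u (fun x => al i (chart_par i x) v : R^o) (chart_coord i y)
    - 'D_v (fun x => al i (chart_par i x) u : R^o) (chart_coord i y).

Definition scale_form (V : normedModType R) (T : topologicalType)
    (S : charted V T) (h : T -> R) (al : form1 S) : form1 S :=
  fun i y v => h y * al i y v.

Definition smooth_homotopy (V : normedModType R) (T : topologicalType)
    (S : charted V T) (f : R -> T -> R) : Prop :=
  forall i : chart_idx S,
    smooth_on [set x : (R^o * V)%type | 0 <= x.1 <= 1 /\ chart_im i x.2]
              (fun x => f x.1 (chart_par i x.2) : R^o).

End Manifolds.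

Section Embeddings.
Context {R : realType}.

(* Near p, the map phi on K read in the chart i is the restriction of the smooth
   map g.  The differential of phi at p in the chart i is then 'd g p; it does
   not depend on g when K is contained in the closure of its interior, as are
   the balls and boxes below. *)
Definition local_rep (E V : normedModType R) (T : topologicalType)
    (S : charted V T) (K : set E) (phi : E -> T) (p : E)
    (i : chart_idx S) (g : E -> V) : Prop :=
  exists N : set E, [/\ N p, smooth_open N g &
    forall q, N q -> K q -> chart_dom i (phi q) /\ chart_coord i (phi q) = g q].

Definition smooth_embedding (E V : normedModType R) (T : topologicalType)
    (S : charted V T) (K : set E) (phi : E -> T) : Prop :=
  [/\ forall p, K p -> exists (i : chart_idx S) (g : E -> V),
        local_rep K phi p i g,
      forall p, K p -> forall (i : chart_idx S) (g : E -> V),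
        local_rep K phi p i g -> injective ('d g p),
      forall p q, K p -> K q -> phi p = phi q -> p = q &
      (* continuity of the inverse phi K -> K *)
      forall p, K p -> forall N : set E, nbhs p N ->
        \forall y \near phi p, forall q, K q -> phi q = y -> N q].

Definition pullback1_eq (E V : normedModType R) (T : topologicalType)
    (S : charted V T) (K : set E) (phi : E -> T) (al : form1 S)
    (be : E -> E -> R) : Prop :=
  forall p, K p -> forall (i : chart_idx S) (g : E -> V),
    local_rep K phi p i g -> forall u, al i (phi p) ('d g p u) = be p u.

Definition pullback2_eq (E V : normedModType R) (T : topologicalType)
    (S : charted V T) (K : set E) (phi : E -> T) (om : form2 S)
    (be : E -> E -> E -> R) : Prop :=
  forall p, K p -> forall (i : chart_idx S) (g : E -> V),
    local_rep K phi p i g ->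
    forall u v, om i (phi p) ('d g p u) ('d g p v) = be p u v.

End Embeddings.

Section GromovWidth.
Context {R : realType}.

(* C^2 is identified with R^4 by the coordinates (x1, y1, x2, y2). *)
Definition ball4 (a : R) : set 'rV[R]_4 :=
  [set z | pi * (\sum_(k < 4) z ord0 k ^+ 2) <= a].

Definition omega_std (z u v : 'rV[R]_4) : R :=
  let c (w : 'rV[R]_4) (k : nat) := w ord0 (inord k) in
  (c u 0 * c v 1 - c u 1 * c v 0) + (c u 2 * c v 3 - c u 3 * c v 2).

(* The Gromov width of the open subset M of T with the symplectic form om. *)
Definition gromov_width (V : normedModType R) (T : topologicalType)
    (S : charted V T) (om : form2 S) (M : set T) : \bar R :=
  ereal_sup [set a%:E | a in [set a : R | 0 < a /\
    exists phi : 'rV[R]_4 -> T,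
      [/\ smooth_embedding S (ball4 a) phi,
          forall z, ball4 a z -> M (phi z) &
          pullback2_eq (ball4 a) phi om omega_std]]].

End GromovWidth.

Section Contact.
Context {R : realType} {Y : topologicalType} (S : charted 'rV[R]_3 Y).
Implicit Types (lam : form1 S) (f : R -> Y -> R).

(* (lam /\ d lam)(e0, e1, e2) in each chart of the oriented atlas. *)
Definition wedge_d lam (i : chart_idx S) (y : Y) : R :=
  let e (k : nat) : 'rV[R]_3 := delta_mx ord0 (inord k) in
  lam i y (e 0) * ext_d lam i y (e 1) (e 2)
  + lam i y (e 1) * ext_d lam i y (e 2) (e 0)
  + lam i y (e 2) * ext_d lam i y (e 0) (e 1).

Definition contact_form lam : Prop :=
  smooth_form1 lam /\ forall i y, chart_dom i y -> 0 < wedge_d lam i y.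

(* v is the vector of components, in the chart i, of the Reeb field at y. *)
Definition is_reeb lam (i : chart_idx S) (y : Y) (v : 'rV[R]_3) : Prop :=
  (forall u, ext_d lam i y v u = 0) /\ lam i y v = 1.

(* A Reeb orbit of action A: an A-periodic map gamma : R -> Y with
   gamma' = Reeb field.  Reparametrization by translation does not affect any
   of the properties considered, so the quotient is not taken. *)
Definition reeb_orbit lam (A : R) (gamma : R -> Y) : Prop :=
  [/\ 0 < A, forall t, gamma (t + A) = gamma t, continuous gamma &
      forall t i, chart_dom i (gamma t) ->
        exists v : 'rV[R]_3, is_reeb lam i (gamma t) v /\
          is_derive (t : R^o) 1 (chart_coord i \o gamma : R^o -> 'rV[R]_3) v].

Definition disk (A : R) : set 'rV[R]_2 :=
  [set z | pi * (z ord0 ord0 ^+ 2 + z ord0 ord_max ^+ 2) <= A].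

(* dt + (1/2) r^2 d theta, where r^2 d theta = x dy - y dx. *)
Definition box_form (p w : (R^o * 'rV[R]_2)%type) : R :=
  w.1 + (p.2 ord0 ord0 * w.2 ord0 ord_max
         - p.2 ord0 ord_max * w.2 ord0 ord0) / 2.

Definition thickened_reeb_trajectory lam (A L : R)
    (phi : (R^o * 'rV[R]_2)%type -> Y) : Prop :=
  let K := [set p : (R^o * 'rV[R]_2)%type | 0 <= p.1 <= L /\ disk A p.2] in
  smooth_embedding S K phi /\ pullback1_eq K phi lam box_form.

Definition Box lam (L : R) : \bar R :=
  ereal_sup [set A%:E | A in [set A : R | 0 < A /\
    exists phi, thickened_reeb_trajectory lam A L phi]].

Definition deform lam f (tau : R) : form1 S :=
  scale_form (fun y => expR (f tau y)) lam.

Definition positive_deformation lam (U : set Y) f : Prop :=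
  [/\ smooth_homotopy S f,
      forall tau, 0 <= tau <= 1 -> contact_form (deform lam f tau),
      forall y, f 0 y = 0,
      forall tau y, 0 <= tau <= 1 -> ~ U y -> f tau y = 0 &
      (forall y, 0 <= f 1 y) /\ exists y, f 1 y != 0].

(* The primitive e^s lam, on R * Y, of the symplectic form of M_{lam_1}. *)
Definition liouville lam : form1 (line_prod S) :=
  fun i p w => expR p.1 * lam i p.2 w.2.

Definition width lam f : \bar R :=
  gromov_width (ext_d (liouville lam))
    [set p : (R^o * Y)%type | 0 < p.1 < f 1 p.2].

Definition closing_property lam (L delta : R) : Prop :=
  forall (U : set Y) f, open U -> U !=set0 ->
    positive_deformation lam U f -> (delta%:E <= width lam f)%E ->
    exists tau : R, 0 <= tau <= 1 /\
      exists (A : R) (gamma : R -> Y),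
        [/\ reeb_orbit (deform lam f tau) A gamma, A <= L &
            exists t, U (gamma t)].

Definition Close lam (L : R) : \bar R :=
  ereal_inf [set delta%:E | delta in
    [set delta : R | 0 < delta /\ closing_property lam L delta]].

End Contact.

(* Main.v *)
From HB Require Import structures.
Require Import Defs.
From mathcomp Require Import all_boot all_order all_algebra.
From mathcomp Require Import all_classical all_reals all_analysis.
From mathcomp Require Import ring lra.

Set Implicit Arguments.
Unset Strict Implicit.
Unset Printing Implicit Defensive.

Import Order.TTheory GRing.Theory Num.Theory.
Import numFieldNormedType.Exports.

Local Open Scope classical_set_scope.
Local Open Scope ring_scope.

(** Let phi be a thickened Reeb trajectory of area A and length L, and let
    delta < A. There is a positive deformation of lam, supported in the image U of
    the open tube, of width at least delta, none of whose forms has a Reeb orbit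
    of action at most L through U. Hence delta does not have the closing property,
    and every delta that has it is at least A.

    In the tube lam is dt + r^2 dtheta / 2. The forms of the deformation are
    expR (tau * H) * lam, where H is a function of t and r^2 with compact support
    in the open tube. Write f for tau * H. Two cases of the equation of the Reeb
    field of expR f * lam suffice (lemma tube_reeb). Paired with the radial vector,
    it shows that the axial component of the Reeb vector is
    expR (- f) * (1 + r f_r / 2), which lies in ]0, 1] if H decreases with r, but
    so slowly that r H_r > -2. Paired with the generator of the rotations, it
    shows that expR f * r^2 is constant along the orbits. So an orbit through U
    does not reach the lateral boundary of the tube; it crosses the tube from one
    end to the other, which takes a time at least L, and its axial coordinate
    increases meanwhile, so that it cannot close up in a time at most L (lemmas
    transit, exit_axial and no_short_orbit).

    In the coordinates e^s - 1, t, e^(s / 2) z the symplectic form d (e^s lam) over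
    the tube is the standard one. A ball of capacity delta is mapped there by a
    linear symplectic map that stretches the first coordinate by a large factor k
    and compresses t by the same factor. The image is short in the direction of
    t, and it is below the graph of H if e^H is almost A / (pi r^2) where this
    exceeds 1, up to a large bound (lemmas ball_height and ball_below_bump). This
    is compatible with r H_r > -2, since A / (pi r^2) is the borderline case; the
    room for the approximation is A - delta.

    The rest is calculus. The exterior derivative commutes with pullbacks, by
    Schwarz' theorem (lemma ext_d_pullback). The inverse function theorem (lemma
    inverse_smooth) shows that U is open and that the inverse of phi is smooth
    there, so that H defines a smooth function on Y. The contact condition for
    expR f * lam is automatic (lemma contact_form_scale). *)


(** * Differentials and functions of class C^k *)

Section DifferentialCriterion.
Context {R : realType} {V W : normedModType R}.

Lemma diff_le (f : V -> W) (x : V) : differentiable f x ->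
  forall e : R, 0 < e ->
    \forall y \near x, `|f y - f x - 'd f x (y - x)| <= e * `|y - x|.
Proof.
move=> dfx e e0; have /diff_locallyP[_ /eqaddoP/(_ e e0)] := dfx.
rewrite [X in X -> _](near_shift x 0); apply: filterS => y.
by rewrite /= !fctE /= sub0r addrNK opprD addrA.
Qed.

Lemma is_diff_le (f : V -> W) (x : V) (df : {linear V -> W}) : continuous df ->
  (forall e : R, 0 < e ->
    \forall y \near x, `|f y - f x - df (y - x)| <= e * `|y - x|) ->
  is_diff x f df.
Proof.
move=> dfc H.
have E : f \o shift x = cst (f x) + df +o_ 0 id.
  apply/eqaddoP => e e0; have := H e e0.
  rewrite [X in X -> _](near_shift 0 x); apply: filterS => h.
  by rewrite /= !fctE /= subr0 addrK opprD addrA.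
have D := diff_unique dfc E.
by split => //; apply/diff_locallyP; rewrite D.
Qed.

Lemma is_diffW (f : V -> W) (x : V) (df : V -> W) :
  is_diff x f df -> differentiable f x /\ 'd f x = df :> (V -> W).
Proof. by case. Qed.

Lemma near_eq_is_diff (f g : V -> W) (x : V) (df : V -> W) :
  (\forall y \near x, f y = g y) -> is_diff x g df -> is_diff x f df.
Proof.
move=> fg [dg dgE]; rewrite -dgE.
apply: is_diff_le => [|e e0]; first exact: diff_continuous.
have := diff_le dg e0; have fgx := nbhs_singleton fg.
by apply: filterS2 fg => y /= -> ; rewrite fgx.
Qed.

End DifferentialCriterion.

Lemma exists_linear (R : realType) (V W : lmodType R) (f : V -> W) :
  linear f -> exists g : {linear V -> W}, f = g.
Proof.
move=> lf; pose m := GRing.isLinear.Build R V W *:%R f lf.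
by pose g : {linear V -> W} := HB.pack f m; exists g.
Qed.

(** Finite dimension in the form needed by the chain rule and by Schwarz'
    theorem: every vector is a combination of finitely many fixed vectors, with
    coefficients that are continuous linear functions of it. *)
Record frame (R : realType) (W : normedModType R) := Frame {
  fdim : nat;
  fvec : 'I_fdim -> W;
  fcoord : 'I_fdim -> {linear W -> R^o};
  fcoord_cont : forall i, continuous (fcoord i);
  frameE : forall x, x = \sum_i fcoord i x *: fvec i }.

Arguments fvec {R W} f i.
Arguments fcoord {R W} f i.
Arguments fcoord_cont {R W} f i.
Arguments frameE {R W} f x.

Section Frames.
Context {R : realType}.

Lemma linear_frameE (W Z : normedModType R) (F : frame W)
    (f : {linear W -> Z}) x : f x = \sum_i fcoord F i x *: f (fvec F i).
Proof. by rewrite {1}(frameE F x) linear_sum; apply: eq_bigr => i _; rewrite linearZ.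
  Qed.

Lemma linear_frame_continuous (W Z : normedModType R) (F : frame W)
    (f : {linear W -> Z}) : continuous f.
Proof.
move=> x; rewrite /continuous_at.
rewrite (_ : (f : W -> Z) = fun y => \sum_i fcoord F i y *: f (fvec F i)); last first.
  by apply/funext => y; exact: linear_frameE.
elim: (index_enum _) => [|i s IH].
  by under eq_fun do rewrite big_nil; rewrite big_nil; exact: cvg_cst.
under eq_fun do rewrite big_cons; rewrite big_cons; apply: cvgD => //.
by apply: cvgZr_tmp; exact: fcoord_cont.
Qed.

Definition frame_line : frame (R^o : normedModType R).
Proof.
refine (@Frame R R^o 1 (fun=> 1) (fun=> (idfun : {linear R^o -> R^o})) _ _).
- by move=> _ x; exact: cvg_id.
- by move=> x; rewrite big_ord1 -[RHS]/(x * 1) mulr1.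
Defined.

Definition rV_coord n (i : 'I_n) (x : 'rV[R]_n) : R^o := x ord0 i.

Fact rV_coord_linear n (i : 'I_n) : linear (@rV_coord n i).
Proof. by move=> a x y; rewrite /rV_coord !mxE. Qed.
HB.instance Definition _ n (i : 'I_n) :=
  GRing.isLinear.Build R 'rV[R]_n R^o *:%R (@rV_coord n i) (@rV_coord_linear n i).

Definition frame_rV n : frame ('rV[R]_n : normedModType R).
Proof.
apply: (@Frame _ _ n (fun i => delta_mx ord0 i) (fun i => @rV_coord n i)) => [i|x].
  exact: coord_continuous.
exact: row_sum_delta.
Defined.

Definition frame_prod (V W : normedModType R) (FV : frame V) (FW : frame W) :
  frame ((V * W)%type : normedModType R).
Proof.
pose e (i : 'I_(fdim FV + fdim FW)) : (V * W)%type :=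
  match fintype.split i with inl j => (fvec FV j, 0) | inr j => (0, fvec FW j) end.
pose c (i : 'I_(fdim FV + fdim FW)) : {linear (V * W)%type -> R^o} :=
  match fintype.split i with
  | inl j => fcoord FV j \o fst
  | inr j => fcoord FW j \o snd end.
apply: (@Frame _ _ _ e c) => [i x|x].
  rewrite /c; case: fintype.split => j /=.
    by apply: continuous_comp; [exact: cvg_fst|exact: fcoord_cont].
  by apply: continuous_comp; [exact: cvg_snd|exact: fcoord_cont].
rewrite big_split_ord /=.
under eq_bigr do rewrite /c /e (unsplitK (inl _)) /=.
under [X in _ + X]eq_bigr do rewrite /c /e (unsplitK (inr _)) /=.
case: x => x y /=; congr pair => /=.
- rewrite [RHS](raddfD fst) /= !(raddf_sum fst) /=.
  rewrite [X in _ + X]big1 ?addr0 => [|i _]; last by rewrite scaler0.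
  by rewrite {1}(frameE FV x).
- rewrite [RHS](raddfD snd) /= !(raddf_sum snd) /=.
  rewrite big1 ?add0r => [|i _]; last by rewrite scaler0.
  by rewrite {1}(frameE FW y).
Defined.

End Frames.

Fact scale_is_bilinear (R : realType) (W : normedModType R) :
  bilinear_for
    (GRing.Scale.Law.clone _ _ *:%R _) (GRing.Scale.Law.clone _ _ *:%R _)
    (fun (a : R^o) (w : W) => a *: w).
Proof.
split=> [u'|u] a x y /=; first by rewrite scalerDl scalerA.
by rewrite scalerDr !scalerA mulrC.
Qed.

Definition scale_bilinear (R : realType) (W : normedModType R) : {bilinear R^o -> W
  -> W} :=
  HB.pack (fun (a : R^o) (w : W) => a *: w)
    (bilinear_isBilinear.Build R R^o W W _ _ (fun (a : R^o) (w : W) => a *: w)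
       (scale_is_bilinear W)).

Section CkCalculus.
Context {R : realType}.
Implicit Types (V W Z : normedModType R).

(** Being C^k is a local property; it gives the smoothness of functions that
    are defined by cases on the pieces of an open cover. *)
Lemma Ck_local V W k (U : set V) (f : V -> W) :
  (forall x, U x -> exists N g,
     [/\ open N, N x, Ck k N g & forall y, N y -> f y = g y]) ->
  Ck k U f.
Proof.
elim: k f => [|k IH] f H /=.
  move=> x /H[N [g [oN Nx gc fg]]].
  have E : \forall y \near x, g y = f y.
    by apply: filterS (open_nbhs_nbhs (conj oN Nx)) => y /fg.
  rewrite /prop_for /continuous_at (fg _ Nx); apply: cvg_trans (gc x Nx).
  exact: near_eq_cvg.
split=> [x /H[N [g [oN Nx [gd _] fg]]]|v].
  have [] // : is_diff x f ('d g x).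
  apply: near_eq_is_diff (differentiableP (gd x Nx)).
  by apply: filterS (open_nbhs_nbhs (conj oN Nx)).
apply: IH => x /H[N [g [oN Nx [_ gd] fg]]].
exists N, ('D_v g); split => // [|y Ny]; first exact: gd.
apply: near_eq_derive.
by apply: filterS (open_nbhs_nbhs (conj oN Ny)).
Qed.

Lemma Ck_sub V W k (U U' : set V) (f : V -> W) :
  U' `<=` U -> Ck k U f -> Ck k U' f.
Proof.
by elim: k f => [|k IH] f s /= => [fc x /s/fc//|[fd fD]]; split=> [x /s/fd//|v];
  exact: IH.
Qed.

Lemma Ck_eq V W k (U : set V) (f g : V -> W) : open U ->
  (forall x, U x -> f x = g x) -> Ck k U g -> Ck k U f.
Proof. by move=> oU fg gk; apply: Ck_local => x Ux; exists U, g. Qed.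

Lemma Ck_continuous V W k (U : set V) (f : V -> W) :
  Ck k U f -> forall x, U x -> {for x, continuous f}.
Proof.
by case: k => [//|k] [fd _] x /fd; exact: differentiable_continuous.
Qed.

Lemma CkS V W k (U : set V) (f : V -> W) : Ck k.+1 U f -> Ck k U f.
Proof.
elim: k f => [|k IH] f fk; first exact: Ck_continuous fk.
by case: fk => fd fD; split => // v; exact/IH/fD.
Qed.

Lemma Ck_cst V W k (U : set V) (a : W) : Ck k U (cst a).
Proof.
elim: k a => [|k IH] a /=; first by move=> x _; exact: cvg_cst.
split=> [x _|v]; first exact: differentiable_cst.
rewrite (_ : 'D_v (cst a) = cst 0) //.
by apply/funext => x; rewrite derive_cst.
Qed.

Lemma Ck_linear V W k (U : set V) (f : {linear V -> W}) :
  continuous f -> Ck k U f.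
Proof.
case: k => [|k] fc /=; first by move=> x _; exact: fc.
split=> [x _|v]; first exact: linear_differentiable.
rewrite (_ : 'D_v f = cst (f v)); first exact: Ck_cst.
by apply/funext => x; rewrite deriveE ?diff_lin //; exact: linear_differentiable.
Qed.

Lemma CkD V W k (U : set V) (f g : V -> W) : open U ->
  Ck k U f -> Ck k U g -> Ck k U (fun x => f x + g x).
Proof.
move=> oU; elim: k f g => [|k IH] f g /=.
  by move=> fc gc x Ux; apply: cvgD; [exact: fc|exact: gc].
move=> [fd fD] [gd gD]; split=> [x Ux|v].
  by apply: differentiableD; [exact: fd|exact: gd].
apply: Ck_eq (IH _ _ (fD v) (gD v)) => // x Ux.
by rewrite deriveD //; apply: diff_derivable; [exact: fd|exact: gd].
Qed.

Lemma Ck_linear_comp V W Z k (U : set V) (l : {linear W -> Z}) (f : V -> W) :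
  open U -> continuous l -> Ck k U f -> Ck k U (fun x => l (f x)).
Proof.
move=> oU lc; elim: k f => [|k IH] f /=.
  by move=> fc x Ux; apply: (@continuous_comp _ _ _ f l); [exact: fc|exact: lc].
move=> [fd fD]; split=> [x Ux|v].
  by apply: differentiable_comp; [exact: fd|exact: linear_differentiable].
apply: Ck_eq (IH _ (fD v)) => // x Ux.
have dl : differentiable l (f x) by exact: linear_differentiable.
rewrite deriveE; last by apply: differentiable_comp => //; exact: fd.
by rewrite diff_comp //= ?diff_lin // ?deriveE //; exact: fd.
Qed.

Lemma is_diff_scale V W (h : V -> R^o) (f : V -> W) (x : V) :
  differentiable h x -> differentiable f x ->
  is_diff x (fun x => h x *: f x) (fun v => h x *: 'd f x v + 'd h x v *: f x).
Proof.
move=> hd fd; pose B : {bilinear R^o -> W -> W} := scale_bilinear W.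
have Bc : continuous (fun p : R^o * W => B p.1 p.2).
  by move=> p; apply: cvgZ; [exact: cvg_fst|exact: cvg_snd].
have dp : is_diff x (fun x => (h x, f x)) (fun v => ('d h x v, 'd f x v)).
  by apply: is_diff_pair; exact: differentiableP.
have dB : differentiable (fun p : R^o * W => B p.1 p.2) (h x, f x).
  exact: differentiable_bilin.
have E := diff_comp (g := fun p : R^o * W => B p.1 p.2) (is_diffW dp).1 dB.
split; first exact: (differentiable_comp (g := fun p : R^o * W => B p.1 p.2)
  (is_diffW dp).1 dB).
rewrite [LHS]E (is_diffW dp).2; apply/funext => v.
rewrite -[LHS]/('d (fun p : R^o * W => B p.1 p.2) (h x, f x) ('d h x v, 'd f x v)).
by rewrite diff_bilin.
Qed.

Lemma CkZ V W k (U : set V) (h : V -> R^o) (f : V -> W) : open U ->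
  Ck k U h -> Ck k U f -> Ck k U (fun x => h x *: f x).
Proof.
move=> oU; elim: k h f => [|k IH] h f /=.
  by move=> hc fc x Ux; apply: cvgZ; [exact: hc|exact: fc].
move=> hk fk; move: (hk) (fk) => [hd hD] [fd fD].
have D x (Ux : U x) := is_diff_scale (hd x Ux) (fd x Ux).
split=> [x Ux|v]; first exact: (is_diffW (D x Ux)).1.
apply: (@Ck_eq _ _ _ _ _ (fun x => h x *: 'D_v f x + 'D_v h x *: f x)) => //.
  move=> x Ux; have [Dd DE] := is_diffW (D x Ux).
  by rewrite (deriveE _ Dd) DE (deriveE _ (hd x Ux)) (deriveE _ (fd x Ux)).
by apply: CkD => //; apply: IH => //; exact: CkS.
Qed.

End CkCalculus.

Section CkClosure.
Context {R : realType}.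
Implicit Types (V W Z : normedModType R).

Lemma CkN V W k (U : set V) (f : V -> W) : open U ->
  Ck k U f -> Ck k U (fun x => - f x).
Proof.
move=> oU fk; apply: Ck_eq (CkZ oU (Ck_cst k U (-1 : R^o)) fk) => // x _.
by rewrite scaleN1r.
Qed.

Lemma CkB V W k (U : set V) (f g : V -> W) : open U ->
  Ck k U f -> Ck k U g -> Ck k U (fun x => f x - g x).
Proof. by move=> oU fk gk; apply: CkD => //; exact: CkN. Qed.

Lemma Ck_sum V W k (U : set V) I (s : seq I) (P : pred I) (f : I -> V -> W) :
  open U -> (forall i, Ck k U (f i)) ->
  Ck k U (fun x => \sum_(i <- s | P i) f i x).
Proof.
move=> oU fk; elim: s => [|i s IH].
  by apply: Ck_eq (Ck_cst k U 0) => // x _; rewrite big_nil.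
apply: (@Ck_eq _ _ _ _ _ _ (fun x => (if P i then f i x else 0) +
  \sum_(j <- s | P j) f j x)) => // [x _|].
  by rewrite big_cons; case: ifP => // _; rewrite add0r.
by apply: CkD => //; case: (P i) => //; exact: Ck_cst.
Qed.

Lemma CkM V k (U : set V) (f g : V -> R^o) : open U ->
  Ck k U f -> Ck k U g -> Ck k U (fun x => f x * g x : R^o).
Proof. exact: CkZ. Qed.

Lemma Ck_prod V k (U : set V) I (s : seq I) (f : I -> V -> R^o) :
  open U -> (forall i, Ck k U (f i)) ->
  Ck k U (fun x => \prod_(i <- s) f i x : R^o).
Proof.
move=> oU fk; elim: s => [|i s IH].
  by apply: Ck_eq (Ck_cst k U (1 : R^o)) => // x _; rewrite big_nil.
apply: Ck_eq (CkM oU (fk i) IH) => // x _.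
by rewrite big_cons.
Qed.

Lemma Ck_pair V W Z k (U : set V) (f : V -> W) (g : V -> Z) : open U ->
  Ck k U f -> Ck k U g -> Ck k U (fun x => (f x, g x)).
Proof.
move=> oU; elim: k f g => [|k IH] f g /=.
  by move=> fc gc x Ux; apply: cvg_pair; [exact: fc|exact: gc].
move=> [fd fD] [gd gD]; split=> [x Ux|v].
  by apply: differentiable_pair; [exact: fd|exact: gd].
apply: Ck_eq (IH _ _ (fD v) (gD v)) => // x Ux.
have [df dg] := (fd x Ux, gd x Ux).
by rewrite !deriveE ?diff_pair //; exact: differentiable_pair.
Qed.

(** Chain rule: over a frame of the middle space, the differential of g at f x
    applied to a derivative of f is a sum of products of functions of lower
    order. *)
Lemma Ck_comp V W Z (F : frame W) k (U : set V) (U' : set W)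
    (f : V -> W) (g : W -> Z) :
  open U -> (forall x, U x -> U' (f x)) ->
  Ck k U f -> Ck k U' g -> Ck k U (g \o f).
Proof.
move=> oU fU; elim: k f g fU => [|k IH] f g fU.
  by move=> fc gc x Ux; apply: continuous_comp; [exact: fc|exact/gc/fU].
move=> fk gk; move: (fk) (gk) => [fd fD] [gd gD]; split=> [x Ux|v].
  by apply: differentiable_comp; [exact: fd|exact/gd/fU].
apply: (@Ck_eq _ _ _ _ _ _ (fun x => \sum_(i < fdim F)
    fcoord F i ('D_v f x) *: ('D_(fvec F i) g \o f) x)) => // [x Ux|].
  have [df dg] := (fd x Ux, gd _ (fU x Ux)).
  have dgf : differentiable (g \o f) x by exact: differentiable_comp.
  rewrite (deriveE _ dgf) (diff_comp df dg) [LHS]/= (linear_frameE F).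
  by rewrite -(deriveE _ df); apply: eq_bigr => i _; rewrite -(deriveE _ dg).
apply: Ck_sum => // i; apply: CkZ => //.
  by apply: Ck_linear_comp; [|exact: fcoord_cont|exact: fD].
by apply: IH => //; [exact: CkS|exact: gD].
Qed.

Lemma Ck_of_derive k (U : set R^o) (f df : R^o -> R^o) : open U ->
  (forall x, U x -> is_derive x 1 f (df x)) -> Ck k U df -> Ck k.+1 U f.
Proof.
move=> oU fd dfk; have D x : U x -> differentiable f x.
  by move=> /fd[+ _]; move/derivable1_diffP.
split=> // v; apply: Ck_eq (CkM oU (Ck_cst k U (v : R^o)) dfk) => // x Ux.
have dx := D x Ux; rewrite (deriveE _ dx) (diff1E dx) derive1E.
by have [_ ->] := fd x Ux.
Qed.

Lemma Ck_expR k (U : set R^o) : open U -> Ck k U (expR : R^o -> R^o).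
Proof.
move=> oU; elim: k => [|k IH]; first by move=> x _; exact: continuous_expR.
by apply: Ck_of_derive IH => // x _; exact: is_derive_expR.
Qed.

Lemma Ck_inv k (U : set R^o) : open U -> (forall x, U x -> x != 0) ->
  Ck k U (GRing.inv : R^o -> R^o).
Proof.
move=> oU U0; elim: k => [|k IH]; first by move=> x /U0 ?; exact: inv_continuous.
apply: (@Ck_of_derive _ _ _ (fun x => - (x^-1 * x^-1))) => // [x /U0 x0|].
  split; first exact: derivableV.
  by rewrite deriveV // derive_id scaler1 -invrM ?unitfE // -expr2.
by apply: CkN => //; exact: CkM.
Qed.

Lemma Ck_ln k : Ck k [set x : R^o | 0 < x] (@ln R : R^o -> R^o).
Proof.
have oU : open [set x : R^o | 0 < x] by exact: open_gt.
case: k => [|k]; first by move=> x x0; exact: continuous_ln.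
apply: (@Ck_of_derive _ _ _ GRing.inv) => //.
by apply: Ck_inv => // x /= /gt_eqF ->.
Qed.

End CkClosure.

(** * Symmetry of second derivatives *)

Section Schwarz.
Context {R : realType}.
Implicit Types (V W E : normedModType R).

Lemma continuous_near (T : topologicalType) V (f : T -> V) (p : T) (e : R) :
  0 < e -> {for p, continuous f} -> \forall x \near p, `|f x - f p| < e.
Proof.
move=> e0 fc.
by near do rewrite distrC; apply: (cvgrPdist_lt f (f p)).1 e0; exact: fc.
Unshelve. all: by end_near. Qed.

Lemma is_derive_line V W (f : V -> W) (q u : V) (a : R) :
  differentiable f (q + a *: u) ->
  is_derive (a : R^o) (1 : R^o) (fun s : R^o => f (q + s *: u)) ('D_u f (q + a *: u)).
Proof.
move=> fd; have E : (fun h : R => h^-1 *: (((fun s : R^o => f (q + s *: u)) \o shift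
  (a : R^o)) (h *: (1 : R^o))
     - f (q + a *: u)))
   = (fun h => h^-1 *: ((f \o shift (q + a *: u)) (h *: u) - f (q + a *: u))).
  apply/funext => h /=; congr (_ *: (f _ - _)).
  by rewrite -[h *: 1]/(h * 1) mulr1 scalerDl addrCA addrA addrC addrA.
split; first by rewrite /derivable E; exact: diff_derivable.
by rewrite /derive E.
Qed.

Lemma MVT_line V (f : V -> R^o) (q u : V) (h : R) : 0 < h ->
  (forall s, 0 <= s <= h -> differentiable f (q + s *: u)) ->
  exists2 s, 0 < s < h & f (q + h *: u) - f q = h * 'D_u f (q + s *: u).
Proof.
move=> h0 fd.
have [||s s0h] := @MVT _ (fun s : R^o => f (q + s *: u)) (fun s => 'D_u f (q + s *:
  u)) 0 h h0.
- move=> s /[!in_itv]/= /andP[s0 sh]; apply: is_derive_line.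
  by apply: fd; rewrite !ltW.
- apply: derivable_within_continuous => s /[!in_itv]/= s0h.
  by have [] := is_derive_line (fd s s0h).
rewrite scale0r addr0 subr0 mulrC => ->; by exists s.
Qed.

Definition second_difference V (f : V -> R^o) (p u v : V) (h : R) : R :=
  f (p + h *: u + h *: v) - f (p + h *: u) - (f (p + h *: v) - f p).

Lemma second_differenceC V (f : V -> R^o) (p u v : V) (h : R) :
  second_difference f p u v h = second_difference f p v u h.
Proof. by rewrite /second_difference [p + _ + _]addrAC; ring. Qed.

(** Two applications of the mean value theorem: in the direction u to the
    increment of f by h *: v, then in the direction v to 'D_u f. The second
    difference is symmetric in u and v, which gives Schwarz' theorem. *)
Lemma second_difference_approx V (U : set V) (f : V -> R^o) (p u v : V) :
  open U -> Ck 2 U f -> U p -> forall e : R, 0 < e ->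
  \forall h \near (0:R)^'+,
    `|second_difference f p u v h - h ^+ 2 * 'D_v ('D_u f) p| <= e * h ^+ 2.
Proof.
move=> oU [fd fD] Up e e0; have [fDd fDD] := fD u; have fc := fDD v p Up.
pose Q x := U x /\ `|'D_v ('D_u f) x - 'D_v ('D_u f) p| < e.
have nQ : nbhs p Q.
  apply: filterI; first exact: open_nbhs_nbhs.
  exact: continuous_near.
have [d d0 Hd] := (nbhs_ballP _ _).1 nQ.
rewrite /= in d0.
pose r := d / (`|u| + `|v| + 1).
have uv0 : 0 < `|u| + `|v| + 1 by rewrite ltr_wpDl // addr_ge0.
have r0 : 0 < r by rewrite divr_gt0.
have HQ a b : `|a| < r -> `|b| < r -> Q (p + a *: u + b *: v).
  move=> ar br; apply: Hd; rewrite -ball_normE /= -addrA opprD addrA subrr add0r normrN.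
  apply: le_lt_trans (ler_normD _ _) _; rewrite !normrZ.
  apply: (@le_lt_trans _ _ (r * (`|u| + `|v|))).
    by rewrite mulrDr lerD // ler_wpM2r // ltW.
  by rewrite /r mulrAC ltr_pdivrMr // ltr_pM2l // ltrDl.
near=> h.
have h0 : 0 < h by near: h; exact: nbhs_right_gt.
have hr : h < r by near: h; exact: nbhs_right_lt.
have sr s : 0 <= s <= h -> `|s| < r.
  by move=> /andP[s0 sh]; rewrite ger0_norm //; exact: le_lt_trans hr.
have hh : 0 <= h <= h by rewrite lexx ltW.
pose g x := f (x + h *: v) - f x.
have gd s : 0 <= s <= h -> is_diff (p + s *: u) g (fun w => 'd f (p + s *: u + h *:
  v) w - 'd f (p + s *: u) w).
  move=> sh; have [U1 _] := HQ _ _ (sr s sh) (sr h hh).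
  have [U2 _] := HQ s 0 (sr s sh) ltac:(by rewrite normr0).
  rewrite scale0r addr0 in U2.
  have d1 : is_diff (p + s *: u) (fun x => f (x + h *: v)) ('d f (p + s *: u + h *: v)).
    have ds : is_diff (p + s *: u) (fun x => x + h *: v) id.
      by rewrite -[X in is_diff _ _ X]addr0; apply: is_diffD.
    have fd' : is_diff (p + s *: u + h *: v) f ('d f (p + s *: u + h *: v)).
      by apply: differentiableP; exact: fd.
    exact: (@is_diff_comp _ _ _ _ (fun x => x + h *: v) id f).
  exact: (is_diffB d1 (differentiableP (fd _ U2))).
have [|s s0h] := @MVT_line _ g p u h h0.
  by move=> s /gd/is_diffW[].
have sh : 0 <= s <= h by move/andP: s0h => [? ?]; rewrite !ltW.
rewrite deriveE ?(is_diffW (gd _ sh)).2; last exact: (is_diffW (gd s sh)).1.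
have [U1 _] := HQ _ _ (sr s sh) (sr h hh).
have [U2 _] := HQ s 0 (sr s sh) ltac:(by rewrite normr0).
rewrite scale0r addr0 in U2.
rewrite -!deriveE //; [|exact: fd|exact: fd].
have [|t t0h ->] := @MVT_line _ ('D_u f) (p + s *: u) v h h0.
  by move=> t th; apply: fDd; exact: (HQ _ _ (sr _ sh) (sr _ th)).1.
have th : 0 <= t <= h by move/andP: t0h => [? ?]; rewrite !ltW.
have [_ Hst] := HQ _ _ (sr _ sh) (sr _ th).
rewrite /second_difference -[X in `|X - _|]/(g (p + h *: u) - g p) => ->.
rewrite mulrA -expr2 -mulrBr normrM ger0_norm ?sqr_ge0 // mulrC.
by apply: ler_wpM2r; [exact: sqr_ge0|exact: ltW].
Unshelve. all: by end_near. Qed.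

Lemma schwarz_scalar V (U : set V) (f : V -> R^o) (p u v : V) :
  open U -> Ck 2 U f -> U p -> 'D_u ('D_v f) p = 'D_v ('D_u f) p.
Proof.
move=> oU fk Up; apply/eqP; rewrite -subr_eq0 -normr_le0; apply/ler_addgt0Pl => e e0.
rewrite addr0.
have key (d a b k : R) : 0 < k -> `|d - k * a| <= e / 2 * k ->
    `|d - k * b| <= e / 2 * k -> `|b - a| <= e.
  move=> k0 /ler_normlP[a1 a2] /ler_normlP[b1 b2].
  by rewrite -(ler_pM2l k0) -[X in X * `|_|]gtr0_norm // -normrM; apply/ler_normlP;
    split; nra.
have e20 : 0 < e / 2 by rewrite divr_gt0.
have A1 := second_difference_approx u v oU fk Up e20.
have A2 := second_difference_approx v u oU fk Up e20.
have [h [[h0 H1] H2]] := filter_ex (filterI (filterI (nbhs_right_gt (0 : R)) A1) A2).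
rewrite second_differenceC in H2.
have h2 : 0 < h ^+ 2 by rewrite exprn_gt0.
by apply: key h2 H1 H2.
Qed.

Lemma derive_linear_comp V W E (l : {linear W -> E}) (f : V -> W) (x v : V) :
  continuous l -> differentiable f x -> 'D_v (fun y => l (f y)) x = l ('D_v f x).
Proof.
move=> lc fd; have dl : differentiable l (f x) by exact: linear_differentiable.
rewrite !deriveE //; last exact: (differentiable_comp (g := l)).
by rewrite (diff_comp (g := l)) //= diff_lin.
Qed.

Lemma schwarz V W (F : frame W) (U : set V) (f : V -> W) (p u v : V) :
  open U -> Ck 2 U f -> U p -> 'D_u ('D_v f) p = 'D_v ('D_u f) p.
Proof.
move=> oU fk Up; have [fd fD] := fk.
have coordE i w w' : fcoord F i ('D_w' ('D_w f) p) =
    'D_w' ('D_w (fun z => fcoord F i (f z))) p.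
  have c := fcoord_cont F i.
  rewrite -(derive_linear_comp w' c ((fD w).1 p Up)); apply: near_eq_derive.
  apply: filterS (open_nbhs_nbhs (conj oU Up)) => y Uy.
  by rewrite (derive_linear_comp w c (fd y Uy)).
have E i : fcoord F i ('D_u ('D_v f) p) = fcoord F i ('D_v ('D_u f) p).
  rewrite !coordE; apply: (@schwarz_scalar _ U) => //.
  exact: Ck_linear_comp oU (fcoord_cont F i) fk.
by rewrite [LHS](frameE F) [RHS](frameE F); apply: eq_bigr => i _; rewrite E.
Qed.

End Schwarz.

(** * Exterior derivatives and pullbacks *)

Section ExteriorDerivative.
Context {R : realType}.
Implicit Types (V E : normedModType R).

Lemma derive_comp V E (W : normedModType R) (f : V -> W) (g : E -> V) (q u : E) :
  differentiable g q -> differentiable f (g q) ->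
  'D_u (fun x => f (g x)) q = 'D_('d g q u) f (g q).
Proof.
move=> gd fd; have fgd : differentiable (f \o g) q by exact: differentiable_comp.
by rewrite (deriveE _ fd) [LHS](deriveE _ fgd) (diff_comp gd fd).
Qed.

Lemma derive_frame V (F : frame V) (a : V -> V -> R) (U : set V) (x w v : V) :
  open U -> U x ->
  (forall y, U y -> forall (c : R) u u', a y (c *: u + u') = c * a y u + a y u') ->
  (forall u, differentiable (fun y => a y u : R^o) x) ->
  'D_w (fun y => a y v : R^o) x =
  \sum_(i < fdim F) fcoord F i v * 'D_w (fun y => a y (fvec F i) : R^o) x.
Proof.
move=> oU Ux al ad.
have E : \forall y \near x,
    a y v = (\sum_(i < fdim F) (fcoord F i v \*: (fun y => a y (fvec F i) : R^o))) y.
  apply: filterS (open_nbhs_nbhs (conj oU Ux)) => y Uy.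
  have [l ayE] := @exists_linear R V R^o (a y) (al y Uy).
  rewrite [LHS](congr1 (@^~ v) ayE) (linear_frameE F) fct_sumE.
  by apply: eq_bigr => i _; rewrite -ayE.
rewrite (near_eq_derive w E) derive_sum => [|i].
  apply: eq_bigr => i _.
  have db : derivable (fun y => a y (fvec F i) : R^o) x w by exact: diff_derivable.
  by rewrite (deriveZ _ db).
by apply: derivableZ; exact: diff_derivable.
Qed.

(** Leibniz rule for the pulled back form a (g q) ('d g q v): the second
    derivative of g contributes the term that Schwarz' theorem makes
    symmetric. *)
Lemma derive_pullback V E (F : frame V) (a : V -> V -> R) (U : set V)
    (N : set E) (g : E -> V) (p u v : E) :
  open U -> open N -> N p -> U (g p) ->
  (forall y, U y -> forall (c : R) w w', a y (c *: w + w') = c * a y w + a y w') ->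
  (forall w, differentiable (fun y => a y w : R^o) (g p)) ->
  Ck 2 N g ->
  'D_u (fun q => a (g q) ('d g q v) : R^o) p =
  a (g p) ('D_u ('D_v g) p) +
  'D_('d g p u) (fun y => a y ('d g p v) : R^o) (g p).
Proof.
move=> oU oN Np Ugp al ad [gd gD].
have [gDd _] := gD v; have gdp := gd p Np; have gDp := gDd p Np.
have gc : {for p, continuous g} by exact: differentiable_continuous.
pose c i (q : E) : R^o := fcoord F i ('D_v g q).
pose b i (q : E) : R^o := a (g q) (fvec F i).
have cd i : differentiable (c i) p.
  apply: (differentiable_comp (g := fcoord F i)) => //.
  by apply: linear_differentiable; exact: fcoord_cont.
have bd i : differentiable (b i) p.
  by apply: (differentiable_comp (g := fun y => a y (fvec F i) : R^o)).
have E0 : \forall q \near p, a (g q) ('d g q v) = (\sum_(i < fdim F) (c i * b i)) q.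
  have NU : \forall q \near p, N q /\ U (g q).
    apply: filterI; first exact: open_nbhs_nbhs.
    by apply: gc; exact: open_nbhs_nbhs.
  apply: filterS NU => q [Nq Uq].
  rewrite -(deriveE v (gd q Nq)) fct_sumE /c /b.
  have [l aqE] := @exists_linear R V R^o (a (g q)) (al _ Uq).
  rewrite [LHS](congr1 (@^~ _) aqE) (linear_frameE F).
  by apply: eq_bigr => i _; rewrite -aqE.
rewrite (near_eq_derive u E0) derive_sum => [|i]; last first.
  by apply: derivableM; exact: diff_derivable.
have [l lE] := @exists_linear R V R^o (a (g p)) (al _ Ugp).
rewrite [X in X + _](_ : _ = \sum_i fcoord F i ('D_u ('D_v g) p) * a (g p) (fvec F
  i)); last first.
  rewrite [LHS](congr1 (@^~ _) lE) (linear_frameE F).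
  by apply: eq_bigr => i _; rewrite -lE.
rewrite (derive_frame F _ _ oU Ugp al ad) -big_split /=; apply: eq_bigr => i _.
have [dc db] : derivable (c i) p u /\ derivable (b i) p u.
  by split; exact: diff_derivable.
rewrite (deriveM dc db).
rewrite /c (derive_linear_comp u (fcoord_cont F i) gDp) /b.
rewrite (derive_comp u gdp (ad _)) (deriveE v gdp).
have comm (x y z t : R) : x * y + z * t = t * z + x * y by ring.
exact: comm.
Qed.



(** The exterior derivative commutes with pullbacks: be is the pullback of al by
    the map whose expression in the chart i is g. *)
Lemma ext_d_pullback V E (F : frame V) (T : topologicalType) (S : charted V T)
    (al : form1 S) (i : chart_idx S) (N : set E) (g : E -> V)
    (be : E -> E -> R) (p u v : E) :
  (forall x, chart_im i x ->
     chart_dom i (chart_par i x) /\ chart_coord i (chart_par i x) = x) ->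
  (forall y, chart_dom i y -> forall (a : R) w w',
     al i y (a *: w + w') = a * al i y w + al i y w') ->
  (forall w, smooth_open (chart_im i) (fun x => al i (chart_par i x) w : R^o)) ->
  open N -> N p -> Ck 2 N g ->
  (forall q, N q -> chart_im i (g q)) ->
  (forall q, N q -> forall w, al i (chart_par i (g q)) ('d g q w) = be q w) ->
  ext_d al i (chart_par i (g p)) ('d g p u) ('d g p v) =
  'D_u (fun q => be q v : R^o) p - 'D_v (fun q => be q u : R^o) p.
Proof.
move=> parK al_lin al_smooth oN Np gk gN gE.
have oU : open (chart_im i) by case: (al_smooth 0).
have al_diff w : differentiable (fun x => al i (chart_par i x) w : R^o) (g p).
  by case: (al_smooth w) => _ /(_ 1%N)[+ _]; apply; exact: gN.
have lin x : chart_im i x -> forall (c : R) w w',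
    al i (chart_par i x) (c *: w + w') = c * al i (chart_par i x) w + al i (chart_par
      i x) w'.
  by move=> /parK[+ _]; exact: al_lin.
have beE w : \forall q \near p, be q w = al i (chart_par i (g q)) ('d g q w).
  by apply: filterS (open_nbhs_nbhs (conj oN Np)) => q Nq; rewrite gE.
have pullE := derive_pullback (a := fun x => al i (chart_par i x)) F _ _ oU oN Np (gN
  p Np) lin al_diff gk.
rewrite (near_eq_derive u (beE v)) (near_eq_derive v (beE u)) !pullE.
rewrite (schwarz F u v oN gk Np) /ext_d (parK _ (gN p Np)).2.
have comm (x y z : R) : y - z = x + y - (x + z) by ring.
exact: comm.
Qed.

End ExteriorDerivative.

(** * Inverse function theorem *)

Section LocalInverse.
Context {R : realType}.

Definition sqnorm n (x : 'rV[R]_n) : R := \sum_k x ord0 k ^+ 2.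

Lemma sqnorm_ge0 n (x : 'rV[R]_n) : 0 <= sqnorm x.
Proof. by apply: sumr_ge0 => k _; exact: sqr_ge0. Qed.

Lemma sqnorm_eq0 n (x : 'rV[R]_n) : sqnorm x = 0 -> x = 0.
Proof.
move=> /psumr_eq0P x0; apply/rowP => k; rewrite mxE; apply/eqP.
by rewrite -sqrf_eq0; apply/eqP/x0 => // j _; exact: sqr_ge0.
Qed.

Lemma sqnorm_le2 n (a b : 'rV[R]_n) : sqnorm (a + b) <= 2 * sqnorm a + 2 * sqnorm b.
Proof.
rewrite /sqnorm !mulr_sumr -big_split; apply: ler_sum => k _ /=.
rewrite mxE; set x := a _ _; set y := b _ _.
by have := sqr_ge0 (x - y); rewrite !expr2; nra.
Qed.

Lemma sqnorm_continuous n : continuous (@sqnorm n : 'rV[R]_n -> R^o).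
Proof.
have : Ck 0 setT (@sqnorm n : 'rV[R]_n -> R^o).
  apply: Ck_sum => [|k]; first exact: openT.
  have c : Ck 0 setT (@rV_coord R n k) by apply: Ck_linear; exact: coord_continuous.
  by apply: Ck_eq (CkM openT c c) => //; exact: openT.
by move=> c x; exact: c.
Qed.

Lemma derive_linear (V W : normedModType R) (l : {linear V -> W}) (x v : V) :
  continuous l -> 'D_v l x = l v.
Proof.
move=> lc; have ld : differentiable l x by exact: linear_differentiable.
by rewrite (deriveE v ld) diff_lin.
Qed.

Lemma Ck_id (V : normedModType R) k (U : set V) : Ck k U (fun x : V => x).
Proof. by apply: (@Ck_linear R V V k U idfun) => x; exact: cvg_id. Qed.

Lemma sqnorm_smooth n k (U : set 'rV[R]_n) : open U ->
  Ck k U (@sqnorm n : 'rV[R]_n -> R^o).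
Proof.
move=> oU; apply: Ck_sum => // i.
have c : Ck k U (@rV_coord R n i) by apply: Ck_linear; exact: coord_continuous.
exact: Ck_eq (CkM oU c c).
Qed.

Lemma Ck_sqnorm (V : normedModType R) n k (U : set V) (f : V -> 'rV[R]_n) :
  open U -> Ck k U f -> Ck k U (fun x => sqnorm (f x) : R^o).
Proof.
move=> oU fk.
exact: (Ck_comp (frame_rV n) oU (fun _ _ => I) fk (sqnorm_smooth k openT)).
Qed.

Lemma derive_sqnorm n (x v : 'rV[R]_n) :
  'D_v (@sqnorm n : 'rV[R]_n -> R^o) x = 2 * \sum_k x ord0 k * v ord0 k.
Proof.
have cd k y : differentiable (@rV_coord R n k) y.
  by apply: linear_differentiable; exact: coord_continuous.
have dc k y : derivable (@rV_coord R n k) y v by exact: diff_derivable.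
rewrite (_ : @sqnorm n = \sum_(k < n) (@rV_coord R n k * @rV_coord R n k)); last first.
  by apply/funext => y; rewrite fct_sumE.
rewrite derive_sum => [|k]; last by apply: derivableM; exact: dc.
rewrite mulr_sumr; apply: eq_bigr => k _.
have vE : 'D_v (@rV_coord R n k) x = v ord0 k.
  by apply: derive_linear; exact: coord_continuous.
rewrite (deriveM (dc k x) (dc k x)) vE.
have comm (a b : R) : a * b + a * b = 2 * (a * b) by ring.
exact: comm.
Qed.

Lemma derive_at_min (V : normedModType R) (U : set V) (f : V -> R^o) (x v : V) :
  open U -> U x -> (forall y, U y -> f x <= f y) ->
  (forall y, U y -> differentiable f y) -> 'D_v f x = 0.
Proof.
move=> oU Ux xmin fd; pose line (s : R^o) := x + s *: v.
have l0 : line 0 = x by rewrite /line scale0r addr0.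
have lc : {for 0, continuous line}.
  by apply: cvgD; [exact: cvg_cst|apply: cvgZr_tmp; exact: cvg_id].
have nU : nbhs (line 0) U by rewrite l0; exact: open_nbhs_nbhs.
have [r r0 Hr] := (nbhs_ballP _ _).1 (lc U nU).
rewrite /= in r0.
have Ul s : s \in `]- r, r[ -> U (line s).
  rewrite in_itv /= -ltr_norml => sr; apply: Hr.
  by rewrite -ball_normE /= sub0r normrN.
have fdl s : U (line s) -> is_derive s (1 : R^o) (f \o line) ('D_v f (line s)).
  by move=> Us; apply: is_derive_line; exact: fd.
have [_ D0] : is_derive (0 : R^o) (1 : R^o) (f \o line) 0.
  apply: (@derive1_at_min R (f \o line) (- r) r 0).
  - by rewrite ge0_cp // ltW.
  - by move=> s /Ul/fdl[].
  - by rewrite in_itv /= oppr_lt0 r0.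
  - by move=> s /Ul Us; rewrite /= l0; exact: xmin.
have Ul0 : U (line 0) by rewrite l0.
by have [_] := fdl 0 Ul0; rewrite D0 l0.
Qed.

(** Where the differential is onto, a point of least distance to y over a
    compact neighbourhood is mapped to y. *)
Lemma open_image n (N : set 'rV[R]_n) (g : 'rV[R]_n -> 'rV[R]_n) (q : 'rV[R]_n) :
  open N -> N q -> Ck 1 N g ->
  (forall x y, N x -> N y -> g x = g y -> x = y) ->
  (forall x, N x -> forall w, exists v, 'd g x v = w) ->
  nbhs (g q) (g @` N).
Proof.
move=> oN Nq gk ginj gonto; have [gd _] := gk.
have [r rN] := (nbhs_closedballP _ _).1 (open_nbhs_nbhs (conj oN Nq)).
have r0 : 0 < r%:num by [].
set B := closed_ball q r%:num in rN.
have cB : compact B.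
  apply: bounded_closed_compact; last exact: closed_ball_closed.
  exists (`|q| + r%:num); split=> [|M ltM x]; first exact: num_real.
  rewrite /B closed_ballE // /closed_ball_ /= => qx; apply: ltW; apply: le_lt_trans ltM.
  by rewrite -[x](subKr q) (le_trans (ler_normB _ _)) // lerD2l.
have gc x : N x -> {for x, continuous g} by move=> /gd; exact:
  differentiable_continuous.
have hk y : Ck 1 N (fun x => sqnorm (g x - y) : R^o).
  exact: Ck_sqnorm oN (CkB oN gk (Ck_cst 1 N y)).
have hc y A : A `<=` B -> {within A, continuous (fun x => sqnorm (g x - y) : R^o)}.
  move=> AB; apply: continuous_in_subspaceT => x /set_mem/AB/rN Nx.
  exact: Ck_continuous (hk y) _ Nx.
have [m m0 Hm] : exists2 m : R, 0 < m &
    forall x, B x -> ~ ball q r%:num x -> m <= sqnorm (g x - g q).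
  pose Sp := B `&` ~` ball q r%:num.
  have [S0|S0] := pselect (Sp !=set0); last first.
    by exists 1 => // x Bx xr; case: S0; exists x.
  have cS : compact Sp.
    by apply: compact_closedI => //; apply: open_closedC; exact: ball_open.
  have hcS : {within Sp, continuous (fun x => sqnorm (g x - g q) : R^o)}.
    by apply: hc => x [].
  have [c /set_mem[Bc cr] cmin] :=
    @EVT_min_rV R n (fun x => sqnorm (g x - g q)) Sp S0 cS hcS.
  exists (sqnorm (g c - g q)).
    rewrite lt_neqAle sqnorm_ge0 andbT eq_sym; apply/eqP => /sqnorm_eq0/subr0_eq gcq.
    apply: cr; rewrite (ginj _ _ (rN _ Bc) Nq gcq); exact: ballxx.
  by move=> x Bx xr; apply: cmin; apply/mem_set.
have qB : B q by exact: closed_ballxx.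
have near_y : \forall y \near g q, sqnorm (g q - y) < m / 4.
  have m4 : 0 < m / 4 by rewrite divr_gt0.
  have c : {for g q, continuous (fun y : 'rV[R]_n => sqnorm (g q - y) : R^o)}.
    have k : Ck 0 setT (fun y : 'rV[R]_n => sqnorm (g q - y) : R^o).
      exact: Ck_sqnorm openT (CkB openT (Ck_cst 0 _ _) (Ck_id 0 _)).
    exact: k.
  apply: filterS (continuous_near m4 c) => y /=.
  rewrite subrr [sqnorm 0]big1 => [|k _]; last by rewrite mxE expr0n.
  by rewrite subr0; apply: le_lt_trans; exact: ler_norm.
apply: filterS near_y => y ym.
have B0 : B !=set0 by exists q.
have [c /set_mem Bc cmin] :=
  @EVT_min_rV R n (fun x => sqnorm (g x - y)) B B0 cB (hc y B (fun _ => id)).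
have cr : ball q r%:num c.
  apply: contrapT => cr; have := Hm c Bc cr; apply/negP; rewrite -ltNge.
  have -> : g c - g q = (g c - y) - (g q - y) by rewrite opprB addrA subrK.
  apply: le_lt_trans (sqnorm_le2 _ _) _.
  have -> : sqnorm (- (g q - y)) = sqnorm (g q - y).
    by apply: eq_bigr => k _; rewrite [in LHS]mxE sqrrN.
  have := cmin q (mem_set qB); lra.
exists c; first exact: rN.
have [v vE] := gonto c (rN _ Bc) (g c - y).
have rN' x : ball q r%:num x -> N x by move=> /subset_closed_ball/rN.
have D0 : 'D_v (fun x => sqnorm (g x - y) : R^o) c = 0.
  apply: (@derive_at_min _ (ball q r%:num)) => //; first exact: ball_open.
    by move=> x /subset_closed_ball Bx; apply: cmin; apply/mem_set.
  by move=> x /rN' Nx; have [+ _] := hk y; exact.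
have gdc := gd c (rN _ Bc).
have is_d : is_diff c (fun x => g x - y) ('d g c).
  rewrite -['d g c : _ -> _]subr0; apply: is_diffB; exact: differentiableP.
have [gyd gydE] := is_diffW is_d.
have sd : differentiable (@sqnorm n : _ -> R^o) (g c - y).
  have [H _] := @sqnorm_smooth n 1 setT openT.
  exact: H.
move: D0; rewrite (derive_comp v gyd sd) derive_sqnorm gydE vE => /eqP.
rewrite mulf_eq0 pnatr_eq0 /= => /eqP D0; apply/subr0_eq/sqnorm_eq0.
by rewrite -D0; apply: eq_bigr => k _; rewrite expr2.
Qed.

End LocalInverse.

Section InverseSmooth.
Context {R : realType}.

(** The remainder of g at q, bounded by d |J y - q|, becomes a remainder for J
    because |J y - q| is at most 2 C |y - g q|, where C is a Lipschitz constant
    of A. *)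
Lemma is_diff_inverse (V W : normedModType R) (g : V -> W) (J : W -> V)
    (q : V) (A : {linear W -> V}) :
  continuous A -> differentiable g q -> cancel ('d g q) A ->
  {for g q, continuous J} -> J (g q) = q ->
  (\forall y \near g q, g (J y) = y) ->
  is_diff (g q) J A.
Proof.
move=> Ac gd AK Jc Jq gJ; apply: is_diff_le => // e e0.
have [C C0 AC] := linear_lipschitz Ac.
pose d := Num.min (1 / (2 * C)) (e / (2 * C ^+ 2)).
have d0 : 0 < d.
  by rewrite /d lt_min !divr_gt0 // mulr_gt0 // exprn_gt0.
have gle := diff_le gd d0; rewrite -{1}Jq in gle.
have gleJ : \forall y \near g q, `|g (J y) - g q - 'd g q (J y - q)| <= d * `|J y - q|.
  exact: Jc _ gle.
apply: filterS2 gJ gleJ => y -> {gle}; rewrite Jq.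
move: (J y - q) (y - g q) => x w yle.
have Axw : `|A w - x| <= C * (d * `|x|).
  rewrite -{1}(AK x) -raddfB; apply: le_trans (AC _) _.
  by rewrite ler_pM2l.
rewrite distrC; apply: (le_trans Axw).
have dC1 : C * d <= 1 / 2.
  have : d <= 1 / (2 * C) by rewrite ge_min lexx.
  rewrite -(ler_pM2l C0) => /le_trans; apply.
  by rewrite (_ : C * _ = 1 / 2) //; field; rewrite gt_eqF.
have dC2 : C * d * (2 * C) <= e.
  have : d <= e / (2 * C ^+ 2) by rewrite ge_min lexx orbT.
  have CC : 0 < C * (2 * C) by rewrite !mulr_gt0.
  rewrite -(ler_pM2l CC) => H; apply: le_trans (le_trans H _); first by rewrite mulrAC.
  by rewrite (_ : C * _ * _ = e) //; field; rewrite gt_eqF.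
have xw : `|x| <= 2 * C * `|w|.
  have : `|x| <= `|A w| + `|A w - x|.
    by rewrite -{1}[x](subKr (A w)); exact: ler_normB.
  have Aw := AC w.
  have h : C * d * `|x| <= 1 / 2 * `|x| by apply: ler_wpM2r.
  have key (a b c t : R) : `|x| <= b + a -> a <= c -> c <= 1 / 2 * `|x| ->
      b <= t -> `|x| <= 2 * t by lra.
  rewrite -mulrA; move=> H; apply: key H Axw _ Aw.
  by rewrite mulrA.

have Cd0 : 0 < C * d by rewrite mulr_gt0.
rewrite mulrA; apply: (@le_trans _ _ (C * d * (2 * C * `|w|))).
  by rewrite ler_pM2l.
by rewrite mulrA ler_wpM2r.
Qed.

Lemma Ck_det (V : normedModType R) k (U : set V) n (M : V -> 'M[R]_n) : open U ->
  (forall i j, Ck k U (fun x => M x i j : R^o)) ->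
  Ck k U (fun x => \det (M x) : R^o).
Proof.
move=> oU Mk; apply: Ck_sum => // s; apply: CkM => //; first exact: Ck_cst.
by apply: Ck_prod.
Qed.

Lemma Ck_adj (V : normedModType R) k (U : set V) n (M : V -> 'M[R]_n) i j : open U ->
  (forall i j, Ck k U (fun x => M x i j : R^o)) ->
  Ck k U (fun x => (\adj (M x)) i j : R^o).
Proof.
move=> oU Mk; apply: (@Ck_eq _ _ _ _ _ _ (fun x => cofactor (M x) j i : R^o)) => //.
  by move=> x _; rewrite mxE.
apply: CkM => //; first exact: Ck_cst.
apply: Ck_det => // a b; apply: Ck_eq (Mk (lift j a) (lift i b)) => // x _.
by rewrite !mxE.
Qed.

Lemma Ck_invmx (V : normedModType R) k (U : set V) n (M : V -> 'M[R]_n) i j : open U ->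
  (forall x, U x -> M x \in unitmx) ->
  (forall i j, Ck k U (fun x => M x i j : R^o)) ->
  Ck k U (fun x => invmx (M x) i j : R^o).
Proof.
move=> oU Mu Mk.
apply: (@Ck_eq _ _ _ _ _ _ (fun x => (\det (M x))^-1 * (\adj (M x)) i j : R^o)) => //.
  by move=> x /Mu Mx; rewrite /invmx Mx mxE.
apply: CkM => //; last exact: Ck_adj.
have o0 : open [set x : R^o | x != 0] by exact: open_neq.
apply: (Ck_comp frame_line oU _ (Ck_det oU Mk) (Ck_inv k o0 (fun _ => id))).
by move=> x /Mu; rewrite unitmxE unitfE.
Qed.

Lemma Ck_rV (V : normedModType R) k (U : set V) n (f : V -> 'rV[R]_n) : open U ->
  (forall j, Ck k U (fun x => f x ord0 j : R^o)) -> Ck k U f.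
Proof.
move=> oU fk.
apply: (@Ck_eq _ _ _ _ _ _ (fun x => \sum_j f x ord0 j *: delta_mx ord0 j)) => //.
  by move=> x _; exact: row_sum_delta.
by apply: Ck_sum => // j; apply: CkZ => //; exact: Ck_cst.
Qed.

Lemma lin1_mx_unit n (l : {linear 'rV[R]_n -> 'rV[R]_n}) :
  injective l -> lin1_mx l \in unitmx.
Proof.
move=> inj; rewrite -row_free_unit -kermx_eq0; apply/eqP/row_matrixP => i.
rewrite row0; apply: inj; rewrite linear0.
by rewrite -(mul_rV_lin1 l) -row_mul mulmx_ker row0.
Qed.

(** Smooth inverse function theorem. The derivative of the inverse J at y is
    given by the inverse of the matrix of 'd g at J y, hence has the regularity
    of J, and J gains one derivative at each step. *)
Lemma inverse_smooth_rV n (N : set 'rV[R]_n) (g J : 'rV[R]_n -> 'rV[R]_n) :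
  open N -> (forall k, Ck k N g) -> (forall x, N x -> injective ('d g x)) ->
  (forall x, N x -> J (g x) = x) ->
  open (g @` N) /\ forall k, Ck k (g @` N) J.
Proof.
move=> oN gk ginj JK.
have gd x : N x -> differentiable g x by move=> Nx; have [+ _] := gk 1%N; apply.
pose M x : 'M[R]_n := 'J g x.
have Mu x : N x -> M x \in unitmx by move=> /ginj; exact: lin1_mx_unit.
have dgE x v : 'd g x v = v *m M x by rewrite mul_rV_lin1.
have onto x : N x -> forall w, exists v, 'd g x v = w.
  by move=> Nx w; exists (w *m invmx (M x)); rewrite dgE mulmxKV // Mu.
have gN x y : N x -> N y -> g x = g y -> x = y.
  by move=> Nx Ny gxy; rewrite -(JK x Nx) -(JK y Ny) gxy.
have img N' x : open N' -> N' `<=` N -> N' x -> nbhs (g x) (g @` N').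
  move=> oN' N'N N'x; apply: open_image => //.
  - exact: Ck_sub (gk 1%N).
  - by move=> a b /N'N Na /N'N; exact: gN.
  - by move=> a /N'N; exact: onto.
have oI : open (g @` N).
  by rewrite openE => _ [x Nx <-]; exact: img.
split=> //.
have Jc x : N x -> {for g x, continuous J}.
  move=> Nx B; rewrite JK // => nB.
  have [B' [[oB' B'x] B'B]] : exists B', open_nbhs x B' /\ B' `<=` B.
    by move: nB; rewrite nbhsE => -[B' ? ?]; exists B'.
  have := img (B' `&` N) x (openI oB' oN) (@subIsetr _ B' N) (conj B'x Nx).
  by apply: filterS => _ [z [B'z Nz] <-] /=; rewrite JK //; exact: B'B.
have Jd x : N x -> is_diff (g x) J (mulmxr (invmx (M x))).
  move=> Nx; apply: (@is_diff_inverse _ _ g J x).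
  - exact: linear_frame_continuous (frame_rV n) _.
  - exact: gd.
  - by move=> v /=; rewrite dgE mulmxK // Mu.
  - exact: Jc.
  - exact: JK.
  - by apply: filterS (img N x oN (fun _ => id) Nx) => _ [z Nz <-]; rewrite JK.
elim=> [|k IH]; first by move=> _ [x Nx <-]; exact: Jc.
split=> [_ [x Nx <-]|v]; first by have [] := is_diffW (Jd x Nx).
apply: (@Ck_eq _ _ _ _ _ _ (fun y => v *m invmx (M (J y)))) => //.
  move=> _ [x Nx <-]; have [d dE] := is_diffW (Jd x Nx).
  by rewrite (deriveE v d) dE JK.
apply: Ck_rV => // j.
apply: (@Ck_eq _ _ _ _ _ _ (fun y => \sum_i v ord0 i * invmx (M (J y)) i j : R^o)) =>
  //.
  by move=> y _; rewrite mxE.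
apply: Ck_sum => // i; apply: CkM => //; first exact: Ck_cst.
apply: Ck_invmx => // [_ [x Nx <-]|a b]; first by rewrite JK // Mu.
have Jmap y : (g @` N) y -> N (J y) by move=> [x Nx <-]; rewrite JK.
have Mab : Ck k N (fun x => M x a b : R^o).
  have [_ /(_ (delta_mx ord0 a)) gD] := gk k.+1.
  have c := Ck_linear_comp oN (@coord_continuous R _ _ ord0 b : continuous (rV_coord
    b)) gD.
  apply: Ck_eq c => // x Nx.
  rewrite /rV_coord (deriveE _ (gd x Nx)) dgE.
  by rewrite -rowE [RHS]mxE.
exact: (Ck_comp (frame_rV n) oI Jmap IH Mab).
Qed.

End InverseSmooth.

(** The case used for tubes, whose domain is R * R^2 and whose charts take
    values in R^3. *)
Section LinePlane.
Context {R : realType}.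
Local Notation E := (R^o * 'rV[R]_2)%type.

Definition line_plane_rV (p : E) : 'rV[R]_3 :=
  \row_i (if unlift ord0 i is Some j then p.2 ord0 j else p.1).
Definition rV_line_plane (w : 'rV[R]_3) : E :=
  (w ord0 ord0, \row_j w ord0 (lift ord0 j)).

Lemma line_plane_rVK : cancel line_plane_rV rV_line_plane.
Proof.
move=> [t z]; rewrite /rV_line_plane /line_plane_rV; congr pair.
  by rewrite mxE unlift_none.
by apply/rowP => j; rewrite !mxE liftK.
Qed.

Lemma rV_line_planeK : cancel rV_line_plane line_plane_rV.
Proof.
move=> w; apply/rowP => i; rewrite mxE.
by case: unliftP => [j ->|->] //=; rewrite mxE.
Qed.

Lemma line_plane_rV_linear : linear line_plane_rV.
Proof.
by move=> a p q; apply/rowP => i; rewrite !mxE; case: unlift => [j|] //=; rewrite !mxE.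
Qed.

Lemma rV_line_plane_linear : linear rV_line_plane.
Proof.
move=> a w w'; rewrite /rV_line_plane; congr pair; first by rewrite !mxE.
by apply/rowP => j; rewrite !mxE.
Qed.

Lemma inverse_smooth (N : set E) (g : E -> 'rV[R]_3) (J : 'rV[R]_3 -> E) :
  open N -> (forall k, Ck k N g) -> (forall x, N x -> injective ('d g x)) ->
  (forall x, N x -> J (g x) = x) ->
  open (g @` N) /\ forall k, Ck k (g @` N) J.
Proof.
move=> oN gk ginj JK.
have FE : frame (E : normedModType R) := frame_prod frame_line (frame_rV 2).
have [io ioE] := exists_linear rV_line_plane_linear.
have [ka kaE] := exists_linear line_plane_rV_linear.
have ioc : continuous io by exact: linear_frame_continuous (frame_rV 3) io.
have kac : continuous ka by exact: linear_frame_continuous FE ka.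
have ioK w : ka (io w) = w by rewrite -kaE -ioE rV_line_planeK.
have kaK p : io (ka p) = p by rewrite -kaE -ioE line_plane_rVK.
pose N' := io @^-1` N; pose g' := g \o io; pose J' := ka \o J.
have oN' : open N' by apply: open_comp => // x _; exact: ioc.
have gE : g @` N = g' @` N'.
  apply/seteqP; split=> [_ [x Nx <-]|_ [w Nw <-]]; last by exists (io w).
  by exists (ka x); rewrite /N' /g' /= kaK.
have gd x : N x -> differentiable g x by move=> Nx; have [+ _] := gk 1%N; apply.
have g'k k : Ck k N' g'.
  exact: (Ck_comp FE oN' (fun _ => id) (Ck_linear k N' ioc) (gk k)).
have g'inj w : N' w -> injective ('d g' w).
  move=> Nw; have iod : differentiable io w by exact: linear_differentiable.
  rewrite /g' (diff_comp iod (gd _ Nw)) => u v /=.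
  by rewrite diff_lin // => /(ginj _ Nw)/(congr1 ka); rewrite !ioK.
have J'K w : N' w -> J' (g' w) = w.
  by move=> Nw; rewrite /J' /g' /= JK.
have [oI J'k] := inverse_smooth_rV oN' g'k g'inj J'K.
rewrite gE; split=> // k.
apply: (@Ck_eq _ _ _ _ _ _ (fun y => io (J' y))) => // [y _|]; first by rewrite /J'
  /= kaK.
exact: Ck_linear_comp oI ioc (J'k k).
Qed.

(** The two spaces have the same dimension. *)
Lemma injective_diff_onto (g : E -> 'rV[R]_3) (x : E) : injective ('d g x) ->
  forall w, exists v, 'd g x v = w.
Proof.
move=> ginj w.
have [io ioE] := exists_linear rV_line_plane_linear.
have [ka kaE] := exists_linear line_plane_rV_linear.
have ioK w' : ka (io w') = w' by rewrite -kaE -ioE rV_line_planeK.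
pose h : {linear 'rV[R]_3 -> 'rV[R]_3} := 'd g x \o io.
have hinj : injective h by move=> u v /= /ginj/(congr1 ka); rewrite !ioK.
have hu := lin1_mx_unit hinj.
exists (io (w *m invmx (lin1_mx h))).
by rewrite -[LHS]/(h _) -(mul_rV_lin1 h) mulmxKV.
Qed.

End LinePlane.

(** * Flat functions *)

Section FlatFunctions.
Context {R : realType} (c : R).
Hypothesis c0 : 0 < c.

(** The powers of 1 / x make the linear span of these functions closed under
    derivation, so that all of them are proved smooth at once. *)
Definition flat (n : nat) (x : R^o) : R^o :=
  if 0 < x then (x^-1) ^+ n * expR (- c * x^-1) else 0.

Lemma flat_le0 n x : x <= 0 -> flat n x = 0.
Proof. by rewrite /flat ltNge => ->. Qed.

Lemma flat_ge0 n x : 0 <= flat n x.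
Proof.
rewrite /flat; case: ifP => // x0.
by rewrite mulr_ge0 ?expR_ge0 // exprn_ge0 // invr_ge0 ltW.
Qed.

Lemma flat_mul n x : x * flat n.+1 x = flat n x.
Proof.
rewrite /flat; case: ifP => [x0|_]; last by rewrite mulr0.
by rewrite exprS !mulrA divff ?mul1r // gt_eqF.
Qed.

Lemma flat_bounded n : exists2 C : R, 0 < C & forall x, flat n.+1 x <= C.
Proof.
pose C := (n.+1)`!%:R / c ^+ n.+1.
have f0 : 0 < (n.+1)`!%:R :> R by rewrite ltr0n fact_gt0.
have C0 : 0 < C by rewrite divr_gt0 // exprn_gt0.
exists C => // x; rewrite /flat; case: ifP => [x0|_]; last exact: ltW.
set y := x^-1; have y0 : 0 < y by rewrite invr_gt0.
have cy : 0 <= c * y by rewrite mulr_ge0 ?ltW.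
have := expR_ge1Dxn n cy; rewrite mulNr expRN.
rewrite ler_pdivrMr ?expR_gt0 // => H.
apply: (@le_trans _ _ (C * (1 + (c * y) ^+ n.+1 / (n.+1)`!%:R))); last by rewrite
  ler_pM2l.
have cn0 : 0 < c ^+ n.+1 by rewrite exprn_gt0.
rewrite mulrDr mulr1 [X in C + X](_ : _ = y ^+ n.+1); last first.
  rewrite /C exprMn; move: f0 cn0; set f := _%:R; set cn := c ^+ _ => f0 cn0.
  by field; rewrite !gt_eqF.
by rewrite lerDr ltW.
Qed.

Lemma is_derive_flat n (x : R^o) :
  is_derive x (1 : R^o) (flat n) (c * flat n.+2 x - n%:R * flat n.+1 x).
Proof.
have [x0|x0|->] := ltgtP x 0.
- rewrite !flat_le0 ?ltW // !mulr0 subr0.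
  have H : is_derive x (1 : R^o) (cst 0 : R^o -> R^o) 0 by exact: is_derive_cst.
  apply: near_eq_is_derive H; apply: filterS (lt_nbhsl x0) => y y0.
  by rewrite flat_le0 // ltW.
- pose h (y : R^o) : R^o := (y^-1) ^+ n * expR (- c * y^-1).
  suff H : is_derive x (1 : R^o) h (c * flat n.+2 x - n%:R * flat n.+1 x).
    apply: near_eq_is_derive H; apply: filterS (lt_nbhsr x0) => y y0.
    by rewrite /flat y0.
  have xn0 : x != 0 by rewrite gt_eqF.
  have di : is_derive (x : R^o) (1 : R^o) (GRing.inv : R^o -> R^o) (- x ^- 2).
    split; first exact: derivableV.
    by rewrite deriveV // derive_id [LHS]mulr1.
  have di' : is_derive (x : R^o) (1 : R^o) (fun y : R^o => - c * y^-1 : R^o) (- c * -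
    x ^- 2).
    exact: (is_deriveZ (- c) di).
  have de : is_derive (x : R^o) (1 : R^o) (fun y : R^o => expR (- c * y^-1) : R^o)
      (expR (- c * x^-1) * (- c * - x ^- 2)).
    exact: (is_derive1_comp (f := expR) (is_derive_expR _) di').
  have dx : is_derive (x : R^o) (1 : R^o) (fun y : R^o => (y^-1) ^+ n : R^o)
      (n%:R * (x^-1) ^+ n.-1 * - x ^- 2).
    by have := is_deriveX n di; rewrite exprfctE.
  have dh := is_deriveM dx de; rewrite -[X in is_derive _ _ X _]/h in dh.
  apply: (is_derive_eq dh); rewrite /flat x0 {h dh dx}.
  rewrite -exprVn; move: (x^-1) (expR _) => y E.
  case: n => [|m] /=.
    rewrite -[LHS]/(y ^+ 0 * (E * (- c * - y ^+ 2)) + E * (0 * y ^+ 0 * - y ^+ 2)).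
    ring.
  rewrite -[LHS]/(y ^+ m.+1 * (E * (- c * - y ^+ 2)) + E * (m.+1%:R * y ^+ m * - y ^+
    2)).
  by rewrite !exprS; ring.
- rewrite flat_le0 // flat_le0 // !mulr0 subr0.
  have [C C0 CP] := flat_bounded n.+1.
  have lin0 : linear (fun _ : R^o => 0 : R^o) by move=> a u v; rewrite scaler0 addr0.
  have [l lE] := exists_linear lin0.
  have lc : continuous l by rewrite -lE => y; exact: cvg_cst.
  have : is_diff (0 : R^o) (flat n) l.
    apply: is_diff_le => // e e0.
    have eC : 0 < e / C by exact: divr_gt0.
    apply: filterS (nbhs0_lt eC) => y yeC.
    rewrite -lE /= (flat_le0 n (lexx 0)) !subr0.
    rewrite -flat_mul -flat_mul !normrM mulrCA mulrC; apply: ler_wpM2r => //.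
    rewrite (ger0_norm (flat_ge0 _ _)) mulrC.
    apply: (@le_trans _ _ (C * `|y|)); first exact: ler_wpM2r.
    by rewrite mulrC -ler_pdivlMr //; exact: ltW.
  move=> /is_diffW[d dE]; split; first exact: diff_derivable.
  by rewrite (deriveE _ d) dE -lE.
Qed.

Lemma flat_smooth n k (U : set R^o) : open U -> Ck k U (flat n).
Proof.
move=> oU; elim: k n => [|k IH] n.
  move=> x _; apply: differentiable_continuous.
  by apply/derivable1_diffP; have [] := is_derive_flat n x.
apply: (Ck_of_derive oU (fun x _ => is_derive_flat n x)).
exact: CkB oU (CkM oU (Ck_cst k U (c : R^o)) (IH _)) (CkM oU (Ck_cst k U (n%:R :
  R^o)) (IH _)).
Qed.

(** A smooth substitute for the positive part of x, which it approximates to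
    within c. *)
Definition soft_pos (x : R^o) : R^o := x * flat 0 x.

Definition soft_pos' (x : R^o) : R^o := flat 0 x + c * flat 1 x.

Lemma soft_pos_smooth k (U : set R^o) : open U -> Ck k U soft_pos.
Proof. by move=> oU; apply: CkM => //; [exact: Ck_id|exact: flat_smooth]. Qed.

Lemma is_derive_soft_pos (x : R^o) : is_derive x (1 : R^o) soft_pos (soft_pos' x).
Proof.
have [fd fE] := is_derive_flat 0 x.
split; first exact: derivableM.
rewrite deriveM // derive_id fE mul0r subr0 /soft_pos' -(flat_mul 1).
have comm (a b d e : R) : a * (b * d) + e * 1 = e + b * (a * d) by ring.
exact: comm.
Qed.

Lemma soft_pos'_itv x : 0 <= soft_pos' x <= 1.
Proof.
have f0 n : 0 <= flat n x by exact: flat_ge0.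
apply/andP; split; first by rewrite addr_ge0 // mulr_ge0 // ltW.
rewrite /soft_pos' /flat.
case: ifP => _; last by rewrite mulr0 addr0.
rewrite [leLHS](_ : _ = (1 + c * x^-1) / expR (c * x^-1)); last first.
  by rewrite mulNr expRN; ring.
by rewrite ler_pdivrMr ?expR_gt0 // mul1r expR_ge1Dx.
Qed.

Lemma soft_pos_le0 x : x <= 0 -> soft_pos x = 0.
Proof. by move=> x0; rewrite /soft_pos flat_le0 // mulr0. Qed.

Lemma soft_pos_gt0 x : 0 < x -> 0 < soft_pos x.
Proof. by move=> x0; rewrite /soft_pos /flat x0 expr0 mul1r mulr_gt0 // expR_gt0. Qed.

Lemma soft_pos_ge0 x : 0 <= soft_pos x.
Proof. by have [/soft_pos_le0->|/soft_pos_gt0/ltW] := leP x 0. Qed.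

Lemma soft_pos_le x : 0 <= x -> soft_pos x <= x.
Proof.
move=> x0; rewrite /soft_pos ler_piMr // /flat.
case: ifP => // x1; rewrite expr0 mul1r mulNr expRN invf_le1 ?expR_gt0 //.
rewrite (le_trans _ (expR_ge1Dx _)) // lerDl mulr_ge0 ?ltW // invr_gt0.
exact: x1.
Qed.

Lemma soft_pos_ge x : x - c <= soft_pos x.
Proof.
have [x0|x0] := leP x 0.
  by rewrite soft_pos_le0 // subr_le0 (le_trans x0) // ltW.
rewrite /soft_pos /flat x0 expr0 mul1r.
apply: (@le_trans _ _ (x * (1 + - c * x^-1))).
  by rewrite mulrDr mulr1 mulrCA divff ?mulr1 // gt_eqF.
by rewrite ler_pM2l // expR_ge1Dx.
Qed.

End FlatFunctions.

(** * Charts and conformal changes of a form *)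

Section Charts.
Context {R : realType} {V : normedModType R} {T : topologicalType}.
Variable S : charted V T.
Hypothesis hS : smooth_atlas S.

Lemma chart_coordK (i : chart_idx S) y : chart_dom i y ->
  chart_par i (chart_coord i y) = y.
Proof. by case: hS => _ _ /(_ i y) + _ _ => /[apply]-[]. Qed.

Lemma chart_parK (i : chart_idx S) x : chart_im i x ->
  chart_dom i (chart_par i x) /\ chart_coord i (chart_par i x) = x.
Proof. by move=> [y dy <-]; rewrite chart_coordK. Qed.

Lemma chart_imP (i : chart_idx S) y : chart_dom i y -> chart_im i (chart_coord i y).
Proof. by move=> dy; exists y. Qed.

Lemma chart_coord_continuous (i : chart_idx S) y : chart_dom i y ->
  {for y, continuous (chart_coord i)}.
Proof. by case: hS => _ _ /(_ i y) + _ _ => /[apply]-[]. Qed.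

Lemma chart_par_continuous (i : chart_idx S) x : chart_im i x ->
  {for x, continuous (chart_par i)}.
Proof. by case: hS => _ _ _ /(_ i x). Qed.

Lemma chart_dom_open (i : chart_idx S) : open (chart_dom i).
Proof. by case: hS => _ /(_ i)[]. Qed.

Lemma chart_im_open (i : chart_idx S) : open (chart_im i).
Proof. by case: hS => _ /(_ i)[]. Qed.

Lemma transition_smooth (i j : chart_idx S) :
  smooth_open (chart_coord i @` (chart_dom i `&` chart_dom j)) (transition i j).
Proof. by case: hS => _ _ _ _; apply. Qed.

Lemma open_preimage_on (X Z : topologicalType) (N : set X) (B : set Z) (g : X -> Z) :
  open N -> (forall x, N x -> {for x, continuous g}) -> open B ->
  open (N `&` g @^-1` B).
Proof.
move=> oN gc oB; rewrite openE => x [Nx Bgx].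
apply: filterI; first exact: open_nbhs_nbhs.
by apply: (gc x Nx); exact: open_nbhs_nbhs.
Qed.

(** Local expressions exist in every chart around the image point, since the
    transition maps are smooth. *)
Lemma local_rep_chart (FV : frame V) (E : normedModType R) (K : set E)
    (phi : E -> T) (p : E) (i j : chart_idx S) (g : E -> V) :
  K p -> local_rep K phi p j g -> chart_dom i (phi p) ->
  local_rep K phi p i (transition j i \o g).
Proof.
move=> Kp [N [Np [oN gk] Nphi]] dip.
have [oT tk] := transition_smooth j i.
set B := chart_coord j @` (chart_dom j `&` chart_dom i) in oT tk.
have gc x : N x -> {for x, continuous g} by exact: Ck_continuous (gk 0%N) x.
exists (N `&` g @^-1` B); split.
- split=> //; have [djp gE] := Nphi p Np Kp.
  by exists (phi p).
- split=> [|k]; first exact: open_preimage_on.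
  apply: (Ck_comp FV _ _ _ (tk k)); first exact: open_preimage_on.
    by move=> x [].
  by apply: Ck_sub (gk k) => x [].
- move=> q [Nq [y [djy diy] yE]] Kq.
  have [djq gE] := Nphi q Nq Kq.
  have qE : phi q = y by rewrite -(chart_coordK djq) gE -yE chart_coordK.
  by rewrite /transition /= -gE chart_coordK // qE.
Qed.

End Charts.

Section ScaledForms.
Context {R : realType} {V : normedModType R} {T : topologicalType}.
Variable S : charted V T.
Hypothesis hS : smooth_atlas S.
Variable al : form1 S.
Hypothesis hal : smooth_form1 al.

Lemma form1_coef_diff (i : chart_idx S) y v : chart_dom i y ->
  differentiable (fun x => al i (chart_par i x) v : R^o) (chart_coord i y).
Proof.
move=> dy; have [_ _ /(_ i v)[_ /(_ 1%N)[+ _]]] := hal.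
by apply; exact: chart_imP.
Qed.

Lemma ext_d_scale (h : T -> R) (i : chart_idx S) y u v : chart_dom i y ->
  differentiable (fun x => h (chart_par i x) : R^o) (chart_coord i y) ->
  ext_d (scale_form h al) i y u v =
  'D_u (fun x => h (chart_par i x) : R^o) (chart_coord i y) * al i y v
  - 'D_v (fun x => h (chart_par i x) : R^o) (chart_coord i y) * al i y u
  + h y * ext_d al i y u v.
Proof.
move=> dy hd.
have D w z : 'D_w (fun x => scale_form h al i (chart_par i x) z : R^o) (chart_coord i y)
   = h y * 'D_w (fun x => al i (chart_par i x) z : R^o) (chart_coord i y)
   + al i y z * 'D_w (fun x => h (chart_par i x) : R^o) (chart_coord i y).
  have ad := form1_coef_diff z dy.
  have := deriveM (@diff_derivable _ _ _ _ _ w hd) (@diff_derivable _ _ _ _ _ w ad).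
  by rewrite (chart_coordK hS dy).
rewrite /ext_d !D.
have comm (a b c d e f g : R) : a * b + c * d - (a * e + f * g) =
  d * c - g * f + a * (b - e) by ring.
exact: comm.
Qed.

Lemma smooth_form1_scale (h : T -> R) :
  (forall (i : chart_idx S) k, Ck k (chart_im i) (fun x => h (chart_par i x) : R^o)) ->
  smooth_form1 (scale_form h al).
Proof.
move=> hk; have [al_lin al_tr al_sm] := hal; split.
- by move=> i y dy a u v; rewrite /scale_form al_lin //; ring.
- by move=> i j y di dj v; rewrite /scale_form (al_tr i j y).
- move=> i v; have [oI ak] := al_sm i v; split=> // k.
  exact: CkM oI (hk i k) (ak k).
Qed.

End ScaledForms.

Section ScaledContact.
Context {R : realType} {Y : topologicalType}.
Variable S : charted 'rV[R]_3 Y.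
Hypothesis hS : smooth_atlas S.
Variable lam : form1 S.
Hypothesis hlam : contact_form lam.

(** The terms with derivatives of h cancel since they are multiples of lam
    wedge lam. *)
Lemma contact_form_scale (h : Y -> R) : (forall y, h y != 0) ->
  (forall (i : chart_idx S) k, Ck k (chart_im i) (fun x => h (chart_par i x) : R^o)) ->
  contact_form (scale_form h lam).
Proof.
move=> h0 hk; have [slam clam] := hlam.
split=> [|i y dy]; first exact: smooth_form1_scale.
have hd : differentiable (fun x => h (chart_par i x) : R^o) (chart_coord i y).
  by have [+ _] := hk i 1%N; apply; exact: chart_imP.
rewrite /wedge_d !(ext_d_scale hS slam _ _ dy hd) /scale_form.
have := clam i y dy; rewrite /wedge_d.
move: (ext_d lam i y _ _) (ext_d lam i y _ _) (ext_d lam i y _ _) => e12 e20 e01.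
move: ('D__ _ _) ('D__ _ _) ('D__ _ _) (lam i y _) (lam i y _) (lam i y _).
move=> d1 d2 d0 a0 a2 a1 pos.
have h2 : 0 < h y ^+ 2 by rewrite lt_neqAle sqr_ge0 andbT eq_sym sqrf_eq0 h0.
have := mulr_gt0 h2 pos; congr (_ < _); ring.
Qed.

End ScaledContact.

(** * The tube of a thickened Reeb trajectory *)

Section Tube.
Context {R : realType} {Y : topologicalType}.
Variable S : charted 'rV[R]_3 Y.
Variables (lam : form1 S) (A L : R) (phi : (R^o * 'rV[R]_2)%type -> Y).
Hypothesis hY : closed_oriented_manifold S.
Hypothesis hlam : contact_form lam.
Hypothesis A0 : 0 < A.
Hypothesis L0 : 0 < L.
Hypothesis hphi : thickened_reeb_trajectory lam A L phi.

Local Notation E := (R^o * 'rV[R]_2)%type.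
Local Notation K := [set p : E | 0 <= p.1 <= L /\ disk A p.2].

Definition tube_interior : set E :=
  [set p | 0 < p.1 < L /\ sqnorm p.2 < A / pi].

(** The default value 0 is a point of the tube where the deforming function
    vanishes, so that the composite of this function with tube_inv vanishes off
    the tube. *)
Definition tube_inv (y : Y) : E := xget 0 [set p | K p /\ phi p = y].

Definition tube : set Y := phi @` tube_interior.

Let hS : smooth_atlas S. Proof. by case: hY. Qed.
Let slam : smooth_form1 lam. Proof. by case: hlam. Qed.
Let FE : frame (E : normedModType R) := frame_prod frame_line (frame_rV 2).

Lemma sqnorm2E (z : 'rV[R]_2) : sqnorm z = z ord0 ord0 ^+ 2 + z ord0 ord_max ^+ 2.
Proof.
rewrite /sqnorm big_ord_recl big_ord1.
by congr (_ + z ord0 _ ^+ 2); exact: val_inj.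
Qed.

Lemma diskE (z : 'rV[R]_2) : disk A z <-> sqnorm z <= A / pi.
Proof. by rewrite /disk /= -sqnorm2E ler_pdivlMr ?pi_gt0 // mulrC. Qed.

Lemma tube_interior_sub : tube_interior `<=` K.
Proof.
move=> p [/andP[t0 tL] /ltW/diskE zA]; split => //.
by rewrite !ltW.
Qed.

Lemma tube_interior_open : open tube_interior.
Proof.
apply: openI; last first.
  apply: (@open_comp _ _ (fun p : E => sqnorm p.2 : R^o) [set x | x < A / pi]).
    move=> p _; apply: (@continuous_comp _ _ _ snd (@sqnorm R 2 : _ -> R^o)).
      exact: cvg_snd.
    exact: sqnorm_continuous.
  exact: open_lt.
apply: (@open_comp _ _ (fst : E -> R^o) [set x : R^o | 0 < x < L]).
  by move=> p _; exact: cvg_fst.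
by rewrite (_ : [set x : R^o | 0 < x < L] = `]0, L[%classic) //; apply/seteqP.
Qed.

Lemma tube_invK p : K p -> tube_inv (phi p) = p.
Proof.
move=> Kp; case: hphi => [[_ _ inj _] _].
rewrite /tube_inv; case: xgetP => [q _ [Kq qE]|/(_ p)[]//].
exact: inj.
Qed.

(** The chart is arbitrary among those around the image point, as needed when it
    is given by an orbit or by the expression of another map. *)
Lemma tube_chart (p : E) (i : chart_idx S) : tube_interior p -> chart_dom i (phi p) ->
  exists N g, [/\ open N, N p, N `<=` tube_interior, forall k, Ck k N g &
    forall q, N q -> [/\ chart_dom i (phi q), chart_coord i (phi q) = g q,
      injective ('d g q) & forall u, lam i (phi q) ('d g q u) = box_form q u]].
Proof.
move=> Ip di; have Kp := tube_interior_sub Ip.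
have [[rep inj _ _] pull] := hphi.
have [j [gj rj]] := rep p Kp.
have [N [Np [oN gk] Nphi]] := local_rep_chart hS (frame_rV 3) Kp rj di.
exists (N `&` tube_interior), (transition j i \o gj); split=> //.
- by apply: openI => //; exact: tube_interior_open.
- by move=> k; exact: (Ck_sub (@subIsetl _ N tube_interior) (gk k)).
- move=> q [Nq Iq]; have Kq := tube_interior_sub Iq.
  have rq : local_rep K phi q i (transition j i \o gj) by exists N.
  have [dq qE] := Nphi q Nq Kq; split=> //.
    exact: (inj q Kq i _ rq).
  exact: (pull q Kq i _ rq).
Qed.

Lemma tube_atlas y : exists i : chart_idx S, chart_dom i y.
Proof. by case: hS => /(_ y). Qed.

Lemma tube_open : open tube.
Proof.
rewrite openE => _ [p Ip <-].
have [i di] := tube_atlas (phi p).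
have [N [g [oN Np NI gk Ng]]] := tube_chart Ip di.
have JK q : N q -> (tube_inv \o chart_par i) (g q) = q.
  move=> Nq; have [dq qE _ _] := Ng q Nq.
  rewrite /= -qE (chart_coordK hS dq) tube_invK //.
  exact/tube_interior_sub/NI.
have ginj q : N q -> injective ('d g q) by move=> /Ng[].
have [oI _] := inverse_smooth oN gk ginj JK.
have [_ gp _ _] := Ng p Np.
have nI : nbhs (chart_coord i (phi p)) (g @` N).
  by rewrite gp; apply: open_nbhs_nbhs; split=> //; exists p.
have H : nbhs (phi p) (chart_dom i `&` chart_coord i @^-1` (g @` N)).
  have c := chart_coord_continuous hS di.
  apply: filterI; last exact: (c _ nI).
  exact: (open_nbhs_nbhs (conj (chart_dom_open hS i) di)).
rewrite /interior /=; apply: filterS H => y [dy [q Nq qE]]; exists q; first exact: NI.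
have [dq gq _ _] := Ng q Nq.
by rewrite -(chart_coordK hS dy) -qE -gq (chart_coordK hS dq).
Qed.

Lemma tube_inv_smooth (i : chart_idx S) :
  open [set x | chart_im i x /\ tube (chart_par i x)] /\
  forall k, Ck k [set x | chart_im i x /\ tube (chart_par i x)]
    (tube_inv \o chart_par i).
Proof.
have loc x : chart_im i x /\ tube (chart_par i x) ->
    exists N, [/\ open N, N x, N `<=` [set x | chart_im i x /\ tube (chart_par i x)]
      & forall k, Ck k N (tube_inv \o chart_par i)].
  move=> [ix [p Ip pE]]; have [dx xE] := chart_parK hS ix.
  have di : chart_dom i (phi p) by rewrite pE.
  have [N [g [oN Np NI gk Ng]]] := tube_chart Ip di.
  have parE q : N q -> chart_par i (g q) = phi q.
    by move=> /Ng[dq <- _ _]; rewrite (chart_coordK hS dq).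
  have JK q : N q -> (tube_inv \o chart_par i) (g q) = q.
    move=> Nq; rewrite /= parE // tube_invK //.
    exact/tube_interior_sub/NI.
  have ginj q : N q -> injective ('d g q) by move=> /Ng[].
  have [oI Jk] := inverse_smooth oN gk ginj JK.
  exists (g @` N); split=> //.
    by exists p => //; have [_ <- _ _] := Ng p Np; rewrite pE xE.
  move=> _ [q Nq <-]; split; last by rewrite parE //; exists q => //; exact: NI.
  by have [dq <- _ _] := Ng q Nq; exact: chart_imP.
split=> [|k].
  rewrite openE => x /loc[N [oN Nx NW _]].
  exact: filterS NW (open_nbhs_nbhs (conj oN Nx)).
by apply: Ck_local => x /loc[N [oN Nx NW Jk]]; exists N, (tube_inv \o chart_par i).
Qed.

Definition area_form (z w : 'rV[R]_2) : R :=
  z ord0 ord0 * w ord0 ord_max - z ord0 ord_max * w ord0 ord0.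

Lemma derive_box_form (p u v : E) :
  'D_u (fun q => box_form q v : R^o) p = area_form u.2 v.2 / 2.
Proof.
pose l (q : E) : R^o := area_form q.2 v.2 / 2.
have ll : linear l.
  move=> a q q'; rewrite /l /area_form /= !mxE.
  rewrite -[RHS]/(a * ((q.2 ord0 ord0 * v.2 ord0 ord_max
    - q.2 ord0 ord_max * v.2 ord0 ord0) / 2) + (q'.2 ord0 ord0 * v.2 ord0 ord_max
    - q'.2 ord0 ord_max * v.2 ord0 ord0) / 2).
  by field.
have [m mE] := exists_linear ll.
have mc : continuous m by exact: linear_frame_continuous FE m.
rewrite (_ : (fun q => box_form q v : R^o) = (cst v.1 : E -> R^o) + m); last first.
  by rewrite -mE.
have dm : differentiable m p by exact: linear_differentiable.
rewrite deriveD; [|exact: derivable_cst|exact: diff_derivable].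
by rewrite derive_cst add0r (deriveE _ dm) diff_lin // -mE.
Qed.

Lemma ext_d_tube (p : E) (i : chart_idx S) (N : set E) (g : E -> 'rV[R]_3) (u v : E) :
  open N -> N p -> (forall k, Ck k N g) ->
  (forall q, N q -> [/\ chart_dom i (phi q), chart_coord i (phi q) = g q &
     forall u, lam i (phi q) ('d g q u) = box_form q u]) ->
  ext_d lam i (phi p) ('d g p u) ('d g p v) = area_form u.2 v.2.
Proof.
move=> oN Np gk Ng.
have parE q : N q -> chart_par i (g q) = phi q.
  by move=> /Ng[dq <- _]; rewrite (chart_coordK hS dq).
have [al_lin _ al_sm] := slam.
rewrite -(parE p Np) (@ext_d_pullback _ _ _ (frame_rV 3) _ _ _ _ N g (@box_form R)) //.
- by rewrite !derive_box_form /area_form; field.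
- exact: chart_parK.
- by move=> y dy a w w'; exact: al_lin.
- by move=> q /Ng[dq <- _]; exact: chart_imP.
- by move=> q Nq w; rewrite parE //; have [_ _ ->] := Ng q Nq.
Qed.

Lemma tube_continuous : {within K, continuous phi}.
Proof.
apply/subspace_continuousP => p Kp.
have [[rep _ _ _] _] := hphi.
have [i [g [N [Np [oN gk] Ng]]]] := rep p Kp.
have gc : {for p, continuous g} by exact: Ck_continuous (gk 0%N) p Np.
have [dp gp] := Ng p Np Kp.
have pc : {for g p, continuous (chart_par i)}.
  by apply: chart_par_continuous => //; rewrite -gp; exact: chart_imP.
have c : {for p, continuous (chart_par i \o g)} by exact: continuous_comp.
have pE : phi p = chart_par i (g p) by rewrite -gp (chart_coordK hS dp).
move=> B; rewrite -[X in nbhs X]/(phi p) pE => nB.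
have nN : nbhs p N by exact: open_nbhs_nbhs.
apply: filterS2 nN (c B nB) => q Nq Bq Kq.
have [dq gq] := Ng q Nq Kq; move: Bq.
by rewrite /preimage /= -gq (chart_coordK hS dq).
Qed.

Lemma tube_compact : compact K.
Proof.
have -> : K = `[0, L]%classic `*` [set z | sqnorm z <= A / pi].
  apply/seteqP; split=> p [].
    by move=> tL /diskE; split => //; rewrite /= in_itv.
  by rewrite /= in_itv /= => tL /diskE.
apply: compact_setX; first exact: segment_compact.
apply: bounded_closed_compact; last first.
  apply: (@closed_comp _ _ (@sqnorm R 2 : _ -> R^o) [set x | x <= A / pi]).
    by move=> z _; exact: sqnorm_continuous.
  exact: closed_le.
exists (1 + A / pi); split=> [|M ltM z]; first exact: num_real.
move=> /= zA; apply: ltW; apply: le_lt_trans ltM.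
have b0 : 0 <= 1 + A / pi by rewrite addr_ge0 // divr_ge0 ?pi_ge0 // ltW.
have coord_le k : `|z ord0 k| <= 1 + A / pi.
  have : z ord0 k ^+ 2 <= A / pi.
    apply: le_trans zA; rewrite /sqnorm (bigD1 k) //= lerDl.
    by apply: sumr_ge0 => j _; exact: sqr_ge0.
  by have := sqr_ge0 (`|z ord0 k| - 1); rewrite -(real_normK (num_real (z ord0 k)))
    !expr2; nra.
rewrite [`|z|]mx_normrE; apply: bigmax_le => // -[a b] _ /=.
by rewrite (ord1 a).
Qed.

Lemma tube_image_closed (C : set E) : closed C -> C `<=` K -> closed (phi @` C).
Proof.
move=> cC CK; apply: compact_closed; first by case: hY.
apply: continuous_compact.
  exact: continuous_subspaceW CK tube_continuous.
exact: subclosed_compact cC tube_compact CK.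
Qed.

End Tube.

(** * The deforming function *)

Section DeformingFunction.
Context {R : realType}.
Variables (A L c eta : R).
Hypotheses (A0 : 0 < A) (L0 : 0 < L) (c0 : 0 < c) (eta0 : 0 < eta).

Local Notation E := (R^o * 'rV[R]_2)%type.

(** This polynomial exceeds |z|^2 everywhere, and A / pi off the interior of the
    tube, so that what happens where it is at most A / pi happens in a compact
    part of the interior. *)
Definition height (p : E) : R^o :=
  eta + sqnorm p.2 + A / pi / (L / 2) ^+ 2 * (p.1 - L / 2) ^+ 2.

(** Up to the smoothing, expR of this function is the maximum of 1 and of
    A / (pi * height). It is almost as large over the middle of the tube as the
    condition that expR H * |z|^2 increase with |z| allows. *)
Definition tube_bump (p : E) : R^o := soft_pos c (ln (A / pi) - ln (height p)).

Let r0 : 0 < A / pi. Proof. by rewrite divr_gt0 // pi_gt0. Qed.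
Let oE : open [set: E]. Proof. exact: openT. Qed.
Let FE : frame (E : normedModType R) := frame_prod frame_line (frame_rV 2).

Let longitudinal (p : E) : R^o := A / pi / (L / 2) ^+ 2 * ((p.1 - L / 2) * (p.1 - L /
  2)).

Let fst_k k : Ck k setT (fst : E -> R^o).
Proof. by apply: (@Ck_linear R E R^o k setT fst) => x; exact: cvg_fst. Qed.

Let snd_k k : Ck k setT (snd : E -> 'rV[R]_2).
Proof. by apply: (@Ck_linear R E 'rV[R]_2 k setT snd) => x; exact: cvg_snd. Qed.

Let longitudinal_k k : Ck k setT longitudinal.
Proof.
have t := CkB oE (fst_k k) (Ck_cst k setT (L / 2 : R^o)).
exact: (CkM oE (Ck_cst k setT (_ : R^o)) (CkM oE t t)).
Qed.

Lemma heightE : height = (fun p => (eta : R^o) + sqnorm p.2 + longitudinal p).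
Proof. by apply/funext => p; rewrite /height /longitudinal expr2. Qed.

Lemma height_smooth k : Ck k setT height.
Proof.
rewrite heightE.
exact: (CkD oE (CkD oE (Ck_cst k setT (eta : R^o)) (Ck_sqnorm oE (snd_k k)))
  (longitudinal_k k)).
Qed.

Lemma sqnorm_lt_height p : sqnorm p.2 < height p.
Proof.
rewrite /height -addrA ltr_pwDl // lerDl mulr_ge0 ?sqr_ge0 //.
by rewrite divr_ge0 ?sqr_ge0 // ltW.
Qed.

Lemma height_gt0 p : 0 < height p.
Proof. exact: le_lt_trans (sqnorm_ge0 _) (sqnorm_lt_height p). Qed.

Lemma bump_smooth k : Ck k setT tube_bump.
Proof.
have lnk := Ck_comp frame_line oE (fun p _ => height_gt0 p) (height_smooth k) (Ck_ln k).
have Gk := CkB oE (Ck_cst k setT (ln (A / pi) : R^o)) lnk.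
exact: (Ck_comp frame_line oE (fun _ _ => I) Gk (soft_pos_smooth c0 k openT)).
Qed.

Lemma bump_ge0 p : 0 <= tube_bump p.
Proof. exact: soft_pos_ge0. Qed.

Lemma bump_neq0 p : tube_bump p != 0 -> height p < A / pi.
Proof.
move=> H; rewrite ltNge; apply: contra H => rw.
by rewrite /tube_bump soft_pos_le0 // subr_le0 ler_ln // posrE // height_gt0.
Qed.

Lemma bump_gt0 p : height p < A / pi -> 0 < tube_bump p.
Proof.
by move=> wr; rewrite soft_pos_gt0 // subr_gt0 ltr_ln // posrE // height_gt0.
Qed.

Lemma bump0 : tube_bump 0 = 0.
Proof.
apply/eqP/negP => /negP/bump_neq0; rewrite /height /= sub0r sqrrN.
rewrite divfK ?expf_neq0 ?mulf_neq0 ?gt_eqF ?invr_gt0 //.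
by rewrite ltNge lerDr addr_ge0 ?sqnorm_ge0 // ltW.
Qed.

Lemma height_le_interior p : height p <= A / pi -> tube_interior A L p.
Proof.
move=> wr; split; last exact: lt_le_trans (sqnorm_lt_height p) wr.
have L20 : 0 < (L / 2) ^+ 2 by rewrite exprn_gt0 // divr_gt0.
have : A / pi / (L / 2) ^+ 2 * (p.1 - L / 2) ^+ 2 < A / pi.
  apply: lt_le_trans wr; rewrite /height ltrDr.
  by rewrite ltr_pwDl // sqnorm_ge0.
rewrite mulrAC ltr_pdivrMr // ltr_pM2l // => H.
have L2 : 0 < L / 2 by rewrite divr_gt0.
have : `|p.1 - L / 2| < L / 2.
  rewrite -(ltr_pXn2r (_ : 0 < 2)%N) ?nnegrE ?normr_ge0 ?ltW //.
  by rewrite real_normK ?num_real.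
by rewrite ltr_norml => /andP[? ?]; apply/andP; split; lra.
Qed.

(** The angular momentum is smaller at the interior points of the tube than on
    its lateral boundary. *)
Lemma bump_expR_lt (tau : R) p : 0 <= tau <= 1 -> sqnorm p.2 < A / pi ->
  expR (tau * tube_bump p) * sqnorm p.2 < A / pi.
Proof.
move=> /andP[t0 t1] pr.
have [b0|/bump_neq0 wr] := eqVneq (tube_bump p) 0; first by rewrite b0 mulr0 expR0
  mul1r.
have w0 := height_gt0 p.
have G0 : 0 <= ln (A / pi) - ln (height p).
  by rewrite subr_ge0 ler_ln ?posrE // ltW.
have e_le : expR (tau * tube_bump p) <= A / pi / height p.
  have -> : A / pi / height p = expR (ln (A / pi) - ln (height p)).
    by rewrite expRB !lnK // posrE.
  rewrite ler_expR; apply: le_trans (soft_pos_le c0 G0).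
  by rewrite ler_piMl // bump_ge0.
apply: (@le_lt_trans _ _ (A / pi / height p * sqnorm p.2)).
  by rewrite ler_wpM2r // sqnorm_ge0.
by rewrite mulrAC ltr_pdivrMr // ltr_pM2l // sqnorm_lt_height.
Qed.

Lemma derive_height (p : E) (v : 'rV[R]_2) :
  'D_((0, v) : E) height p = 2 * \sum_k p.2 ord0 k * v ord0 k.
Proof.
have sd : differentiable (snd : E -> 'rV[R]_2) p by have [+ _] := snd_k 1; exact.
have fd : differentiable (fst : E -> R^o) p by have [+ _] := fst_k 1; exact.
have qd : differentiable (@sqnorm R 2 : _ -> R^o) p.2.
  by have [+ _] := @sqnorm_smooth R 2 1 setT openT; exact.
have ld : differentiable longitudinal p by have [+ _] := longitudinal_k 1; exact.
have sqd : differentiable (fun p : E => sqnorm p.2 : R^o) p.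
  exact: (differentiable_comp sd qd).
pose h (t : R^o) : R^o := A / pi / (L / 2) ^+ 2 * ((t - L / 2) * (t - L / 2)).
have hd : differentiable h p.1.
  have t := CkB openT (Ck_id 1 [set: R^o]) (Ck_cst 1 setT (L / 2 : R^o)).
  have [+ _] := CkM openT (Ck_cst 1 setT (A / pi / (L / 2) ^+ 2 : R^o)) (CkM openT t t).
  exact.
rewrite heightE.
have dD := @diff_derivable _ _ _ _ _ ((0, v) : E).
rewrite (_ : (fun p => _) = (cst (eta : R^o) + (fun p : E => sqnorm p.2 : R^o)) +
  longitudinal) //.
rewrite deriveD; [|apply: derivableD; [exact: derivable_cst|exact: dD]|exact: dD].
rewrite deriveD; [|exact: derivable_cst|exact: dD].
rewrite derive_cst add0r (derive_comp _ sd qd) derive_sqnorm.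
rewrite (_ : 'D_(0, v) longitudinal p = 0) ?addr0; last first.
  rewrite -[longitudinal]/(fun p : E => h p.1) (derive_comp _ fd hd).
  have -> : 'd (fst : E -> R^o) p (0, v) = 0.
    by rewrite (@diff_lin _ _ _ fst) // => x; exact: cvg_fst.
  by rewrite derive0.
have -> : 'd (snd : E -> 'rV[R]_2) p (0, v) = v.
  by rewrite (@diff_lin _ _ _ snd) // => x; exact: cvg_snd.
by [].
Qed.

Lemma height_center : height (L / 2, 0) = eta.
Proof.
rewrite /height /= subrr expr0n mulr0 addr0 [sqnorm _]big1 ?addr0 // => k _.
by rewrite mxE expr0n.
Qed.

Lemma derive_scalar (f : R^o -> R^o) (x a df : R^o) :
  is_derive x (1 : R^o) f df -> 'D_a f x = a * df.
Proof.
move=> [/derivable1_diffP fd fE].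
by rewrite (deriveE _ fd) (diff1E fd) derive1E fE.
Qed.

Lemma derive_bump (p : E) (v : 'rV[R]_2) :
  'D_((0, v) : E) tube_bump p =
  - (soft_pos' c (ln (A / pi) - ln (height p)) *
     (2 * (\sum_k p.2 ord0 k * v ord0 k) / height p)).
Proof.
have w0 := height_gt0 p.
have wd : differentiable height p by have [+ _] := height_smooth 1; exact.
have lnd : is_derive (height p) (1 : R^o) (@ln R : R^o -> R^o) (height p)^-1.
  exact: is_derive1_ln.
have ld : differentiable (@ln R : R^o -> R^o) (height p).
  by case: lnd => /derivable1_diffP.
have lwd : differentiable (fun p => ln (height p) : R^o) p by exact:
  (differentiable_comp wd ld).
pose G (p : E) : R^o := ln (A / pi) - ln (height p).
have Gd : differentiable G p by apply: differentiableB => //; exact: differentiable_cst.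
have sd := is_derive_soft_pos c0 (G p).
have sdd : differentiable (soft_pos c) (G p) by case: sd => /derivable1_diffP.
have GE : 'd G p (0, v) = - (2 * (\sum_k p.2 ord0 k * v ord0 k) / height p).
  rewrite -(deriveE _ Gd).
  rewrite (_ : G = cst (ln (A / pi) : R^o) - (fun p => ln (height p) : R^o)) //.
  rewrite deriveB; [|exact: derivable_cst|exact: diff_derivable].
  rewrite derive_cst sub0r (derive_comp _ wd ld) (derive_scalar _ lnd).
  by rewrite -(deriveE _ wd) derive_height.
rewrite -[tube_bump]/(fun p => soft_pos c (G p)) (derive_comp _ Gd sdd).
by rewrite (derive_scalar _ sd) GE mulNr mulrC.
Qed.

(** Invariance under the rotations about the axis. *)
Lemma derive_bump_angular (p : E) (v : 'rV[R]_2) :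
  \sum_k p.2 ord0 k * v ord0 k = 0 -> 'D_((0, v) : E) tube_bump p = 0.
Proof. by move=> pv; rewrite derive_bump pv mulr0 mul0r mulr0 oppr0. Qed.

(** The lower bound keeps the axial component of the Reeb field positive, and the
    upper bound keeps it at most 1. *)
Lemma derive_bump_radial (p : E) : -2 < 'D_((0, p.2) : E) tube_bump p <= 0.
Proof.
have w0 := height_gt0 p.
rewrite derive_bump (_ : \sum_k _ = sqnorm p.2); last first.
  by apply: eq_bigr => k _; rewrite expr2.
set th := soft_pos' _ _; have /andP[th0 th1] : 0 <= th <= 1 by exact: soft_pos'_itv.
have s0 := sqnorm_ge0 p.2.
have q0 : 0 <= 2 * sqnorm p.2 / height p by rewrite divr_ge0 ?mulr_ge0 // ltW.
have q2 : 2 * sqnorm p.2 / height p < 2.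
  by rewrite ltr_pdivrMr // ltr_pM2l // sqnorm_lt_height.
rewrite oppr_le0 mulr_ge0 // andbT ltrN2.
by apply: le_lt_trans q2; rewrite ler_piMl.
Qed.

End DeformingFunction.

(** * The deformation *)

Section Deformation.
Context {R : realType} {Y : topologicalType}.
Variable S : charted 'rV[R]_3 Y.
Variables (lam : form1 S) (A L : R) (phi : (R^o * 'rV[R]_2)%type -> Y).
Hypothesis hY : closed_oriented_manifold S.
Hypothesis hlam : contact_form lam.
Hypothesis A0 : 0 < A.
Hypothesis L0 : 0 < L.
Hypothesis hphi : thickened_reeb_trajectory lam A L phi.
Variables (c eta : R).
Hypotheses (c0 : 0 < c) (eta0 : 0 < eta) (etar : eta < A / pi).

Local Notation E := (R^o * 'rV[R]_2)%type.
Local Notation K := [set p : E | 0 <= p.1 <= L /\ disk A p.2].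
Local Notation tinv := (tube_inv A L phi).
Local Notation H := (tube_bump A L c eta).

Let hS : smooth_atlas S. Proof. by case: hY. Qed.
Let FE : frame (E : normedModType R) := frame_prod frame_line (frame_rV 2).

Definition tube_deformation (tau : R) (y : Y) : R := tau * H (tinv y).

(** Where the composite with tube_inv does not vanish, tube_inv has not taken its
    default value. *)
Lemma tube_inv_bump y : H (tinv y) != 0 ->
  height A L eta (tinv y) < A / pi /\ phi (tinv y) = y.
Proof.
move=> Hy; split; first exact: bump_neq0 Hy.
move: Hy; rewrite /tube_inv; case: xgetP => [q _ [_ qE]//|_].
by rewrite bump0 ?eqxx.
Qed.

Lemma tube_inv_bump_tube y : H (tinv y) != 0 -> tube A L phi y.
Proof.
move=> /tube_inv_bump[/ltW wr yE]; exists (tinv y) => //.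
exact: height_le_interior wr.
Qed.

(** The support of the deforming function is the image of a compact part of the
    interior of the tube, hence closed: near a point of Y, either phi has a smooth
    inverse or the function vanishes. *)
Lemma bump_tube_smooth (i : chart_idx S) k :
  Ck k (chart_im i) (fun x => H (tinv (chart_par i x)) : R^o).
Proof.
pose C := [set p : E | height A L eta p <= A / pi].
have CK : C `<=` K by move=> p /(height_le_interior A0 L0 eta0); exact:
  tube_interior_sub.
have cC : closed C.
  apply: (@closed_comp _ _ (height A L eta) [set x : R^o | x <= A / pi]).
    by move=> z _; exact: (height_smooth A L eta 0).
  exact: closed_le.
have cpC := tube_image_closed hY A0 hphi cC CK.
apply: Ck_local => x ix.
have [[p Cp pE]|nC] := pselect ((phi @` C) (chart_par i x)).
  have [oW Wk] := tube_inv_smooth hY hphi i.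
  exists [set x | chart_im i x /\ tube A L phi (chart_par i x)].
  exists (fun x => H (tinv (chart_par i x))); split=> //.
    by split=> //; exists p => //; exact: height_le_interior Cp.
  exact: (Ck_comp FE oW (fun _ _ => I) (Wk k) (bump_smooth L A0 c0 eta0 k)).
exists (chart_im i `&` chart_par i @^-1` (~` (phi @` C))), (cst 0); split=> //.
- apply: open_preimage_on; first exact: chart_im_open.
    by move=> z; exact: chart_par_continuous.
  exact: closed_openC.
- exact: Ck_cst.
- move=> z [iz nCz]; apply/eqP/negP => /negP /tube_inv_bump[/ltW wr zE].
  by apply: nCz; exists (tinv (chart_par i z)).
Qed.

Lemma tube_positive_deformation :
  positive_deformation lam (tube A L phi) tube_deformation.
Proof.
split.
- move=> i p [_ ip]; exists [set x : R^o * 'rV[R]_3 | chart_im i x.2].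
  exists (fun x => tube_deformation x.1 (chart_par i x.2)).
  have oN : open [set x : R^o * 'rV[R]_3 | chart_im i x.2].
    apply: (@open_comp _ _ snd (chart_im i)); last exact: chart_im_open.
    by move=> x _; exact: cvg_snd.
  split=> //; split=> // k; apply: CkM => //.
    by apply: (@Ck_linear R _ R^o k _ fst) => x; exact: cvg_fst.
  have sk : Ck k [set x : R^o * 'rV[R]_3 | chart_im i x.2] (snd : R^o * 'rV[R]_3 ->
    'rV[R]_3).
    by apply: (@Ck_linear R _ 'rV[R]_3 k _ snd) => x; exact: cvg_snd.
  exact: (Ck_comp (frame_rV 3) oN (fun _ => id) sk (bump_tube_smooth i k)).
- move=> tau _; apply: contact_form_scale => // [y|i k].
    by rewrite gt_eqF // expR_gt0.
  have oI := chart_im_open hS i.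
  have fk : Ck k (chart_im i) (fun x => tube_deformation tau (chart_par i x) : R^o).
    exact: (CkM oI (Ck_cst k _ (tau : R^o)) (bump_tube_smooth i k)).
  exact: (Ck_comp frame_line oI (fun _ _ => I) fk (Ck_expR k openT)).
- by move=> y; rewrite /tube_deformation mul0r.
- move=> tau y _ ny; rewrite /tube_deformation.
  have [->|/tube_inv_bump_tube//] := eqVneq (H (tinv y)) 0.
  by rewrite mulr0.
- split=> [y|]; first by rewrite /tube_deformation mul1r bump_ge0.
  have wr : height A L eta (L / 2, 0) < A / pi.
    by rewrite height_center.
  exists (phi (L / 2, 0)); rewrite /tube_deformation mul1r (tube_invK hphi).
    by rewrite gt_eqF // bump_gt0.
  exact/tube_interior_sub/height_le_interior/ltW/wr.
Qed.

Lemma tube_deformation_phi tau p : K p -> tube_deformation tau (phi p) = tau * H p.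
Proof. by move=> Kp; rewrite /tube_deformation (tube_invK hphi). Qed.

(** The Reeb vector of the deformed form, in the coordinates of the tube. Its
    axial component comes from pairing with the radial vector, and the
    conservation law for expR f * |z|^2 from pairing with the generator of the
    rotations. *)
Lemma tube_reeb (tau : R) (p : E) (i : chart_idx S) (N : set E) (g : E -> 'rV[R]_3)
    (w : E) :
  0 <= tau <= 1 -> N `<=` tube_interior A L ->
  open N -> N p -> (forall k, Ck k N g) ->
  (forall q, N q -> [/\ chart_dom i (phi q), chart_coord i (phi q) = g q,
     injective ('d g q) & forall u, lam i (phi q) ('d g q u) = box_form q u]) ->
  is_reeb (deform lam tube_deformation tau) i (phi p) ('d g p w) ->
  0 < w.1 <= 1 /\
  (tau * 'd H p w) * sqnorm p.2 + 2 * (\sum_k p.2 ord0 k * w.2 ord0 k) = 0.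
Proof.
move=> tau01 NI oN Np gk Ng [reeb1 reeb2].
have Ip := NI p Np; have Kp := tube_interior_sub Ip.
have [di gp _ lamE] := Ng p Np.
pose h y := expR (tube_deformation tau y).
have hd : differentiable (fun x => h (chart_par i x) : R^o) (chart_coord i (phi p)).
  have oI := chart_im_open hS i.
  have fk : Ck 1 (chart_im i) (fun x => tube_deformation tau (chart_par i x) : R^o).
    exact: (CkM oI (Ck_cst 1 _ (tau : R^o)) (bump_tube_smooth i 1)).
  have [hd _] := Ck_comp frame_line oI (fun _ _ => I) fk (Ck_expR 1 openT).
  by apply: hd; exact: chart_imP.
have Hd : differentiable H p by have [+ _] := bump_smooth L A0 c0 eta0 1; exact.
have gd : differentiable g p by have [+ _] := gk 1%N; exact.
have DhE (e : E) : 'D_('d g p e) (fun x => h (chart_par i x) : R^o) (chart_coord i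
  (phi p)) =
    h (phi p) * (tau * 'd H p e).
  rewrite gp in hd *; rewrite -(derive_comp e gd hd).
  have tHd : differentiable (fun q => tau * H q : R^o) p by exact: (differentiableZ
    tau Hd).
  have ed : is_derive (tau * H p : R^o) (1 : R^o) (expR : R^o -> R^o) (expR (tau * H
    p)).
    exact: is_derive_expR.
  have edd : differentiable (expR : R^o -> R^o) (tau * H p : R^o) by case: ed =>
    /derivable1_diffP.
  have E1 : \forall q \near p, h (chart_par i (g q)) = expR (tau * H q).
    apply: filterS (open_nbhs_nbhs (conj oN Np)) => q Nq.
    have [dq <- _ _] := Ng q Nq; rewrite (chart_coordK hS dq) /h tube_deformation_phi
      //.
    exact/tube_interior_sub/NI.
  rewrite (near_eq_derive e E1) (derive_comp e tHd edd) (derive_scalar _ ed).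
  rewrite -(deriveE e tHd).
  have -> : 'D_e (fun q => tau * H q : R^o) p = tau * 'd H p e.
    by have := deriveZ tau (@diff_derivable _ _ _ _ _ e Hd); rewrite (deriveE e Hd).
  by rewrite /h tube_deformation_phi // mulrC.
have reebE (e : E) : tau * 'd H p w * box_form p e - tau * 'd H p e * box_form p w
    + area_form w.2 e.2 = 0.
  have h0 : h (phi p) != 0 by rewrite gt_eqF // expR_gt0.
  apply: (mulfI h0); rewrite mulr0 -(reeb1 ('d g p e)).
  have slam : smooth_form1 lam by case: hlam.
  rewrite /deform (ext_d_scale hS slam _ _ di hd) !DhE !lamE.
  rewrite (ext_d_tube hY hlam w e oN Np gk); last first.
    by move=> q /Ng[].
  by rewrite -/(h _); ring.
have bE : expR (tau * H p) * box_form p w = 1.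
  by move: reeb2; rewrite /deform /scale_form lamE tube_deformation_phi.
have sum2 (a b : 'rV[R]_2) : \sum_k a ord0 k * b ord0 k =
    a ord0 ord0 * b ord0 ord0 + a ord0 ord_max * b ord0 ord_max.
  rewrite big_ord_recl big_ord1.
  by rewrite (_ : lift _ _ = ord_max) //; exact: val_inj.
pose J : 'rV[R]_2 := \row_j (if j == ord0 then - p.2 ord0 ord_max else p.2 ord0 ord0).
have J0 : J ord0 ord0 = - p.2 ord0 ord_max by rewrite mxE.
have J1 : J ord0 ord_max = p.2 ord0 ord0 by rewrite mxE.
have angular : 'd H p (0, J) = 0.
  rewrite -(deriveE _ Hd); apply: derive_bump_angular => //.
  by rewrite sum2 J0 J1; ring.
have radial := derive_bump_radial L A0 c0 eta0 p; rewrite (deriveE _ Hd) in radial.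
have := reebE (0, J); rewrite angular sum2 sqnorm2E.
have := reebE (0, p.2).
have := bump_ge0 A L c eta p; move: bE radial.
rewrite /box_form /area_form /= J0 J1.
move: (H p) ('d H p (0, p.2)) ('d H p w) => Hp d1 dw bE /andP[d1l d1u] Hp0 r1 r2.
case/andP: tau01 => t0 t1.
set b := w.1 + _ in bE.
have b01 : 0 < b <= 1.
  have e0 := expR_gt0 (tau * Hp).
  have e1 : 1 <= expR (tau * Hp) by rewrite -expR0 ler_expR mulr_ge0.
  apply/andP; split; first by rewrite -(pmulr_rgt0 _ e0) bE ltr01.
  by rewrite -bE ler_peMl // -(pmulr_rge0 _ e0) bE ler01.
case/andP: b01 => b0 b1.
have td : -2 < tau * d1 <= 0 by apply/andP; split; nra.
case/andP: td => td0 td1.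
have solve (m bb x y a0 a1 W k : R) :
    k * (0 + (x * y - y * x) / 2) - m * bb + (a0 * y - a1 * x) = 0 ->
    bb = W + (x * a1 - y * a0) / 2 -> W = bb * (1 + m / 2) by nra.
have w1E : w.1 = b * (1 + tau * d1 / 2) by exact: (solve _ _ _ _ _ _ _ _ r1 (erefl b)).
split; first by apply/andP; split; rewrite w1E; nra.
move: r2; rewrite !expr2; set x := p.2 _ _; set y := p.2 _ _; set w0 := w.2 _ _; set
  w1 := w.2 _ _.
nra.
Qed.

End Deformation.

(** * Reeb orbits through the tube *)

Lemma closed_least {R : realType} (B : set R^o) (t0 s : R^o) : closed B -> t0 <= s ->
  B s ->
  exists m : R^o, [/\ B m, t0 <= m & forall x, t0 <= x < m -> ~ B x].
Proof.
move=> cB t0s Bs; pose C := B `&` `[t0, s]%classic.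
have cC : compact C.
  by rewrite /C setIC; apply: compact_closedI => //; exact: segment_compact.
have C0 : C !=set0 by exists s; split=> //; rewrite /= in_itv /= t0s lexx.
have idc : {within C, continuous (idfun : R^o -> R)}.
  by apply: continuous_subspaceT => x; exact: cvg_id.
have [m /set_mem[Bm ms] mmin] := compact_EVT_min C0 cC idc.
move: ms; rewrite /= in_itv /= => /andP[t0m ms].
exists m; split=> // x /andP[t0x xm] Bx.
have := mmin x; rewrite leNgt xm => /(_ _)/negP; apply => //.
by apply/mem_set; split => //; rewrite /= in_itv /= t0x (ltW (lt_le_trans xm ms)).
Qed.

Lemma closed_greatest {R : realType} (B : set R^o) (t0 s : R^o) : closed B -> s <= t0
  -> B s ->
  exists m : R^o, [/\ B m, m <= t0 & forall x, m < x <= t0 -> ~ B x].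
Proof.
move=> cB st0 Bs.
have cN : closed [set x : R^o | B (- x)].
  by apply: (@closed_comp _ _ (-%R : R^o -> R^o)) => // x _; exact: opp_continuous.
have t0s : - t0 <= - s by rewrite lerN2.
have [|m [Bm mt0 mP]] := closed_least cN t0s _; first by rewrite /= opprK.
exists (- m); split=> //; first by rewrite lerNl.
move=> x /andP[mx xt0] Bx; apply: (mP (- x)); last by rewrite /= opprK.
by rewrite lerN2 xt0 ltrNl.
Qed.

Section Dynamics.
Context {R : realType} {Y : topologicalType}.
Variable S : charted 'rV[R]_3 Y.
Variables (lam : form1 S) (A L : R) (phi : (R^o * 'rV[R]_2)%type -> Y).
Hypothesis hY : closed_oriented_manifold S.
Hypothesis hlam : contact_form lam.
Hypothesis A0 : 0 < A.
Hypothesis L0 : 0 < L.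
Hypothesis hphi : thickened_reeb_trajectory lam A L phi.
Variables (c eta : R).
Hypotheses (c0 : 0 < c) (eta0 : 0 < eta).
Variables (tau a : R) (gamma : R -> Y).
Hypothesis tau01 : 0 <= tau <= 1.
Hypothesis orbit : reeb_orbit (deform lam (tube_deformation A L phi c eta) tau) a gamma.

Local Notation E := (R^o * 'rV[R]_2)%type.
Local Notation K := [set p : E | 0 <= p.1 <= L /\ disk A p.2].
Local Notation tinv := (tube_inv A L phi).
Local Notation H := (tube_bump A L c eta).

Let hS : smooth_atlas S. Proof. by case: hY. Qed.
Let FE : frame (E : normedModType R) := frame_prod frame_line (frame_rV 2).

Let x_ (t : R^o) : E := tinv (gamma t).
Let axial (t : R^o) : R^o := (x_ t).1.
Let momentum (t : R^o) : R^o := expR (tau * H (x_ t)) * sqnorm (x_ t).2.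

Lemma orbit_derive (t : R^o) : tube A L phi (gamma t) ->
  exists w : E, [/\ differentiable x_ t, 'd x_ t 1 = w, 0 < w.1 <= 1 &
   (tau * 'd H (x_ t) w) * sqnorm (x_ t).2 +
     2 * (\sum_k (x_ t).2 ord0 k * w.2 ord0 k) = 0].
Proof.
move=> [p Ip pE]; have Kp := tube_interior_sub Ip.
have xE : x_ t = p by rewrite /x_ -pE (tube_invK hphi).
have [i di] := tube_atlas hY (phi p).
have [N [g [oN Np NI gk Ng]]] := tube_chart hY hphi Ip di.
have [_ gp ginj _] := Ng p Np.
have [_ _ gc /(_ t i)] := orbit; rewrite -pE => /(_ di)[v [reeb dv]].
have [w wE] := injective_diff_onto ginj v.
rewrite -wE in reeb dv.
have gd : differentiable g p by have [+ _] := gk 1%N; exact.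
pose J := tinv \o chart_par i.
have Jd : differentiable J (g p).
  have [_ /(_ 1%N)[+ _]] := tube_inv_smooth hY hphi i; apply; split.
    by rewrite -gp; exact: chart_imP.
  by rewrite -gp (chart_coordK hS di); exists p.
have dJ : 'd J (g p) ('d g p w) = w.
  rewrite -(deriveE _ Jd) -(derive_comp w gd Jd).
  have E1 : \forall q \near p, J (g q) = q.
    apply: filterS (open_nbhs_nbhs (conj oN Np)) => q Nq.
    have [dq <- _ _] := Ng q Nq; rewrite /J /= (chart_coordK hS dq) (tube_invK hphi) //.
    exact/tube_interior_sub/NI.
  by rewrite (near_eq_derive w E1) derive_id.
pose cg := chart_coord i \o gamma : R^o -> 'rV[R]_3.
have cgt : cg t = g p by rewrite /cg /= -pE gp.
have [cgd cgE] : differentiable cg t /\ 'd cg t 1 = 'd g p w.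
  case: dv => dv1 dv2; have cgd : differentiable cg t by apply/derivable1_diffP.
  by split => //; rewrite -(deriveE _ cgd).
have Jd' : differentiable J (cg t) by rewrite cgt.
have E2 : \forall s \near t, x_ s = (J \o cg) s.
  have dti : chart_dom i (gamma t) by rewrite -pE.
  have nd : nbhs t (gamma @^-1` chart_dom i).
    exact: (gc t _ (open_nbhs_nbhs (conj (chart_dom_open hS i) dti))).
  by apply: filterS nd => s ds; rewrite /J /cg /x_ /= (chart_coordK hS ds).
have dJc : is_diff t (J \o cg) ('d (J \o cg) t).
  by apply: differentiableP; exact: differentiable_comp.
have [xd xdE] := is_diffW (near_eq_is_diff E2 dJc).
have [wb wQ] := tube_reeb hY hlam A0 L0 hphi c0 eta0 tau01 NI oN Np gk Ng reeb.
have dxE : 'd x_ t 1 = w.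
  by rewrite xdE (diff_comp cgd Jd') -[LHS]/('d J (cg t) ('d cg t 1)) cgE cgt dJ.
by exists w; split; [exact: xd|exact: dxE|exact: wb|rewrite xE; exact: wQ].
Qed.

Lemma axial_derive (t : R^o) : tube A L phi (gamma t) ->
  derivable axial t 1 /\ 0 < 'D_1 axial t <= 1.
Proof.
move=> /orbit_derive[w [xd xE wb _]].
have ad : differentiable axial t.
  apply: (@differentiable_comp _ _ _ _ x_ (fst : E -> R^o)) => //.
  by apply: (@linear_differentiable _ _ _ fst) => x; exact: cvg_fst.
split; first exact: diff_derivable.
have fd : differentiable (fst : E -> R^o) (x_ t).
  by apply: (@linear_differentiable _ _ _ fst) => x; exact: cvg_fst.
rewrite -[axial]/(fun s => fst (x_ s)) (derive_comp _ xd fd) xE (deriveE _ fd).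
by rewrite (@diff_lin _ _ _ fst) // => x; exact: cvg_fst.
Qed.

Lemma momentum_derive (t : R^o) : tube A L phi (gamma t) ->
  derivable momentum t 1 /\ 'D_1 momentum t = 0.
Proof.
move=> /orbit_derive[w [xd xE _ wQ]].
pose e (p : E) : R^o := expR (tau * H p).
pose q (p : E) : R^o := sqnorm p.2.
have oE : open [set: E] by exact: openT.
have Hd : differentiable H (x_ t) by have [+ _] := bump_smooth L A0 c0 eta0 1; exact.
have tHd : differentiable (fun p => tau * H p : R^o) (x_ t) by exact:
  (differentiableZ tau Hd).
have ed1 : is_derive (tau * H (x_ t) : R^o) (1 : R^o) (expR : R^o -> R^o) (expR (tau
  * H (x_ t))).
  exact: is_derive_expR.
have ed2 : differentiable (expR : R^o -> R^o) (tau * H (x_ t) : R^o).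
  by case: ed1 => /derivable1_diffP.
have ed : differentiable e (x_ t) by exact: (differentiable_comp tHd ed2).
have sd : differentiable (snd : E -> 'rV[R]_2) (x_ t).
  by apply: (@linear_differentiable _ _ _ snd) => x; exact: cvg_snd.
have sq : differentiable (@sqnorm R 2 : _ -> R^o) (x_ t).2.
  by have [+ _] := @sqnorm_smooth R 2 1 setT openT; exact.
have qd : differentiable q (x_ t) by exact: (differentiable_comp sd sq).
have md : differentiable (fun p => e p * q p : R^o) (x_ t) by exact: differentiableM.
have mt : differentiable momentum t by exact: (differentiable_comp xd md).
split; first exact: diff_derivable.
rewrite -[momentum]/(fun s => e (x_ s) * q (x_ s)) (derive_comp _ xd md) xE.
have de : derivable e (x_ t) w by exact: diff_derivable.
have dq : derivable q (x_ t) w by exact: diff_derivable.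
have -> : 'D_w (fun p => e p * q p : R^o) (x_ t) = e (x_ t) * 'D_w q (x_ t) + q (x_
  t) * 'D_w e (x_ t).
  exact: deriveM de dq.
rewrite (derive_comp _ sd sq) derive_sqnorm (derive_comp _ tHd ed2) (derive_scalar _
  ed1).
rewrite (@diff_lin _ _ _ snd); last by move=> x; exact: cvg_snd.
rewrite -(deriveE _ tHd).
have -> : 'D_w (fun p => tau * H p : R^o) (x_ t) = tau * 'd H (x_ t) w.
  by have := deriveZ tau (@diff_derivable _ _ _ _ _ w Hd); rewrite (deriveE w Hd).
rewrite /e /q /=; move: wQ; set s := 2 * _; set d := tau * _; set z := sqnorm _.
have key (x y u v : R) : u * y + v = 0 -> x * v + y * (u * x) = 0.
  by move=> k; rewrite -[RHS](mulr0 x) -k; ring.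
exact: key.
Qed.

(** The end points of a crossing of the tube lie on its boundary, where tube_inv
    is only continuous along the tube. *)
Lemma orbit_continuous : {within [set t | (phi @` K) (gamma t)], continuous x_}.
Proof.
apply/subspace_continuousP => t [p Kp pE] B.
have xE : x_ t = p by rewrite /x_ -pE (tube_invK hphi).
rewrite -[X in nbhs X]/(x_ t) xE => nB; have [[_ _ _ inv_c] _] := hphi.
have [_ _ gc _] := orbit.
have nY : nbhs (gamma t) [set y | forall q, K q -> phi q = y -> B q].
  by rewrite -pE; exact: inv_c.
have nt : nbhs t (gamma @^-1` [set y | forall q, K q -> phi q = y -> B q]).
  exact: (gc t _ nY).
apply: filterS nt => s Hs [q Kq qE].
have xs : x_ s = q by rewrite /x_ -qE (tube_invK hphi).
by suff : B (x_ s) by []; rewrite xs; exact: Hs.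
Qed.

(** Integration of tube_reeb along the orbit. The end points lie in the closed
    tube as limits of points of the tube, and tube_inv is continuous there along
    the orbit. *)
Lemma transit (s s' : R^o) : s < s' ->
  (forall x, s < x < s' -> tube A L phi (gamma x)) ->
  [/\ (phi @` K) (gamma s), (phi @` K) (gamma s'),
      0 < axial s' - axial s <= s' - s & momentum s' = momentum s].
Proof.
move=> ss' inside; have [_ _ gc _] := orbit.
have cK : closed (phi @` K).
  apply: (tube_image_closed hY A0 hphi) => //.
  by apply: compact_closed; [exact: norm_hausdorff|exact: tube_compact].
have cZ : closed [set t : R^o | (phi @` K) (gamma t)].
  by apply: (@closed_comp _ _ (gamma : R^o -> Y)) => // t _; exact: gc.
have ZP (t : R^o) : s <= t <= s' -> (phi @` K) (gamma t).
  move=> /andP[st ts']; apply: cZ => B /nbhs_ballP[e e0 Be].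
  have [x sxs' xe] : exists2 x, s < x < s' & `|t - x| < e.
    rewrite /= in e0; pose m := Num.min e (s' - s) / 4.
    have m0 : 0 < m by rewrite divr_gt0 // lt_min e0 subr_gt0.
    have me : m < e.
      rewrite ltr_pdivrMr // (@le_lt_trans _ _ e) ?ge_min ?lexx //.
      by rewrite ltr_pMr // ltr1n.
    have ms : m <= (s' - s) / 4 by rewrite ler_pM2r // ge_min lexx orbT.
    have [tl|tl] := leP t ((s + s') / 2).
      exists (t + m); last by rewrite opprD addrA subrr add0r normrN gtr0_norm.
      by apply/andP; split; lra.
    exists (t - m); last by rewrite opprB addrCA subrr addr0 gtr0_norm.
    by apply/andP; split; lra.
  exists x; split; last by apply: Be; rewrite -ball_normE.
  have [p Ip pE] := inside x sxs'; exists p => //; exact: tube_interior_sub.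
have xc : {within `[s, s'], continuous x_}.
  by apply: continuous_subspaceW orbit_continuous => t /=; rewrite in_itv /=; exact: ZP.
have tub x : x \in `]s, s'[ -> tube A L phi (gamma x) by rewrite in_itv; exact: inside.
split; [by apply: ZP; rewrite lexx ltW|by apply: ZP; rewrite lexx ltW| |].
  have ac : {within `[s, s'], continuous axial}.
    move=> t; apply: (@continuous_comp (subspace `[s, s']%classic) E R^o x_ fst).
      exact: xc.
    exact: cvg_fst.
  have ad x : x \in `]s, s'[ -> is_derive x 1 axial ('D_1 axial x).
    by move=> /tub/axial_derive[? _]; exact: derivableP.
  have [x /tub/axial_derive[_ /andP[d0 d1]] ->] := MVT ss' ad ac.
  have ss0 : 0 < s' - s by rewrite subr_gt0.
  by rewrite mulr_gt0 //= ler_piMl // ltW.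
have mc : {within `[s, s'], continuous momentum}.
  have oE : open [set: E] by exact: openT.
  have ek : Ck 0 setT (fun p : E => expR (tau * H p) * sqnorm p.2 : R^o).
    have Hk := CkM oE (Ck_cst 0 setT (tau : R^o)) (bump_smooth L A0 c0 eta0 0).
    have ek := Ck_comp frame_line oE (fun _ _ => I) Hk (Ck_expR 0 openT).
    apply: (CkM oE ek); apply: (Ck_sqnorm oE).
    by apply: (@Ck_linear R E 'rV[R]_2 0 setT snd) => x; exact: cvg_snd.
  move=> t; apply: (@continuous_comp (subspace `[s, s']%classic) E R^o x_
    (fun p : E => expR (tau * H p) * sqnorm p.2 : R^o)).
    exact: xc.
  exact: ek.
have md x : x \in `]s, s'[ -> is_derive x 1 momentum ('D_1 momentum x).
  by move=> /tub/momentum_derive[? _]; exact: derivableP.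
have [x /tub/momentum_derive[_ ->]] := MVT ss' md mc.
by rewrite mul0r => /subr0_eq.
Qed.

Lemma axial_bounds (t : R^o) : tube A L phi (gamma t) ->
  0 < axial t < L /\ momentum t < A / pi.
Proof.
move=> [p Ip pE]; have xE : x_ t = p.
  by rewrite /x_ -pE (tube_invK hphi) //; exact: tube_interior_sub.
rewrite /axial /momentum xE; case: Ip => ? ?; split=> //.
exact: bump_expR_lt.
Qed.

(** Conservation of the momentum keeps the orbit away from the lateral boundary
    of the tube. *)
Lemma exit_axial (t : R^o) : (phi @` K) (gamma t) -> momentum t < A / pi ->
  ~ tube A L phi (gamma t) -> axial t = 0 \/ axial t = L.
Proof.
move=> [p Kp pE] mt nt; have xE : x_ t = p by rewrite /x_ -pE (tube_invK hphi).
rewrite /axial xE; case: (Kp) => /andP[p0 pL] _.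
have [->|pn0] := eqVneq p.1 0; first by left.
have [->|pnL] := eqVneq p.1 L; first by right.
case: nt; exists p => //; split.
  by rewrite !lt_neqAle p0 pL pnL eq_sym pn0.
apply: le_lt_trans mt; rewrite /momentum xE ler_peMl ?sqnorm_ge0 //.
rewrite -expR0 ler_expR mulr_ge0 ?bump_ge0 //.
by case/andP: tau01.
Qed.

(** A closed orbit through the tube would have to cross it from one end to the
    other, which takes a time at least L, without coming back to its starting
    point. *)
Lemma no_short_orbit : a <= L -> forall t, ~ tube A L phi (gamma t).
Proof.
move=> aL t0 Ut0; have [a0 per gc _] := orbit.
have cB : closed [set t : R^o | ~ tube A L phi (gamma t)].
  apply: (@closed_comp _ _ (gamma : R^o -> Y) (~` tube A L phi)) => [t _|].
    exact: gc.
  by apply: open_closedC; exact: tube_open hY hphi.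
have axial_per t : axial (t + a) = axial t by rewrite /axial /x_ per.
have not_trapped s : ~ (forall x, s < x < s + a -> tube A L phi (gamma x)).
  have ssa : s < s + a by rewrite ltrDl.
  by move=> /(transit ssa)[_ _ + _]; rewrite axial_per subrr ltxx.
have [s2 t0s2 Bs2] : exists2 s, t0 <= s & ~ tube A L phi (gamma s).
  apply: contrapT => H0; apply: (not_trapped t0) => x /andP[/ltW t0x _].
  by apply: contrapT => nx; apply: H0; exists x.
have [s1 s1t0 Bs1] : exists2 s, s <= t0 & ~ tube A L phi (gamma s).
  apply: contrapT => H0; apply: (not_trapped (t0 - a)) => x; rewrite subrK => /andP[_
    /ltW xt0].
  by apply: contrapT => nx; apply: H0; exists x.
have [t2 [Bt2 t0t2 in2]] := closed_least cB t0s2 Bs2.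
have [t1 [Bt1 t1t0 in1]] := closed_greatest cB s1t0 Bs1.
have t0lt2 : t0 < t2.
  by rewrite lt_neqAle t0t2 andbT; apply/eqP => E0; apply: Bt2; rewrite -E0.
have t1lt0 : t1 < t0.
  by rewrite lt_neqAle t1t0 andbT; apply/eqP => E0; apply: Bt1; rewrite E0.
have in02 x : t0 < x < t2 -> tube A L phi (gamma x).
  by move=> /andP[/ltW t0x xt2]; apply: contrapT => nx; apply: (in2 x); rewrite ?t0x.
have in10 x : t1 < x < t0 -> tube A L phi (gamma x).
  by move=> /andP[t1x /ltW xt0]; apply: contrapT => nx; apply: (in1 x); rewrite ?t1x.
have in12 x : t1 < x < t2 -> tube A L phi (gamma x).
  move=> /andP[t1x xt2]; have [xt0|t0x] := leP x t0.
    by apply: contrapT => nx; apply: (in1 x); rewrite ?t1x.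
  by apply: in02; rewrite t0x.
have [/andP[x0 xL] m0] := axial_bounds Ut0.
have [_ K2 /andP[d02 _] m2] := transit t0lt2 in02.
have [K1 _ /andP[d10 _] m1] := transit t1lt0 in10.
have e2 : axial t2 = L.
  have mt2 : momentum t2 < A / pi by rewrite m2.
  by have [e0|//] := exit_axial K2 mt2 Bt2; lra.
have e1 : axial t1 = 0.
  have mt1 : momentum t1 < A / pi by rewrite -m1.
  by have [//|eL] := exit_axial K1 mt1 Bt1; lra.
have [_ _ /andP[_ d12] _] := transit (lt_trans t1lt0 t0lt2) in12.
apply: (not_trapped t1) => x /andP[t1x xt1]; apply: in12; rewrite t1x /=.
apply: lt_le_trans xt1 _; lra.
Qed.

End Dynamics.

(** * Topology and differentials on compact and convex sets *)

Lemma hausdorff_prod (X Z : topologicalType) :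
  hausdorff_space X -> hausdorff_space Z -> hausdorff_space (X * Z)%type.
Proof.
move=> hX hZ [a b] [a' b'] cl; congr pair.
  apply: hX => A B nA nB.
  have [||[x z] [/= Ax Bx]] := cl (fst @^-1` A) (fst @^-1` B); last by exists x.
    exact: (cvg_fst nA).
  exact: (cvg_fst nB).
apply: hZ => A B nA nB.
have [||[x z] [/= Ax Bx]] := cl (snd @^-1` A) (snd @^-1` B); last by exists z.
  exact: (cvg_snd nA).
exact: (cvg_snd nB).
Qed.

Lemma compact_inverse_continuous (X Z : topologicalType) (K : set X) (f : X -> Z) :
  compact K -> hausdorff_space Z -> {within K, continuous f} ->
  (forall p q, K p -> K q -> f p = f q -> p = q) ->
  forall p, K p -> forall N : set X, nbhs p N ->
    \forall y \near f p, forall q, K q -> f q = y -> N q.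
Proof.
move=> cK hZ fc inj p Kp N nN.
have cC : compact (K `&` ~` N°).
  by apply: compact_closedI => //; apply: open_closedC; exact: open_interior.
have ccl : closed (f @` (K `&` ~` N°)).
  apply: compact_closed => //; apply: continuous_compact => //.
  by apply: continuous_subspaceW fc; exact: subIsetl.
have no : (~` (f @` (K `&` ~` N°))) (f p).
  by move=> [q [Kq nq] qp]; apply: nq; rewrite (inj q p).
apply: filterS (open_nbhs_nbhs (conj (closed_openC ccl) no)) => y ny q Kq qy.
apply: contrapT => nNq; apply: ny; exists q => //; split=> //.
by move=> /nbhs_singleton.
Qed.

Section ConvexDifferential.
Context {R : realType} {E V : normedModType R}.

(** On a convex set with interior points the differential at a boundary point
    is determined by the values on the set, since it is determined on the
    vectors that point into the set. *)
Lemma diff_eq_on_convex (K : set E) (g h : E -> V) (p : E) :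
  nbhs 0 K -> K p ->
  (forall q, K q -> forall s : R, 0 <= s <= 1 -> K (p + s *: (q - p))) ->
  differentiable g p -> differentiable h p ->
  (\forall q \near p, K q -> g q = h q) ->
  'd g p = 'd h p :> (E -> V).
Proof.
move=> K0 Kp conv gd hd gh.
have fd : is_diff p (fun x => g x - h x) (fun x => 'd g p x - 'd h p x).
  exact: is_diffB (differentiableP gd) (differentiableP hd).
have [fdiff fdE] := is_diffW fd.
have zero q : K q -> 'd g p (q - p) - 'd h p (q - p) = 0.
  move=> Kq; apply/eqP; rewrite -normr_le0; apply/ler_addgt0Pl => e e0.
  rewrite addr0; pose e' := e / (`|q - p| + 1).
  have n1 : 0 < `|q - p| + 1 by rewrite ltr_wpDl.
  have e'0 : 0 < e' by rewrite divr_gt0.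
  pose P y := (K y -> g y = h y) /\
    `|g y - h y - (g p - h p) - 'd (fun x => g x - h x) p (y - p)| <= e' * `|y - p|.
  have nP : nbhs p P by exact: filterI gh (diff_le fdiff e'0).
  pose l (s : R^o) := p + s *: (q - p).
  have lc : {for 0, continuous l}.
    by apply: cvgD; [exact: cvg_cst|apply: cvgZr_tmp; exact: cvg_id].
  have l0 : l 0 = p by rewrite /l scale0r addr0.
  have nP' : nbhs (l 0) P by rewrite l0.
  have [r r0 Hr] := (nbhs_ballP _ _).1 (lc P nP').
  rewrite /= in r0.
  have [s [s0 sr s1]] : exists s : R, [/\ 0 < s, s < r & s <= 1].
    by exists (Num.min (r / 2) 1); rewrite lt_min gt_min ge_min lexx orbT ltr01 andbT
      divr_gt0 // ltr_pdivrMr // ltr_pMr // ltr1n.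
  have [gls dle] : P (l s).
    by apply: Hr; rewrite -ball_normE /= sub0r normrN gtr0_norm.
  have Ks : K (l s) by apply: conv => //; rewrite s1 ltW.
  have gp : g p = h p by exact: (nbhs_singleton gh).
  move: dle; rewrite (gls Ks) gp !subrr sub0r normrN fdE.
  have -> : l s - p = s *: (q - p) by rewrite /l addrC addKr.
  have -> : 'd g p (s *: (q - p)) - 'd h p (s *: (q - p)) =
      s *: ('d g p (q - p) - 'd h p (q - p)).
    have gZ : 'd g p (s *: (q - p)) = s *: 'd g p (q - p) by exact: linearZ.
    have hZ : 'd h p (s *: (q - p)) = s *: 'd h p (q - p) by exact: linearZ.
    by rewrite gZ hZ; exact/esym/scalerBr.
  rewrite !normrZ (gtr0_norm s0) mulrCA ler_pM2l //.
  move=> /le_trans; apply; rewrite /e' mulrAC ler_pdivrMr // ler_pM2l //.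
  by rewrite lerDl.
apply/funext => v; apply/eqP; rewrite -subr_eq0; apply/eqP.
pose l (s : R^o) := s *: v.
have lc : {for 0, continuous l} by apply: cvgZr_tmp; exact: cvg_id.
have l0 : l 0 = 0 by rewrite /l scale0r.
have K0' : nbhs (l 0) K by rewrite l0.
have [r r0 Hr] := (nbhs_ballP _ _).1 (lc K K0').
rewrite /= in r0; pose s := r / 2; have s0 : 0 < s by rewrite divr_gt0.
have Ks : K (s *: v).
  apply: Hr; rewrite -ball_normE /= sub0r normrN gtr0_norm //.
  by rewrite ltr_pdivrMr // ltr_pMr // ltr1n.
have K00 : K 0 by exact: nbhs_singleton K0.
have agree q : K q -> 'd g p q - 'd h p q = 'd g p p - 'd h p p.
  have gB : 'd g p (q - p) = 'd g p q - 'd g p p by exact: linearB.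
  have hB : 'd h p (q - p) = 'd h p q - 'd h p p by exact: linearB.
  have key (a b x y : V) : a - b - (x - y) = 0 -> a - x = b - y.
    move=> /subr0_eq/eqP; rewrite subr_eq => /eqP ->.
    by rewrite -[x - y + b]addrA [x + _]addrC addrK addrC.
  by move=> /zero; rewrite gB hB; exact: key.
have gZ : 'd g p (s *: v) = s *: 'd g p v by exact: linearZ.
have hZ : 'd h p (s *: v) = s *: 'd h p v by exact: linearZ.
have g0 : 'd g p 0 = 0 by exact: linear0.
have h0 : 'd h p 0 = 0 by exact: linear0.
have a0 : 'd g p p - 'd h p p = 0 by rewrite -(agree _ K00) g0 h0 subrr.
have : s *: ('d g p v - 'd h p v) = 0.
  by rewrite scalerBr -gZ -hZ; exact: etrans (agree _ Ks) a0.
by move=> /eqP; rewrite scaler_eq0 gt_eqF //= => /eqP.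
Qed.

End ConvexDifferential.

(** * A symplectic ball below the graph *)

Section Ball.
Context {R : realType} {Y : topologicalType}.
Variable S : charted 'rV[R]_3 Y.
Variables (lam : form1 S) (A L : R) (phi : (R^o * 'rV[R]_2)%type -> Y).
Hypothesis hY : closed_oriented_manifold S.
Hypothesis hlam : contact_form lam.
Hypothesis A0 : 0 < A.
Hypothesis L0 : 0 < L.
Hypothesis hphi : thickened_reeb_trajectory lam A L phi.
Variables (c eta k r : R).
Hypotheses (c0 : 0 < c) (eta0 : 0 < eta) (k0 : 0 < k) (r0 : 0 < r).
Hypothesis fit : (1 + 3 * k * r) * (eta + A / pi / (L / 2) ^+ 2 * (r / k) ^+ 2) + r ^+ 2
  < A / pi * (1 - c).

Local Notation E := (R^o * 'rV[R]_2)%type.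
Local Notation K := [set p : E | 0 <= p.1 <= L /\ disk A p.2].
Local Notation H := (tube_bump A L c eta).
Local Notation B := [set q : 'rV[R]_4 | sqnorm q <= r ^+ 2].
Local Notation X q i := (q ord0 (inord i : 'I_4)).

Let hS : smooth_atlas S. Proof. by case: hY. Qed.
Let FE : frame (E : normedModType R) := frame_prod frame_line (frame_rV 2).

(** The exponential of the coordinate s of the symplectization. The product of
    its slope k with that of the axial coordinate q_1 / k + L / 2 is 1, so that the
    map is symplectic; the translation by 2 r makes s positive on the ball of
    radius r. *)
Definition liouville_exp (q : 'rV[R]_4) : R^o := 1 + k * (X q 0 + 2 * r).

Definition plane_part (q : 'rV[R]_4) : 'rV[R]_2 := \row_j X q j.+2.

Definition ball_tube (q : 'rV[R]_4) : E :=
  (k^-1 * X q 1 + L / 2, expR (- (ln (liouville_exp q) / 2)) *: plane_part q).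

Definition ball_map (q : 'rV[R]_4) : (R^o * Y)%type :=
  (ln (liouville_exp q), phi (ball_tube q)).

Lemma sqnorm4E (q : 'rV[R]_4) :
  sqnorm q = X q 0 ^+ 2 + X q 1 ^+ 2 + X q 2 ^+ 2 + X q 3 ^+ 2.
Proof.
rewrite /sqnorm !big_ord_recl big_ord0 addr0 !addrA.
by do 3 (congr (_ + _); last by congr (q _ _ ^+ 2); apply: val_inj; rewrite /= inordK);
  congr (q _ _ ^+ 2); apply: val_inj; rewrite /= inordK.
Qed.

Lemma sqnorm_plane (q : 'rV[R]_4) : sqnorm (plane_part q) = X q 2 ^+ 2 + X q 3 ^+ 2.
Proof. by rewrite sqnorm2E !mxE. Qed.

Lemma sqnormZ n a (z : 'rV[R]_n) : sqnorm (a *: z) = a ^+ 2 * sqnorm z.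
Proof. by rewrite /sqnorm mulr_sumr; apply: eq_bigr => i _; rewrite mxE exprMn. Qed.

Lemma liouville_exp_itv q : B q -> 1 < liouville_exp q <= 1 + 3 * k * r.
Proof.
rewrite /= sqnorm4E => qr; have : X q 0 ^+ 2 <= r ^+ 2.
  have := sqr_ge0 (X q 1); have := sqr_ge0 (X q 2); have := sqr_ge0 (X q 3); lra.
move=> q0r; have : `|X q 0| <= r.
  rewrite -(ler_pXn2r (_ : 0 < 2)%N) ?nnegrE ?normr_ge0 ?(ltW r0) //.
  by rewrite real_normK ?num_real.
move=> /ler_normlP[xl xu].
have pos : 0 < X q 0 + 2 * r by move: (X q 0) xl r0 => x xl; lra.
rewrite /liouville_exp ltrDl mulr_gt0 //=.
rewrite lerD2l (_ : 3 * k * r = k * (3 * r)); last by ring.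
by rewrite ler_pM2l //; lra.
Qed.

Lemma liouville_exp_gt0 q : B q -> 0 < liouville_exp q.
Proof. by move=> /liouville_exp_itv/andP[/(lt_trans ltr01)]. Qed.

(** Multiplied by expR s, the constant and axial terms of the height are bounded
    by the product in the hypothesis fit, and the term |z|^2 becomes the squared
    norm of the last two coordinates of q. *)
Lemma ball_height q : B q ->
  liouville_exp q * height A L eta (ball_tube q) < A / pi * (1 - c).
Proof.
move=> Bq; have /andP[rho1 rho3] := liouville_exp_itv Bq.
have rho0 := liouville_exp_gt0 Bq.
apply: le_lt_trans fit; rewrite /height /= sqnormZ sqnorm_plane addrK.
have -> : expR (- (ln (liouville_exp q) / 2)) ^+ 2 = (liouville_exp q)^-1.
  by rewrite -expRM_natl mulrN mulrC divfK // expRN lnK // posrE.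
move: Bq; rewrite /= sqnorm4E => qr.
have q0 := sqr_ge0 (X q 0); have q1 := sqr_ge0 (X q 1).
have q2 := sqr_ge0 (X q 2); have q3 := sqr_ge0 (X q 3).
set rho := liouville_exp q in rho1 rho3 rho0 *; set M := A / pi / _.
have M0 : 0 <= M by rewrite /M divr_ge0 ?sqr_ge0 // divr_ge0 ?pi_ge0 // ltW.
have rn0 : rho != 0 by rewrite gt_eqF.
rewrite [leLHS](_ : _ = rho * (eta + M * (k^-1 * X q 1) ^+ 2) + (X q 2 ^+ 2 + X q 3
  ^+ 2));
  last by field; rewrite rn0 gt_eqF.
apply: lerD; last by lra.
apply: ler_pM => //; first exact: ltW.
  by apply: addr_ge0; [exact: ltW|rewrite mulr_ge0 ?sqr_ge0].
rewrite lerD2l ler_wpM2l // expr_div_n exprMn exprVn mulrC.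
by rewrite ler_wpM2r ?invr_ge0 ?sqr_ge0 //; lra.
Qed.

Lemma ball_tube_interior q : B q -> tube_interior A L (ball_tube q).
Proof.
move=> Bq; apply: (height_le_interior A0 L0 eta0); apply: ltW.
have /andP[rho1 _] := liouville_exp_itv Bq.
have h0 := height_gt0 L A0 eta0 (ball_tube q).
have r1 : 0 < A / pi by rewrite divr_gt0 // pi_gt0.
apply: (@lt_trans _ _ (liouville_exp q * height A L eta (ball_tube q))).
  have key (x y : R) : 0 < y -> 1 < x -> y < x * y by move=> y0 x1; rewrite ltr_pMl.
  exact: key.
by apply: lt_trans (ball_height Bq) _; rewrite gtr_pMr // ltrBlDr ltrDl.
Qed.

Lemma ball_below_bump q : B q -> 0 < ln (liouville_exp q) < H (ball_tube q).
Proof.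
move=> Bq; have /andP[rho1 _] := liouville_exp_itv Bq.
have rho0 := liouville_exp_gt0 Bq.
have h0 := height_gt0 L A0 eta0 (ball_tube q).
have r1 : 0 < A / pi by rewrite divr_gt0 // pi_gt0.
rewrite ln_gt0 //=.
apply: lt_le_trans (soft_pos_ge c0 _).
have fitq := ball_height Bq.
have c1 : 0 < 1 - c.
  by rewrite -(pmulr_rgt0 _ r1); apply: lt_trans fitq; rewrite mulr_gt0.
have : ln (liouville_exp q * height A L eta (ball_tube q)) < ln (A / pi * (1 - c)).
  by rewrite ltr_ln // posrE mulr_gt0.
have rE : ln (A / pi * (1 - c)) = ln (A / pi) + ln (1 - c) by rewrite lnM ?posrE.
rewrite rE [ln (liouville_exp q * _)]lnM ?posrE // => H1.
have : ln (1 - c) <= - c by apply: le_ln1Dx; rewrite ltrN2 -subr_gt0.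
lra.
Qed.

Definition liouville_domain : set 'rV[R]_4 := [set q | 0 < liouville_exp q].

Let X_k i n (U : set 'rV[R]_4) : Ck n U (fun q : 'rV[R]_4 => X q i : R^o).
Proof. by apply: (@Ck_linear R _ R^o n U (@rV_coord R 4 (inord i))); exact:
  coord_continuous. Qed.

Lemma liouville_exp_smooth n : Ck n setT liouville_exp.
Proof.
exact: (CkD openT (Ck_cst n setT (1 : R^o)) (CkM openT (Ck_cst n setT (k : R^o))
  (CkD openT (X_k 0 n setT) (Ck_cst n setT (2 * r : R^o))))).
Qed.

Lemma liouville_domain_open : open liouville_domain.
Proof.
apply: (@open_comp _ _ liouville_exp [set x : R^o | 0 < x]).
  by move=> x _; exact: (liouville_exp_smooth 0).
exact: open_gt.
Qed.

Lemma liouville_coord_smooth n : Ck n liouville_domain (fun q => ln (liouville_exp q)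
  : R^o).
Proof.
exact: (Ck_comp frame_line liouville_domain_open (fun _ => id)
  (Ck_sub (@subsetT _ liouville_domain) (liouville_exp_smooth n)) (Ck_ln n)).
Qed.

Let contraction (q : 'rV[R]_4) : R^o := expR (- (ln (liouville_exp q) / 2)).

Let contraction_k n : Ck n liouville_domain contraction.
Proof.
have h := CkN liouville_domain_open (CkM liouville_domain_open
  (liouville_coord_smooth n) (Ck_cst n liouville_domain (2^-1 : R^o))).
exact: (Ck_comp frame_line liouville_domain_open (fun _ _ => I) h (Ck_expR n openT)).
Qed.

Fact plane_part_linear : linear plane_part.
Proof. by move=> a q q'; apply/rowP => j; rewrite !mxE. Qed.

Let plane_k n : Ck n liouville_domain plane_part.
Proof.
apply: (Ck_rV liouville_domain_open) => j.
apply: (Ck_eq liouville_domain_open _ (X_k j.+2 n _)) => q _.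
by rewrite mxE.
Qed.

Let axis_k n : Ck n liouville_domain (fun q : 'rV[R]_4 => k^-1 * X q 1 + L / 2 : R^o).
Proof.
exact: (CkD liouville_domain_open (CkM liouville_domain_open (Ck_cst n
  liouville_domain (k^-1 : R^o)) (X_k 1 n liouville_domain))
  (Ck_cst n liouville_domain (L / 2 : R^o))).
Qed.

Lemma ball_tube_smooth n : Ck n liouville_domain ball_tube.
Proof.
exact: (Ck_pair liouville_domain_open (axis_k n) (CkZ liouville_domain_open
  (contraction_k n) (plane_k n))).
Qed.

Definition ball_form (q u : 'rV[R]_4) : R :=
  liouville_exp q * (k^-1 * X u 1) + (X q 2 * X u 3 - X q 3 * X u 2) / 2.

(** Contracting the discs by the factor expR (- s / 2) makes the pulled back
    form free of the derivatives of this factor. *)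
Lemma pullback_ball_tube q u : liouville_domain q ->
  liouville_exp q * box_form (ball_tube q) ('d ball_tube q u) = ball_form q u.
Proof.
move=> oq; have rho0 : 0 < liouville_exp q := oq.
have ad : differentiable (fun q : 'rV[R]_4 => k^-1 * X q 1 + L / 2 : R^o) q.
  by have [+ _] := axis_k 1; exact.
have cd : differentiable contraction q by have [+ _] := contraction_k 1; exact.
have pd : differentiable plane_part q by have [+ _] := plane_k 1; exact.
have [zd zE] := is_diffW (is_diff_scale cd pd).
rewrite [Z in box_form _ Z](_ : _ =
    ('d (fun q : 'rV[R]_4 => k^-1 * X q 1 + L / 2 : R^o) q u,
     'd (fun q => contraction q *: plane_part q) q u)); last first.
  by rewrite -[ball_tube]/(fun q : 'rV[R]_4 => (k^-1 * X q 1 + L / 2 : R^o,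
    contraction q *: plane_part q))
    (diff_pair ad zd).
have [m mE] := exists_linear plane_part_linear.
have pE : 'd plane_part q u = plane_part u.
  rewrite mE diff_lin //; exact: linear_frame_continuous (frame_rV 4) m.
have aE : 'd (fun q : 'rV[R]_4 => k^-1 * X q 1 + L / 2 : R^o) q u = k^-1 * X u 1.
  rewrite -(deriveE _ ad).
  have Xd : derivable (@rV_coord R 4 (inord 1)) q u.
    apply: diff_derivable; apply: linear_differentiable; exact: coord_continuous.
  rewrite (_ : (fun q => _) = k^-1 *: (@rV_coord R 4 (inord 1)) + cst (L / 2 : R^o)) //.
  rewrite deriveD; [|exact: derivableZ|exact: derivable_cst].
  rewrite derive_cst addr0 deriveZ // derive_linear //; exact: coord_continuous.
rewrite aE zE pE /box_form /ball_form /=.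
have cE : contraction q ^+ 2 = (liouville_exp q)^-1.
  by rewrite -expRM_natl mulrN mulrC divfK // expRN lnK // posrE.
rewrite -/(contraction q) !mxE /=.
move: ('d contraction q u) => d; move: (contraction q) cE => a.
set rho := liouville_exp q in rho0 *; rewrite expr2 => aE2.
have rn0 : rho != 0 by rewrite gt_eqF.
have key : rho * (a * a) = 1 by rewrite aE2 divff.
have -> : (X q 2 * X u 3 - X q 3 * X u 2) / 2 =
    rho * (a * a) * ((X q 2 * X u 3 - X q 3 * X u 2) / 2) by rewrite key mul1r.
by field; rewrite gt_eqF.
Qed.

End Ball.

Section BallEmbedding.
Context {R : realType} {Y : topologicalType}.
Variable S : charted 'rV[R]_3 Y.
Variables (lam : form1 S) (A L : R) (phi : (R^o * 'rV[R]_2)%type -> Y).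
Hypothesis hY : closed_oriented_manifold S.
Hypothesis hlam : contact_form lam.
Hypothesis A0 : 0 < A.
Hypothesis L0 : 0 < L.
Hypothesis hphi : thickened_reeb_trajectory lam A L phi.
Variables (c eta k r : R).
Hypotheses (c0 : 0 < c) (eta0 : 0 < eta) (k0 : 0 < k) (r0 : 0 < r).
Hypothesis fit : (1 + 3 * k * r) * (eta + A / pi / (L / 2) ^+ 2 * (r / k) ^+ 2) + r ^+ 2
  < A / pi * (1 - c).

Local Notation E := (R^o * 'rV[R]_2)%type.
Local Notation V4 := (R^o * 'rV[R]_3)%type.
Local Notation B := [set q : 'rV[R]_4 | sqnorm q <= r ^+ 2].
Local Notation X q i := (q ord0 (inord i : 'I_4)).
Local Notation dom := (liouville_domain k r).
Local Notation Phi := (ball_map L phi k r).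

Let hS : smooth_atlas S. Proof. by case: hY. Qed.
Let slam : smooth_form1 lam. Proof. by case: hlam. Qed.
Let FE : frame (E : normedModType R) := frame_prod frame_line (frame_rV 2).
Let FV : frame (V4 : normedModType R) := frame_prod frame_line (frame_rV 3).

Lemma ball_chart q (i : chart_idx S) : B q -> chart_dom i (phi (ball_tube L k r q)) ->
  exists M (G : 'rV[R]_4 -> V4), [/\ open M, M q, forall n, Ck n M G &
    forall q', M q' -> [/\ @chart_dom _ _ _ (line_prod S) i (Phi q'),
      @chart_coord _ _ _ (line_prod S) i (Phi q') = G q' &
      forall u, liouville lam i (Phi q') ('d G q' u) = ball_form k r q' u]].
Proof.
move=> Bq di; have Ip := ball_tube_interior A0 L0 c0 eta0 k0 r0 fit Bq.
have [N [g [oN Np NI gk Ng]]] := tube_chart hY hphi Ip di.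
have oD : open dom by exact: liouville_domain_open.
have tk n := ball_tube_smooth L k r n.
pose M := dom `&` ball_tube L k r @^-1` N.
have oM : open M by apply: open_preimage_on => // x Dx; exact: (tk 0%N).
have MD : M `<=` dom by exact: subIsetl.
have lk n : Ck n M (fun q => ln (liouville_exp k r q) : R^o).
  exact: Ck_sub MD (liouville_coord_smooth k r n).
have gtk n : Ck n M (g \o ball_tube L k r).
  exact: (Ck_comp FE oM (fun x Mx => Mx.2) (Ck_sub MD (tk n)) (gk n)).
exists M, (fun q => (ln (liouville_exp k r q) : R^o, g (ball_tube L k r q))).
split=> //.
- by split=> //; exact: liouville_exp_gt0 Bq.
- by move=> n; exact: (Ck_pair oM (lk n) (gtk n)).
move=> q' [Dq' Nq']; have [dq' gq' _ lamE] := Ng _ Nq'.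
split; [exact: dq'|by rewrite /= gq'|move=> u].
have ld : differentiable (fun q => ln (liouville_exp k r q) : R^o) q'.
  by have [+ _] := lk 1%N; apply; split.
have gtd : differentiable (g \o ball_tube L k r) q'.
  by have [+ _] := gtk 1%N; apply; split.
have td : differentiable (ball_tube L k r) q' by have [+ _] := tk 1%N; apply.
have gd : differentiable g (ball_tube L k r q') by have [+ _] := gk 1%N; apply.
rewrite (diff_pair ld gtd) (diff_comp td gd) /liouville /= lamE.
rewrite lnK; last by rewrite posrE.
exact: pullback_ball_tube.
Qed.

Lemma derive_ball_form (q u v : 'rV[R]_4) :
  'D_u (fun q => ball_form k r q v : R^o) q =
  k * X u 0 * (k^-1 * X v 1) + (X u 2 * X v 3 - X u 3 * X v 2) / 2.
Proof.
pose l (q : 'rV[R]_4) : R^o :=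
  k * X q 0 * (k^-1 * X v 1) + (X q 2 * X v 3 - X q 3 * X v 2) / 2.
have ll : linear l.
  move=> a x y; rewrite /l !mxE.
  rewrite -[RHS]/(a * (k * X x 0 * (k^-1 * X v 1) + (X x 2 * X v 3 - X x 3 * X v 2) / 2)
    + (k * X y 0 * (k^-1 * X v 1) + (X y 2 * X v 3 - X y 3 * X v 2) / 2)).
  by field; rewrite gt_eqF.
have [m mE] := exists_linear ll.
have mc : continuous m by exact: linear_frame_continuous (frame_rV 4) m.
pose b : R^o := (1 + k * (2 * r)) * (k^-1 * X v 1).
rewrite (_ : (fun q => ball_form k r q v : R^o) = (cst b : _ -> R^o) + m); last first.
  rewrite -mE; apply/funext => x.
  rewrite -[RHS]/(b + l x) /b /l /ball_form /liouville_exp.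
  by field; rewrite gt_eqF.
have dm : differentiable m q by exact: linear_differentiable.
rewrite deriveD; [|exact: derivable_cst|exact: diff_derivable].
by rewrite derive_cst add0r (deriveE _ dm) diff_lin // -mE.
Qed.

Lemma line_prod_parK (i : chart_idx S) x : @chart_im _ _ _ (line_prod S) i x ->
  @chart_dom _ _ _ (line_prod S) i (@chart_par _ _ _ (line_prod S) i x) /\
  @chart_coord _ _ _ (line_prod S) i (@chart_par _ _ _ (line_prod S) i x) = x.
Proof. by move=> [[s y] /= dy <-] /=; rewrite (chart_coordK hS dy). Qed.

Lemma line_prod_im (i : chart_idx S) :
  @chart_im _ _ _ (line_prod S) i = [set x | chart_im i x.2].
Proof.
apply/seteqP; split=> [_ [[s y] /= dy <-]|[s x] /= [y dy yx]]; first exact: chart_imP.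
by exists (s, y); rewrite //= yx.
Qed.

Lemma liouville_coef_smooth (i : chart_idx S) w :
  smooth_open (@chart_im _ _ _ (line_prod S) i)
    (fun x => liouville lam i (@chart_par _ _ _ (line_prod S) i x) w : R^o).
Proof.
rewrite line_prod_im; have oI : open [set x : V4 | chart_im i x.2].
  apply: (@open_comp _ _ snd (chart_im i)); last exact: chart_im_open.
  by move=> x _; exact: cvg_snd.
split=> // n; have fk : Ck n [set x : V4 | chart_im i x.2] (fst : V4 -> R^o).
  by apply: (@Ck_linear R _ R^o n _ fst) => x; exact: cvg_fst.
have sk : Ck n [set x : V4 | chart_im i x.2] (snd : V4 -> 'rV[R]_3).
  by apply: (@Ck_linear R _ 'rV[R]_3 n _ snd) => x; exact: cvg_snd.
have ek := Ck_comp frame_line oI (fun _ _ => I) fk (Ck_expR n openT).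
have [_ _ /(_ i w.2)[_ lk]] := slam.
exact: (CkM oI ek (Ck_comp (frame_rV 3) oI (fun _ => id) sk (lk n))).
Qed.

Lemma ext_d_ball q (i : chart_idx S) (M : set 'rV[R]_4) (G : 'rV[R]_4 -> V4) u v :
  open M -> M q -> (forall n, Ck n M G) ->
  (forall q', M q' -> [/\ @chart_dom _ _ _ (line_prod S) i (Phi q'),
      @chart_coord _ _ _ (line_prod S) i (Phi q') = G q' &
      forall u, liouville lam i (Phi q') ('d G q' u) = ball_form k r q' u]) ->
  ext_d (liouville lam) i (Phi q) ('d G q u) ('d G q v) = omega_std q u v.
Proof.
move=> oM Mq Gk MG.
have parE q' : M q' -> @chart_par _ _ _ (line_prod S) i (G q') = Phi q'.
  move=> /MG[dq' <- _]; rewrite /= (chart_coordK hS dq').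
  by [].
rewrite -(parE q Mq).
rewrite (@ext_d_pullback R V4 'rV[R]_4 FV (R^o * Y)%type (line_prod S) (liouville lam) i
  M G (ball_form k r)) //.
- rewrite !derive_ball_form /omega_std.
  by field; rewrite gt_eqF.
- exact: line_prod_parK.
- move=> [s y] /= dy a w w'; have [al_lin _ _] := slam.
  by rewrite /liouville /= al_lin //; ring.
- exact: liouville_coef_smooth.
- by move=> q' /MG[dq' <- _]; exists (Phi q').
- by move=> q' Mq' w; rewrite parE //; have [_ _ ->] := MG q' Mq'.
Qed.

Lemma ball_map_inj q q' : B q -> B q' -> Phi q = Phi q' -> q = q'.
Proof.
move=> Bq Bq' [lnE phiE].
have inK x : B x -> [set p : E | 0 <= p.1 <= L /\ disk A p.2] (ball_tube L k r x).
  by move=> Bx; apply: tube_interior_sub; exact: (ball_tube_interior A0 L0 c0 eta0 k0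
    r0 fit Bx).
have tE : ball_tube L k r q = ball_tube L k r q'.
  by rewrite -(tube_invK hphi (inK q Bq)) phiE (tube_invK hphi (inK q' Bq')).
have rhoE : liouville_exp k r q = liouville_exp k r q'.
  by apply: (@ln_inj R) => //; rewrite posrE; exact: liouville_exp_gt0.
move: tE; rewrite /ball_tube rhoE => -[axisE planeE].
have kn0 : k != 0 by rewrite gt_eqF.
have e0 : X q 0 = X q' 0.
  by move: rhoE; rewrite /liouville_exp => /addrI/(mulfI kn0)/addIr.
have e1 : X q 1 = X q' 1.
  by apply: (mulfI (invr_neq0 kn0)); apply: addIr axisE.
have e23 : plane_part q = plane_part q'.
  by apply: (scalerI _ planeE); rewrite gt_eqF // expR_gt0.
apply/rowP => j; rewrite -[j]inord_val; case: j => [[|[|[|[|//]]]] jn] /=.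
- exact: e0.
- exact: e1.
- by have := congr1 (fun z : 'rV[R]_2 => z ord0 ord0) e23; rewrite !mxE.
- by have := congr1 (fun z : 'rV[R]_2 => z ord0 ord_max) e23; rewrite !mxE.
Qed.

Lemma ball4E : ball4 (pi * r ^+ 2) = B.
Proof. by apply/seteqP; split=> q; rewrite /ball4 /= /sqnorm ler_pM2l ?pi_gt0. Qed.

Lemma ball_compact : compact B.
Proof.
apply: bounded_closed_compact; last first.
  apply: (@closed_comp _ _ (@sqnorm R 4 : _ -> R^o) [set x | x <= r ^+ 2]).
    by move=> z _; exact: sqnorm_continuous.
  exact: closed_le.
exists r; split=> [|m rm q Bq]; first exact: num_real.
apply: ltW; apply: le_lt_trans rm.
rewrite [`|q|]mx_normrE; apply: bigmax_le; first exact: ltW.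
move=> -[a b] _ /=; rewrite (ord1 a) -(ler_pXn2r (_ : 0 < 2)%N) ?nnegrE ?normr_ge0
  ?(ltW r0) //.
rewrite real_normK ?num_real //; apply: le_trans Bq; rewrite /sqnorm (bigD1 b) //=
  lerDl.
by apply: sumr_ge0 => j _; exact: sqr_ge0.
Qed.

Lemma ball_convex p q : B p -> B q -> forall s : R, 0 <= s <= 1 -> B (p + s *: (q - p)).
Proof.
move=> Bp Bq s /andP[s0 s1].
apply: (@le_trans _ _ ((1 - s) * sqnorm p + s * sqnorm q)).
  rewrite /sqnorm !mulr_sumr -big_split /=; apply: ler_sum => j _.
  rewrite !mxE; set x := p _ _; set y := q _ _.
  rewrite -subr_ge0 (_ : _ - _ = s * (1 - s) * (x - y) ^+ 2); last by ring.
  by apply: mulr_ge0; [apply: mulr_ge0 => //; rewrite subr_ge0|exact: sqr_ge0].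
have s1' : 0 <= 1 - s by rewrite subr_ge0.
have := ler_wpM2l s1' Bp; have := ler_wpM2l s0 Bq; lra.
Qed.

Lemma ball_nbhs0 : nbhs (0 : 'rV[R]_4) B.
Proof.
have o : open [set q : 'rV[R]_4 | sqnorm q < r ^+ 2].
  apply: (@open_comp _ _ (@sqnorm R 4 : _ -> R^o) [set x | x < r ^+ 2]).
    by move=> z _; exact: sqnorm_continuous.
  exact: open_lt.
apply: filterS (open_nbhs_nbhs (conj o _)) => [q /ltW //|].
by rewrite /= [sqnorm _]big1 ?exprn_gt0 // => j _; rewrite mxE expr0n.
Qed.

(** A map that pulls the symplectic form back to the standard one is an
    immersion. *)
Lemma omega_std_nondegenerate (q u : 'rV[R]_4) :
  (forall v, omega_std q u v = 0) -> u = 0.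
Proof.
move=> H; pose e j : 'rV[R]_4 := delta_mx ord0 (inord j).
have X_e j i : (i < 4)%N -> (j < 4)%N -> X (e j) i = (i == j)%:R.
  by move=> i4 j4; rewrite mxE eqxx /= -val_eqE /= !inordK.
apply/rowP => j; rewrite mxE -[j]inord_val; case: j => [[|[|[|[|//]]]] jn] /=.
- have := H (e 1%N); rewrite /omega_std !X_e //= => h; lra.
- have := H (e 0%N); rewrite /omega_std !X_e //= => h; lra.
- have := H (e 3%N); rewrite /omega_std !X_e //= => h; lra.
- have := H (e 2%N); rewrite /omega_std !X_e //= => h; lra.
Qed.

(** The local expressions of the embedding at a boundary point of the ball may
    differ off the ball, but have the same differential. *)
Lemma ball_map_pullback : pullback2_eq B (ball_map L phi k r : _ -> (R^o * Y)%type)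
  (ext_d (liouville lam)) omega_std.
Proof.
move=> q Bq i g [N [Nq [oN gk] Ng]] u v.
have [dq gq] := Ng q Nq Bq.
have [M [G [oM Mq Gk MG]]] := ball_chart Bq dq.
have -> : 'd g q = 'd G q :> ('rV[R]_4 -> V4).
  apply: (@diff_eq_on_convex _ _ _ B) => //.
  - exact: ball_nbhs0.
  - by move=> q' Bq'; exact: ball_convex.
  - by have [+ _] := gk 1%N; apply.
  - by have [+ _] := Gk 1%N; apply.
  - have nb : nbhs q (N `&` M) by apply: open_nbhs_nbhs; split; [exact: openI|].
    apply: filterS nb => q' [Nq' Mq'] Bq'.
    by have [_ <-] := Ng q' Nq' Bq'; have [_ -> _] := MG q' Mq'.
exact: ext_d_ball oM Mq Gk MG.
Qed.

Lemma ball_map_continuous : {within B, continuous (Phi : _ -> (R^o * Y)%type)}.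
Proof.
apply: continuous_in_subspaceT => q /set_mem Bq.
have [i di] := tube_atlas hY (phi (ball_tube L k r q)).
have [M [G [oM Mq Gk MG]]] := ball_chart Bq di.
have E1 : \forall q' \near q, (G q').1 = (Phi q').1 /\ chart_par i (G q').2 = (Phi
  q').2.
  apply: filterS (open_nbhs_nbhs (conj oM Mq)) => q' Mq'.
  by have [dq' <- _] := MG q' Mq'; rewrite /= (chart_coordK hS dq').
have Gc : {for q, continuous G} by exact: Ck_continuous (Gk 0%N) q Mq.
have [dq gq _] := MG q Mq.
have pc : {for (G q).2, continuous (chart_par i)}.
  by apply: chart_par_continuous => //; rewrite -gq; exact: chart_imP.
have c1 : (G q').1 @[q' --> q] --> (G q).1.
  by apply: (@continuous_comp _ _ _ G (fst : V4 -> R^o)); [exact: Gc|exact: cvg_fst].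
have c2 : chart_par i (G q').2 @[q' --> q] --> chart_par i (G q).2.
  apply: (@continuous_comp _ _ _ (fun q' => (G q').2) (chart_par i)); last exact: pc.
  by apply: (@continuous_comp _ _ _ G (snd : V4 -> _)); [exact: Gc|exact: cvg_snd].
have E2 : \forall q' \near q,
    (((G q').1, chart_par i (G q').2) : (R^o * Y)%type) = Phi q'.
  by apply: filterS E1 => q' [-> ->].
have PhiE : nbhs (Phi q) = nbhs (((G q).1, chart_par i (G q).2) : (R^o * Y)%type).
  by rewrite (nbhs_singleton E2).
rewrite /prop_for /continuous_at.
rewrite PhiE; apply: cvg_trans (near_eq_cvg E2) _.
exact: cvg_pair c1 c2.
Qed.

Lemma ext_d_liouville0 (i : chart_idx S) (p : (R^o * Y)%type) w : chart_dom i p.2 ->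
  ext_d (liouville lam) i p 0 w = 0.
Proof.
move=> dp; rewrite /ext_d derive0 sub0r.
have lam0 y : chart_dom i y -> lam i y 0 = 0.
  move=> dy; have [al_lin _ _] := slam; have := al_lin i y dy 1 0 0.
  rewrite scaler0 addr0 mul1r => h; lra.
have E1 : \forall x \near @chart_coord _ _ _ (line_prod S) i p,
    liouville lam i (@chart_par _ _ _ (line_prod S) i x) 0 = (cst 0 : V4 -> R^o) x.
  have [oI _] := liouville_coef_smooth i 0.
  have ip : @chart_im _ _ _ (line_prod S) i (@chart_coord _ _ _ (line_prod S) i p) by
    exists p.
  apply: filterS (open_nbhs_nbhs (conj oI ip)) => x /line_prod_parK[dx _].
  by rewrite /liouville /= lam0 // mulr0.
by rewrite (near_eq_derive w E1) derive_cst oppr0.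
Qed.

Lemma width_tube_deformation :
  ((pi * r ^+ 2)%:E <= width lam (tube_deformation A L phi c eta))%E.
Proof.
apply: ereal_sup_ubound; exists (pi * r ^+ 2) => //; split.
  by rewrite mulr_gt0 ?pi_gt0 // exprn_gt0.
exists (Phi : _ -> (R^o * Y)%type); rewrite ball4E; split.
- split.
  + move=> q Bq; have [i di] := tube_atlas hY (phi (ball_tube L k r q)).
    have [M [G [oM Mq Gk MG]]] := ball_chart Bq di.
    exists i, G, M; split=> // q' Mq' _.
    by have [] := MG q' Mq'.
  + move=> q Bq i g rep u v uv; apply/subr0_eq/(@omega_std_nondegenerate q) => w.
    have [N [Nq _ Ng]] := rep; have [dq _] := Ng q Nq Bq.
    have uv0 : 'd g q (u - v) = 0 by rewrite linearB /= uv subrr.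
    by rewrite -(ball_map_pullback Bq rep) uv0; exact: ext_d_liouville0.
  + exact: ball_map_inj.
  + apply: compact_inverse_continuous.
    * exact: ball_compact.
    * apply: hausdorff_prod; last by case: hY.
      exact: norm_hausdorff.
    * exact: ball_map_continuous.
    * exact: ball_map_inj.
- move=> q Bq; have /andP[l0 lb] := ball_below_bump A0 c0 eta0 k0 r0 fit Bq.
  rewrite /= l0 /= /tube_deformation mul1r (tube_invK hphi) //.
  by apply: tube_interior_sub; exact: (ball_tube_interior A0 L0 c0 eta0 k0 r0 fit Bq).
- exact: ball_map_pullback.
Qed.

End BallEmbedding.

(** * The inequality *)

(** Stretching the disc of the first two coordinates by a large factor k makes
    it short in the axial direction, at the expense of a height of order k, so
    that the error terms are of order 1 / k. *)
Lemma ball_parameters {R : realFieldType} (s M r : R) : 0 < r -> 0 <= M -> r ^+ 2 < s ->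
  exists c eta k : R, [/\ 0 < c, 0 < eta, eta < s, 0 < k &
    (1 + 3 * k * r) * (eta + M * (r / k) ^+ 2) + r ^+ 2 < s * (1 - c)].
Proof.
move=> r0 M0 rs; have s0 : 0 < s by apply: le_lt_trans rs; exact: sqr_ge0.
set D := s - r ^+ 2; have D0 : 0 < D by rewrite subr_gt0.
pose C := (1 + 3 * r) * (1 + M * r ^+ 2).
have r2 : 0 <= r ^+ 2 by exact: sqr_ge0.
have Mr : 0 <= M * r ^+ 2 by rewrite mulr_ge0.
have C1 : 0 < C by rewrite mulr_gt0 // ltr_pwDl // mulr_ge0 // ltW.
pose k := 1 + 2 * C / D.
have k1 : 1 < k by rewrite /k ltrDl divr_gt0 // mulr_gt0.
have k0 : 0 < k by exact: lt_trans k1.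
have kn0 : k != 0 by rewrite gt_eqF.
have Ck : C / k < D / 2.
  rewrite ltr_pdivrMr // /k mulrDr mulr1.
  have -> : D / 2 * (2 * C / D) = C by field; rewrite gt_eqF.
  by rewrite ltrDr divr_gt0.
have bound : (1 + 3 * k * r) * (k ^- 2 + M * (r / k) ^+ 2) <= C / k.
  have -> : C / k = (k + 3 * k * r) * (1 + M * r ^+ 2) * k ^- 2.
    by rewrite /C; field.
  have -> : k ^- 2 + M * (r / k) ^+ 2 = (1 + M * r ^+ 2) * k ^- 2 by field.
  rewrite mulrA; apply: ler_wpM2r; first by rewrite invr_ge0 sqr_ge0.
  apply: ler_wpM2r; first by rewrite addr_ge0.
  by rewrite lerD2r ltW.
have eta0 : 0 < k ^- 2 by rewrite invr_gt0 exprn_gt0.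
exists (D / (2 * s)), (k ^- 2), k; split=> //.
- by rewrite divr_gt0 // mulr_gt0.
- have : k ^- 2 <= C / k.
    apply: le_trans bound; rewrite -[leLHS]mul1r; apply: ler_pM => //; first exact: ltW.
      by rewrite lerDl !mulr_ge0 // ltW.
    by rewrite lerDl mulr_ge0 ?sqr_ge0.
  have : D <= s by rewrite gerBl.
  by move: (C / k) Ck => e; lra.
- have -> : s * (1 - D / (2 * s)) = r ^+ 2 + D / 2.
    by rewrite /D; field; rewrite gt_eqF.
  by rewrite addrC ltrD2l; exact: le_lt_trans Ck.
Qed.

Theorem proposition1p13 (R : realType) (Y : topologicalType)
    (S : charted 'rV[R]_3 Y) (lam : form1 S) (L : R)
    (hY : closed_oriented_manifold S) (hlam : contact_form lam)
    (hL : (0 < L)%R) :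
  (Box lam L <= Close lam L)%E.
Proof.
apply: ge_ereal_sup => _ [A [A0 [phi hphi]] <-].
apply: le_ereal_inf_tmp => _ [delta [delta0 closing] <-].
rewrite lee_fin leNgt; apply/negP => deltaA.
have pi0 : 0 < pi :> R by exact: pi_gt0.
pose r := Num.sqrt (delta / pi).
have r0 : 0 < r by rewrite sqrtr_gt0 divr_gt0.
have r2 : r ^+ 2 = delta / pi by rewrite sqr_sqrtr // ltW // divr_gt0.
have M0 : 0 <= A / pi / (L / 2) ^+ 2.
  by rewrite divr_ge0 ?sqr_ge0 // divr_ge0 // ltW.
have rA : r ^+ 2 < A / pi by rewrite r2 ltr_pM2r ?invr_gt0.
have [c [eta [k [c0 eta0 etaA k0 fit]]]] := ball_parameters r0 M0 rA.
have [tau [tau01 [a [gamma [orbit aL [t tube_t]]]]]] :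
    exists tau : R, 0 <= tau <= 1 /\ exists (a : R) (gamma : R -> Y),
    [/\ reeb_orbit (deform lam (tube_deformation A L phi c eta) tau) a gamma, a <= L &
        exists t, tube A L phi (gamma t)].
  apply: closing.
  - exact: tube_open hY hphi.
  - have mid : height A L eta (L / 2, 0) < A / pi.
      by rewrite height_center.
    by exists (phi (L / 2, 0)), (L / 2, 0) => //; exact/height_le_interior/ltW/mid.
  - exact: (tube_positive_deformation hY hlam A0 hL hphi c0 eta0 etaA).
  - have -> : delta = pi * r ^+ 2 by rewrite r2 mulrC divfK // gt_eqF.
    exact: (width_tube_deformation hY hlam A0 hL hphi c0 eta0 k0 r0 fit).
exact: (no_short_orbit hY hlam A0 hL hphi c0 eta0 tau01 orbit aL tube_t).
Qed.
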